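(* Let $0<\alpha<2$ and $\lambda>0$. For $x\in\mathbb{R}$ and $t>0$ let $$Z_t^{\lambda V}(x)=E_x\Big[\exp\Big\{-\frac\lambda2\int_0^t\frac{ds}{1+|B_s|^\alpha}\Big\}\Big].$$ Then, for every $x\in\mathbb{R}$, $$\lim_{t\to\infty}\Big(t^{\frac{\alpha-2}{\alpha+2}}\ln\big(Z_t^{\lambda V}(x)\big)\Big)=-\frac12 I_0(\lambda),$$ where $$I_0(\lambda)=\inf_{\psi\in\mathcal{C}_0}\Big\{\int_0^1\dot\psi^2(s)\,ds+\lambda\int_0^1\frac{ds}{|\psi(s)|^\alpha}\Big\}$$ belongs to $]0,+\infty[$.
   Context: $(B_t)$ is a one-dimensional Brownian motion started at $x$ under $P_x$ (expectation $E_x$). $\mathcal{C}_0$ is the set of continuous functions $\psi:[0,1]\to\mathbb{R}$ with $\psi(0)=0$; $\int_0^1\dot\psi^2(s)ds$ is taken to be $+\infty$ if $\psi$ is not absolutely continuous with square-integrable derivative. *)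

(* Defs.v *)
From HB Require Import structures.
From mathcomp Require Import all_boot all_order all_algebra.
From mathcomp Require Import all_classical all_reals all_analysis.

Set Implicit Arguments.
Unset Strict Implicit.
Unset Printing Implicit Defensive.

Import Order.TTheory GRing.Theory Num.Theory.
Import numFieldTopology.Exports numFieldNormedType.Exports.

Local Open Scope classical_set_scope.
Local Open Scope ring_scope.

Section brownian.
Context {d : measure_display} {T : measurableType d} {R : realType}.
Variable P : probability T R.

Definition mutually_independent (n : nat) (X : 'I_n -> T -> R) : Prop :=
  forall A : 'I_n -> set R, (forall i, measurable (A i)) ->
    (P [set w | forall i, A i (X i w)] = \prod_(i < n) P (X i @^-1` A i))%E.

(* Time is the half-line [0, +oo[: the values of B at negative times are junk
   and are never constrained or used. *)
Record brownian_motion (x : R) (B : R -> {RV P >-> R}) : Prop := {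
  bm_start : P [set w | B 0 w = x] = 1%E ;
  bm_independent_increments : forall (t : nat -> R) (n : nat),
    0 <= t 0%N -> {homo t : i j / (i <= j)%N >-> i <= j} ->
    mutually_independent (fun (i : 'I_n) w => B (t i.+1) w - B (t i) w) ;
  (* the second parameter of normal_prob is the standard deviation *)
  bm_normal_increments : forall (s t : R), 0 <= s -> s < t ->
    forall A : set R, measurable A ->
      P [set w | A (B t w - B s w)] = normal_prob 0 (Num.sqrt (t - s)) A ;
  bm_continuous_paths : forall w,
    {within `[0, +oo[, continuous (fun t => B t w)} }.

Definition Z (alpha lambda : R) (B : R -> {RV P >-> R}) (t : R) : R :=
  fine ('E_P[fun w => expR (- (lambda / 2) *
    \int[lebesgue_measure]_(s in `[0%R, t]) (1 + `|B s w| `^ alpha)^-1)])%E.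

End brownian.

Arguments brownian_motion {d T R} P x B.
Arguments Z {d T R} P alpha lambda B t.

Section action.
Context {R : realType}.
Local Notation mu := (@lebesgue_measure R).

Definition abs_continuous (a b : R) (f : R -> R) : Prop :=
  forall e : R, 0 < e -> exists2 delta : R, 0 < delta &
    forall (n : nat) (u v : 'I_n -> R),
      (forall i, [/\ a <= u i, u i <= v i & v i <= b]) ->
      trivIset [set: 'I_n] (fun i => `]u i, v i[%classic) ->
      \sum_(i < n) (v i - u i) < delta ->
      \sum_(i < n) `|f (v i) - f (u i)| < e.

(* Elements of C_0 are represented by functions on R, of which only the values
   on [0, 1] matter. *)
Definition C0 : set (R -> R) :=
  [set psi : R -> R | {within `[0 : R, 1 : R], continuous psi} /\ psi 0 = 0].

(* If psi is absolutely continuous but its derivative (which exists a.e.) is not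
   square-integrable, the integral is itself +oo. *)
Definition energy (psi : R -> R) : \bar R :=
  if `[< abs_continuous 0 1 psi >]
  then (\int[mu]_(s in `[0%R, 1%R]) ((psi^`()%classic s) ^+ 2)%:E)%E
  else +oo%E.

(* The inverse is taken in \bar R, where 0^-1 = +oo (in R it would be 0). *)
Definition action (alpha lambda : R) (psi : R -> R) : \bar R :=
  (energy psi +
   lambda%:E * \int[mu]_(s in `[0%R, 1%R]) ((`|psi s| `^ alpha)%:E)^-1)%E.

Definition I0 (alpha lambda : R) : \bar R :=
  ereal_inf [set action alpha lambda psi | psi in C0].

End action.

(* Main.v *)
(* Brownian scaling turns [B] on [0, t] into [t `^ scale] times a path on [0, 1], and
   both the energy and the potential of the scaled path get the factor [t `^ rate].

   The partition function is a limit of expectations of exponentials of Riemann sums,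
   so only finitely many independent Gaussian increments are used at a time.

   Upper bound: on a grid of [n] points, a broken line of given increments can be
   turned into a competitor for [I0] by replacing it with the running maximum of its
   modulus, started by a rise [s `^ beta] with [1/2 < beta < 1/alpha], at a cost that
   vanishes with [1/n]. Hence the weight is at most
   [exp (- t `^ rate / 2 * theta * (I0 - o(1)) + theta * sum of X_i ^+ 2 / (2 * s_i ^+ 2))],
   and the last exponential has a mean independent of [t] for [theta < 1].

   Lower bound: given a path of nearly minimal action, replace it with the running
   maximum of its modulus plus [c * s `^ beta], and shift the increments along it
   (Cameron-Martin). The fluctuations exceed a small proportion of this path with
   a probability so small that, after integration in time, they only cost a constant. *)

Require Import Defs.
From HB Require Import structures.
From mathcomp Require Import all_boot all_order all_algebra.
From mathcomp Require Import all_classical all_reals all_analysis.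
From mathcomp Require Import measurable_realfun.
From mathcomp Require Import ring lra.

Set Implicit Arguments.
Unset Strict Implicit.
Unset Printing Implicit Defensive.

Import Order.TTheory GRing.Theory Num.Theory.
Import numFieldTopology.Exports numFieldNormedType.Exports.

Local Open Scope classical_set_scope.
Local Open Scope ring_scope.

(** * Absolutely continuous functions *)

(** The potential in [action] is singular at 0, where every competitor starts: a path that leaves 0
    linearly has infinite action once [alpha >= 1]. A start as [s^beta] has finite energy if
    [2 * beta > 1] and finite potential if [alpha * beta < 1]; both are possible because
    [alpha < 2]. In [Z] the potential is regularized by the 1 in [1 + |b|^alpha], which scaling
    turns into [t^(- alpha * scale)]. Paths charged by [Z] may thus linger at 0 and must be lifted
    before they are compared with [I0]. Passing to the running maximum of the modulus increases
    neither energy nor potential, and over a step a nondecreasing path stays above its initial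
    value.

    [energy] is written with the pointwise derivative of an absolutely continuous function. It is
    handled through two facts: [(psi v - psi u)^2 <= (v - u) * (Phi v - Phi u)] with [Phi] a
    primitive of the squared density, a bound inherited by the running supremum; and a primitive of
    a density has at most the energy of that density. The first fact rests on the existence of a
    density, hence on Radon-Nikodym and Lebesgue differentiation. *)

Section interval_families.
Context {R : realType}.
Implicit Types (a b : R) (p q : R * R) (s : seq (R * R)).

Definition separated p q := (p.2 <= q.1) || (q.2 <= p.1).

Definition subitv a b p := [&& a <= p.1, p.1 <= p.2 & p.2 <= b].

(** Sequences, rather than families over ['I_n], let an interval be replaced by a partition of it
    through concatenation. *)
Definition itv_family a b s := all (subitv a b) s && pairwise separated s.

Definition total_length s := \sum_(p <- s) (p.2 - p.1).

Lemma separated_sym p q : separated p q = separated q p.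
Proof. by rewrite /separated orbC. Qed.

Lemma separated_sub p q x y : p.1 <= x -> y <= p.2 -> separated p q ->
  separated (x, y) q.
Proof.
move=> px yp /orP[h|h]; rewrite /separated/=.
  by rewrite (le_trans yp h).
by rewrite (le_trans h px) orbT.
Qed.

Lemma subitv_trans a b x y p : a <= x -> y <= b -> subitv x y p ->
  subitv a b p.
Proof.
by move=> ax yb /and3P[xp pp py]; rewrite /subitv (le_trans ax xp) pp (le_trans py).
Qed.

Lemma itv_family_cat a b s1 s2 : itv_family a b (s1 ++ s2) =
  [&& itv_family a b s1, itv_family a b s2 & allrel separated s1 s2].
Proof.
rewrite /itv_family all_cat pairwise_cat.
by case: all; case: all; case: pairwise; case: pairwise; case: allrel.
Qed.

Lemma itv_partition_family a b (s : seq R) : itv_partition a b s ->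
  itv_family a b (zip (a :: s) s).
Proof.
elim: s a => [//|x s ih] a /[dup] abs /itv_partition_cons xbs.
have ax : a <= x by case: abs => /andP[/ltW].
have xb : x <= b := itv_partition_le xbs.
have /andP[sub sep] := ih _ xbs.
apply/andP; split=> /=.
  rewrite {1}/subitv/= lexx ax xb/=; apply/allP => p /(allP sub).
  by apply: subitv_trans.
rewrite sep andbT; apply/allP => p /(allP sub)/and3P[xp _ _].
by rewrite /separated/= xp.
Qed.

Lemma total_length_partition a b (s : seq R) : itv_partition a b s ->
  total_length (zip (a :: s) s) = b - a.
Proof.
rewrite /total_length; elim: s a => [a /itv_partition_nil ->|x s ih a].
  by rewrite big_nil subrr.
by move=> /itv_partition_cons /ih /=; rewrite big_cons/= => ->; lra.
Qed.

Lemma variation_pairs a b (s : seq R) f : itv_partition a b s ->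
  variation a b f s = \sum_(p <- zip (a :: s) s) `|f p.2 - f p.1|.
Proof.
move=> abs; rewrite variation_zip//.
elim: s a {abs} => [|x s ih] a /=; first by rewrite !big_nil.
by rewrite !big_cons /= ih.
Qed.

Lemma total_length_cat s1 s2 :
  total_length (s1 ++ s2) = total_length s1 + total_length s2.
Proof. by rewrite /total_length big_cat. Qed.

Lemma itv_family_trivIset a b s : itv_family a b s ->
  trivIset [set: 'I_(size s)]
    (fun i => `](nth (0, 0) s i).1, (nth (0, 0) s i).2[%classic).
Proof.
move=> /andP[_ /(pairwiseP (0, 0)) sep].
have key (i j : 'I_(size s)) : (i < j)%N ->
    `](nth (0, 0) s i).1, (nth (0, 0) s i).2[%classic `&`
    `](nth (0, 0) s j).1, (nth (0, 0) s j).2[%classic = set0.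
  move=> ij; have /orP[h|h] := sep _ _ (ltn_ord i) (ltn_ord j) ij;
    rewrite -subset0 => x /= [] /[!in_itv]/= /andP[x1 x2] /andP[x3 x4]; lra.
apply/trivIsetP => i j _ _; rewrite neq_lt => /orP[|] ij; first exact: key.
by rewrite setIC; exact: key.
Qed.

Lemma abs_continuous_family a b (f : R -> R) : abs_continuous a b f ->
  forall e, 0 < e -> exists2 delta, 0 < delta &
    forall s, itv_family a b s -> total_length s < delta ->
      \sum_(p <- s) `|f p.2 - f p.1| < e.
Proof.
move=> acf e /acf[delta d0 H]; exists delta => // s fs ls.
rewrite (big_nth (0, 0)) big_mkord; apply: H => //.
- move=> i; case/andP: fs => /(all_nthP (0, 0))/(_ _ (ltn_ord i))/and3P[] //.
- exact: itv_family_trivIset fs.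
- by move: ls; rewrite /total_length (big_nth (0, 0)) big_mkord.
Qed.

(** Induction on [s1]: the total variation of its first interval is a supremum over partitions, and
    each partition can be moved into [s2], which changes neither the total length nor the separation
    of the intervals. *)
Lemma total_variation_family a b (f : R -> R) e delta :
  (forall s, itv_family a b s -> total_length s < delta ->
      \sum_(p <- s) `|f p.2 - f p.1| <= e) ->
  forall s1 s2, itv_family a b (s1 ++ s2) ->
    total_length (s1 ++ s2) < delta ->
  (\sum_(p <- s1) total_variation p.1 p.2 f
   + (\sum_(p <- s2) `|f p.2 - f p.1|)%:E <= e%:E)%E.
Proof.
move=> H; elim=> [|p s1 ih] s2 fam len.
  by rewrite big_nil add0e lee_fin H.
have /andP[psub _] : subitv a b p && true.
  by move: fam => /andP[/= /andP[-> _] _].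
have /and3P[ap pp pb] := psub.
move: (fam); rewrite cat_cons -cat1s itv_family_cat => /and3P[_ fam12 sepp].
have len12 : total_length (s1 ++ s2) <= total_length ((p :: s1) ++ s2).
  by rewrite cat_cons /total_length big_cons lerDr subr_ge0.
have rest := ih _ fam12 (le_lt_trans len12 len).
set r := (X in (X <= _)%E) in rest.
(* Finiteness of [r] allows it to be moved across the inequality, so that the supremum stands alone
   on the left. *)
have rfin : r \is a fin_num.
  rewrite ge0_fin_numE ?(le_lt_trans rest) ?ltry// adde_ge0//.
    rewrite big_seq sume_ge0// => q qs1; apply: total_variation_ge0.
    by move: fam12 => /andP[/allP/(_ q)]; rewrite mem_cat qs1 => /(_ isT)/and3P[].
  by rewrite lee_fin sumr_ge0.
rewrite big_cons -addeA -/r -leeBrDr//.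
apply: ge_ereal_sup => _ [_ [l pl <-] <-]; rewrite leeBrDr//.
rewrite variation_pairs// /r addeCA -EFinD -big_cat; apply: ih.
  move: (itv_partition_family pl) => famp.
  have lsub q : q \in zip (p.1 :: l) l -> subitv p.1 p.2 q.
    by case/andP: famp => /allP h _ /h.
  have sepl t : t \in s1 ++ s2 -> forall q, q \in zip (p.1 :: l) l -> separated q t.
    move=> ts q /lsub/and3P[q1 _ q2].
    rewrite [q]surjective_pairing; apply: (separated_sub q1 q2).
    by move/allrelP: sepp => /(_ p t); apply; rewrite ?mem_head.
  move: fam12; rewrite itv_family_cat => /and3P[fam1 fam2 sep12].
  rewrite !itv_family_cat fam1 fam2/= -andbA; apply/and3P; split.
  - case/andP: famp => sub sep; rewrite /itv_family sep andbT.
    by apply: sub_all sub => q; exact: subitv_trans.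
  - by apply/allrelP => q t qs ts; apply: sepl => //; rewrite mem_cat ts orbT.
  - rewrite allrel_catr sep12 andbT; apply/allrelP => t q ts qs.
    by rewrite separated_sym; apply: sepl => //; rewrite mem_cat ts.
apply: le_lt_trans len.
rewrite !total_length_cat (total_length_partition pl).
by rewrite /total_length big_cons addrCA addrA.
Qed.

End interval_families.

Definition clamp {R : realDomainType} (a b x : R) := Num.max a (Num.min x b).

Lemma clamp_in {R : realDomainType} (a b x : R) : a <= b -> a <= clamp a b x <= b.
Proof. by move=> ab; rewrite /clamp le_max lexx/= ge_max ab ge_min lexx orbT. Qed.

(** * Density of a nondecreasing absolutely continuous function *)

Section monotone_density.
Context {R : realType}.
Local Notation mu := (@lebesgue_measure R).

Lemma lebesgue_stieltjes_oc (f : cumulative R R) (x y : R) : x <= y ->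
  lebesgue_stieltjes_measure f `]x, y]%classic = (f y - f x)%:E.
Proof.
move=> xy; rewrite /lebesgue_stieltjes_measure /measure_extension.
rewrite measurable_mu_extE/=; last exact: is_ocitv.
by rewrite wlength_itv_bnd// EFinB.
Qed.

Variables (F : R -> R) (a b : R).
Hypothesis ab : a < b.
Hypothesis ndF : {homo F : x y / x <= y}.
Hypothesis Fa : forall x, x <= a -> F x = F a.
Hypothesis Fb : forall x, b <= x -> F x = F b.
Hypothesis acF : forall e, 0 < e -> exists2 delta, 0 < delta &
  forall s, itv_family a b s -> total_length s < delta ->
    \sum_(p <- s) (F p.2 - F p.1) <= e.

Let clip := clamp a b.

Let clip_in x : a <= clip x <= b.
Proof. by apply: clamp_in; exact: ltW. Qed.

Let F_clip x : F (clip x) = F x.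
Proof.
rewrite /clip /clamp; have [xa|ax] := leP x a.
  by rewrite (min_idPl (le_trans xa (ltW ab))) (max_idPl xa) (Fa xa).
have [xb|bx] := leP x b; first by rewrite (max_idPr (ltW ax)).
by rewrite (max_idPr (ltW ab)) Fb// ltW.
Qed.

Let clip_sub x y : x <= y ->
  clip x <= clip y /\ clip y - clip x <= y - x.
Proof.
rewrite /clip /clamp => xy; have ab' := ab.
case: (leP x b) => xb; case: (leP y b) => yb; rewrite ?(max_idPr (ltW ab));
  try case: (leP a x) => ax; try case: (leP a y) => ay; lra.
Qed.

Let F_modulus e : 0 < e -> exists2 delta, 0 < delta &
  forall x y, x <= y -> y - x < delta -> F y - F x <= e.
Proof.
move=> /acF[delta d0 H]; exists delta => // x y xy yxd.
have [cxy cd] := clip_sub xy.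
have := H [:: (clip x, clip y)].
rewrite /itv_family /total_length/= /subitv/= !big_seq1/= !F_clip; apply.
  have /andP[-> _] := clip_in x; have /andP[_ ->] := clip_in y.
  by rewrite cxy.
exact: le_lt_trans yxd.
Qed.

Let rcF : right_continuous F.
Proof.
move=> x; apply/cvgrPdist_le => e e0.
have [delta d0 H] := F_modulus e0.
near=> y.
have xy : x <= y by near: y; exact: nbhs_right_ge.
rewrite ler0_norm ?subr_le0 ?ndF// opprB; apply: H => //.
by rewrite ltrBlDl; near: y; apply: nbhs_right_lt; rewrite ltrDl.
Unshelve. all: by end_near. Qed.

Let Fc : cumulative R R := HB.pack F (isCumulative.Build R _ R F ndF rcF).

Let nu : {measure set (measurableTypeR R) -> \bar R} :=
  lebesgue_stieltjes_measure Fc.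

Let nu_oc x y : x <= y -> nu `]x, y]%classic = (F y - F x)%:E.
Proof. exact: lebesgue_stieltjes_oc. Qed.

Let nuT : (nu setT <= (F b - F a)%:E)%E.
Proof.
rewrite -(bigcup_itvT false false).
pose I n : set R := `]- (n%:R), n%:R]%classic.
have cv : (nu \o I) n @[n --> \oo] --> nu (\bigcup_n I n).
  apply: nondecreasing_cvg_mu; rewrite /I//; first exact: bigcup_measurable.
  by move=> *; apply/subsetPset/subset_itv; rewrite leBSide/= ?lerN2 ler_nat.
have <- := cvg_lim (@ereal_hausdorff R) cv.
apply: lime_le; first exact: (cvgP _ cv).
near=> n; rewrite /= nu_oc ?ge0_cp// lee_fin.
have lo x : F a <= F x by rewrite -(F_clip x); apply: ndF; case/andP: (clip_in x).
have hi x : F x <= F b by rewrite -(F_clip x); apply: ndF; case/andP: (clip_in x).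
by rewrite lerB.
Unshelve. all: by end_near. Qed.

Let nu_set1 x : nu [set x] = 0%E.
Proof.
apply/eqP; rewrite eq_le measure_ge0 andbT; apply/lee_addgt0Pr => e e0.
have [delta d0 H] := F_modulus e0.
rewrite add0e (@le_trans _ _ (nu `]x - delta / 2, x]%classic))//.
  rewrite le_measure ?inE// => y /= ->; rewrite in_itv/= lexx andbT; lra.
by rewrite nu_oc ?lee_fin ?H//; lra.
Qed.

Let nu_itv (bl br : bool) x y : x <= y ->
  (nu [set` Interval (BSide bl x) (BSide br y)] <= (F y - F x)%:E)%E.
Proof.
move=> xy; rewrite -nu_oc// -[leRHS]add0e -[X in (X + _)%E](nu_set1 x).
rewrite -measureU//; last first.
  by apply/seteqP; split => // z [/= ->]; rewrite in_itv/= ltxx.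
rewrite le_measure ?inE//; first exact: measurableU.
move=> z /=; rewrite !in_itv/=; have [->|zx] := eqVneq z x; first by left.
move=> /andP[h1 h2]; right; rewrite lt_neqAle eq_sym zx/=.
by rewrite (lteifW h1)/= (lteifW h2).
Qed.

(** A Lebesgue null set lies in an open set of measure less than [delta]. Finitely many components
    of it, cut at [b], form a family of total length less than [delta], on which [F] increases by at
    most [e]. *)
Let nu_dom : nu `<< mu.
Proof.
apply/null_content_dominatesP => A mA muA0.
pose D : set R := `]a, b]%classic.
have mD : measurable (D : set (measurableTypeR R)).
  by apply: sub_sigma_algebra; exact: is_ocitv.
(* The total mass is at most [F b - F a], which is already the mass of []a, b]]. *)
have nuA : (nu A <= nu (A `&` D))%E.
  rewrite -[in leLHS](setUIDK A D) (le_trans (measureU2 _ _ _))//; first exact: measurableI.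
    exact: measurableD.
  rewrite -[leRHS]adde0 leeD2l//.
  apply: (@le_trans _ _ (nu (setT `\` D))).
    by rewrite le_measure ?inE//; [exact: measurableD|exact: measurableD|move=> x []].
  have nuD : nu D = (F b - F a)%:E by rewrite nu_oc// ltW.
  rewrite measureD//; last by rewrite (le_lt_trans nuT)// ltry.
  by rewrite setTI [X in (_ - X)%E]nuD leeBlDr// add0e.
apply/eqP; rewrite eq_le measure_ge0 andbT; apply/lee_addgt0Pr => e e0.
rewrite add0e; apply: (le_trans nuA).
have [delta d0 H] := acF e0.
have mAD : measurable (A `&` D) by apply: (@measurableI _ (measurableTypeR R)) => //.
have muAD : mu (A `&` D) = 0%E.
  by apply/eqP; rewrite eq_le measure_ge0 andbT -muA0 le_measure ?inE//; move=> x [].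
have [|U [oU AU muUA]] := @lebesgue_regularity_outer R _ delta mAD _ d0.
  by rewrite [X in (X < _)%E]muAD ltry.
have muU : (mu U < delta%:E)%E.
  have mU : measurable U by exact: open_measurable.
  rewrite -(setUIDK U (A `&` D)).
  rewrite (le_lt_trans (measureU2 _ _ _))//; [exact: measurableI|exact: measurableD|].
  by rewrite setIidr// [X in (X + _)%E]muAD add0e.
(* The right end [b + 1] keeps the point [b] inside an open set and makes the components bounded;
   [F] is constant beyond [b]. *)
pose U2 : set R := U `&` `]a, b + 1[%classic.
have oU2 : open U2 by apply: openI => //; exact: interval_open.
pose I := open_disjoint_itv oU2.
have mI q : measurable (I q) by apply: open_measurable; exact: open_disjoint_itv_open.
have IU2 q : I q `<=` U2.
  by rewrite (open_disjoint_itv_bigcup oU2) => x Ix; exists q.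
(* Each component is represented by an interval of [[a, b]] carrying at least its [nu]-mass. The
   pair [(a, a)] stands for components that are empty or on which [F] does not increase. *)
have IH q : exists p : R * R, [/\ subitv a b p, (nu (I q) <= (F p.2 - F p.1)%:E)%E,
    `]p.1, p.2[%classic `<=` I q & p.1 < p.2 \/ p = (a, a)].
  have aa : subitv a b (a, a) by rewrite /subitv/= lexx ltW.
  have aaI : `]a, a[%classic `<=` I q by move=> x /=; rewrite in_itv/=; lra.
  have [I0|/set0P[z Iz]] := eqVneq (I q) set0.
    by exists (a, a); split => //=; [rewrite I0 measure0 subrr|right].
  have Iab t : I q t -> a < t < b + 1 by move=> /IU2[_] /=; rewrite in_itv.
  have infI : has_inf (I q).
    by split; [exists z|exists a => t /Iab/andP[/ltW]].
  have supI : has_sup (I q).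
    by split; [exists z|exists (b + 1) => t /Iab/andP[_ /ltW]].
  set x := inf (I q); set y := sup (I q).
  have xI t : I q t -> x <= t by move=> It; apply: ge_inf => //; case: infI.
  have Iy t : I q t -> t <= y by move=> It; apply: ub_le_sup => //; case: supI.
  have xy : x <= y by rewrite (le_trans (xI _ Iz))// Iy.
  have ax : a <= x by apply: lb_le_inf; [exists z|move=> t /Iab/andP[/ltW]].
  have Ixy : I q `<=` `[x, y]%classic by move=> t It; rewrite /= in_itv/= xI ?Iy.
  have xyI : `]x, y[%classic `<=` I q.
    move=> t /=; rewrite in_itv/= => /andP[xt ty].
    have [u Iu ut] := inf_lt infI.1 xt; have [v Iv tv] := sup_gt supI.1 ty.
    apply: (@open_disjoint_itv_is_interval _ _ oU2 q _ _ Iu Iv).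
    by rewrite (ltW ut) (ltW tv).
  have nuI : (nu (I q) <= (F (Num.min y b) - F (Num.min x b))%:E)%E.
    have Fm t : F (Num.min t b) = F t.
      by have [//|bt] := leP t b; rewrite Fb// ltW.
    rewrite !Fm (le_trans _ (nu_itv true false xy))//; apply: le_measure;
      rewrite ?inE//; do ?[exact: mI|exact: measurable_itv].
  have mxy : Num.min x b <= Num.min y b by rewrite le_min !ge_min xy lexx orbT.
  move: (mxy); rewrite le_eqVlt => /orP[/eqP E|lt].
    by exists (a, a); split => //=; [rewrite (le_trans nuI)// E !subrr|right].
  exists (Num.min x b, Num.min y b); split => //=; last by left.
    by rewrite /subitv/= mxy le_min ax (ltW ab) ge_min lexx orbT.
  move=> t /=; rewrite in_itv/= gt_min lt_min => /andP[/orP[xt|bt] /andP[ty tb]].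
    by apply: xyI; rewrite /= in_itv/= xt ty.
  by move: (lt_trans bt tb); rewrite ltxx.
have [P HP] := choice IH.
(* Two overlapping nondegenerate intervals would share an interior point, which would lie in two
   disjoint components. *)
have sepP i j : i != j -> separated (P i) (P j).
  have [/and3P[ai _ ib] _ Ii di] := HP i; have [/and3P[aj _ jb] _ Ij dj] := HP j.
  move=> ij; case: di => [di|->]; last by rewrite /separated/= aj.
  case: dj => [dj|->]; last by rewrite /separated/= ai orbT.
  rewrite /separated -implyNb -ltNge; apply/implyP => h1; rewrite leNgt; apply/negP => h2.
  have := @open_disjoint_itv_trivIset _ _ oU2; move/trivIsetP => /(_ i j Logic.I Logic.I ij).
  rewrite -subset0; pose t := (Num.max (P i).1 (P j).1 + Num.min (P i).2 (P j).2) / 2.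
  have lt : Num.max (P i).1 (P j).1 < Num.min (P i).2 (P j).2.
    by rewrite gt_max !lt_min di dj h1 h2.
  have : Num.max (P i).1 (P j).1 < t < Num.min (P i).2 (P j).2.
    rewrite /t; move: lt; set u := Num.max _ _; set v := Num.min _ _ => uv.
    by apply/andP; split; lra.
  rewrite gt_max lt_min => /andP[/andP[t1 t2] /andP[t3 t4]].
  move=> /(_ t); apply; split; [apply: Ii|apply: Ij];
    by rewrite /= in_itv/= ?t1 ?t2.
have ADU2 : A `&` D `<=` U2.
  move=> x ADx; split; first exact: AU.
  have /andP[ax xb] : a < x <= b by case: ADx => _; rewrite /D /= in_itv.
  by rewrite /= in_itv/= ax/= (le_lt_trans xb)// ltrDl.
have mU2 : measurable U2 by exact: open_measurable.
apply: (@le_trans _ _ (nu U2)); first by rewrite le_measure ?inE.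
have U2E : U2 = \bigcup_q I q by exact: open_disjoint_itv_bigcup.
have tI : trivIset setT I by exact: open_disjoint_itv_trivIset.
rewrite U2E measure_semi_bigcup//; last by rewrite -U2E.
apply: lime_le; first by apply: is_cvg_nneseries.
near=> n; apply: (@le_trans _ _ (\sum_(0 <= q < n) (F (P q).2 - F (P q).1)%:E)%E).
  by apply: lee_sum => q _; case: (HP q).
rewrite sumEFin lee_fin -(big_map P xpredT (fun p => F p.2 - F p.1)).
apply: H.
  rewrite /itv_family all_map; apply/andP; split.
    by apply/allP => q _ /=; case: (HP q).
  rewrite pairwise_map; apply: (@sub_in_pairwise _ predT (fun i j => i != j)).
  - by move=> i j _ _; exact: sepP.
  - by apply/allP.
  - by rewrite -uniq_pairwise iota_uniq.
rewrite -lte_fin; apply: le_lt_trans muU.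
rewrite /total_length big_map -sumEFin.
apply: (@le_trans _ _ (\sum_(0 <= q < n) mu (I q))%E).
  apply: lee_sum => q _; have [/and3P[_ pp _] _ sub _] := HP q.
  apply: (@le_trans _ _ (mu `](P q).1, (P q).2[%classic)).
    rewrite lebesgue_measure_itv/= lte_fin; case: ltP => [_|h]; first by rewrite -EFinB.
    by rewrite lee_fin subr_le0.
  by apply: le_measure; rewrite ?inE; [exact: (@measurable_itv R)|exact: mI|exact: sub].

apply: (@le_trans _ _ (mu U2)); last first.
  by rewrite le_measure ?inE//; [exact: open_measurable|move=> x []].
rewrite U2E measure_semi_bigcup//; last by rewrite -U2E.
exact: nneseries_lim_ge.
Unshelve. all: by end_near. Qed.

Let nu_fin : fin_num_fun nu.
Proof.
move=> A mA; rewrite ge0_fin_numE//.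
apply: (@le_lt_trans _ _ (nu setT)); first by apply: le_measure; rewrite ?inE.
by rewrite (le_lt_trans nuT)// ltry.
Qed.

(** The density is the Radon-Nikodym derivative of the Lebesgue-Stieltjes measure of [F]. Lebesgue
    differentiation applies to its primitive [G] from [-oo], which differs from [F] by a
    constant. *)
Lemma monotone_density : exists f : R -> R,
  [/\ mu.-integrable setT (EFin \o f),
      forall x y, x <= y -> (F y - F x)%:E = (\int[mu]_(z in `]x, y]) (f z)%:E)%E &
      {ae mu, forall x, derivable F x 1 /\ F^`()%classic x = f x}].
Proof.
pose nuf : {finite_measure set (measurableTypeR R) -> \bar R} :=
  HB.pack (Measure.sort nu) (Measure_isFinite.Build _ (measurableTypeR R) _ nu nu_fin).
have [h [h0 hfin hint hE]] := @radon_nikodym_sigma_finite _ _ R mu nuf nu_dom.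
pose f := fine \o h.
have fh : EFin \o f = h by apply/funext => x /=; rewrite fineK.
have intf : mu.-integrable setT (EFin \o f) by rewrite fh.
exists f; split => //.
  move=> x y xy; rewrite -nu_oc// [LHS]hE; last exact: (@measurable_itv R).
  by apply: eq_integral => z _; rewrite fineK.
have := @FTC1Ny R f.
have intS y : mu.-integrable `]-oo, y] (EFin \o f).
  by apply: integrableS intf => //; exact: measurable_itv.
have locf : locally_integrable [set: R] f.
  by apply: open_integrable_locally => //; exact: openT.
pose G x : R := (\int[mu]_(t in `]-oo, x]) f t)%R.
move=> /(_ intS locf) => dG0.
have {dG0} : {ae mu, forall x, derivable G x 1 /\ G^`()%classic x = f x} by exact: dG0.
have GE x : G x = fine (nu `]-oo, x]%classic).
  rewrite /G /Rintegral; congr fine.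
  rewrite [RHS]hE; last exact: (@measurable_itv R).
  by apply: eq_integral => z _; rewrite fineK.
have FG : F = G + cst (F 0 - G 0).
  have key x y : x <= y -> G y - G x = F y - F x.
    move=> xy; rewrite !GE -[RHS]/(fine (F y - F x)%:E) -nu_oc//.
    have -> : `]-oo, y]%classic = `]-oo, x]%classic `|` `]x, y]%classic.
      by rewrite -itv_bndbnd_setU.
    rewrite measureU//.
    - by rewrite fineD ?nu_fin//; [lra|exact: (@measurable_itv R)..].
    - rewrite -subset0 => z [] /=; rewrite !in_itv/= => zx /andP[xz _].
      by move: (le_lt_trans zx xz); rewrite ltxx.
  apply/funext => x; rewrite fctE /=.
  by have [/key|/ltW/key] := leP x 0; lra.
apply: filterS; first exact: (ae_filter_ringOfSetsType mu).
move=> x [dG GfE]; rewrite FG; split.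
  exact: derivableD.
rewrite -GfE !derive1E deriveD//.
by rewrite derive_cst addr0.
Qed.

End monotone_density.

(** * Density of an absolutely continuous function *)

Section abs_continuous_density.
Context {R : realType}.
Local Notation mu := (@lebesgue_measure R).
Variables (a b : R) (f : R -> R).
Hypothesis ab : a < b.
Hypothesis acf : abs_continuous a b f.

Local Notation TV := total_variation.

Let TV_family e : 0 < e -> exists2 delta, 0 < delta &
  forall s, itv_family a b s -> total_length s < delta ->
    (\sum_(p <- s) TV p.1 p.2 f <= e%:E)%E.
Proof.
move=> /(abs_continuous_family acf)[delta d0 H]; exists delta => // s fs ls.
have H' : forall s, itv_family a b s -> total_length s < delta ->
      \sum_(p <- s) `|f p.2 - f p.1| <= e.
  by move=> s' fs' ls'; exact/ltW/H.
have := @total_variation_family R a b f e delta H' s [::].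
by rewrite cats0 big_nil adde0; apply.
Qed.

(** The interval is cut into [n] cells shorter than the [delta] associated with [e = 1]; the
    variation over each of them is at most 1. *)
Let TV_fin x y : a <= x -> x <= y -> y <= b -> TV x y f \is a fin_num.
Proof.
move=> ax xy yb.
have [delta d0 H] := TV_family ltr01.
pose n := Num.bound ((b - a) / delta).
have n0 : 0 < n%:R :> R.
  by rewrite (le_lt_trans _ (archi_boundP _))// divr_ge0 ?subr_ge0 ?ltW.
pose h := (b - a) / n%:R.
have h0 : 0 < h by rewrite divr_gt0// subr_gt0.
have hn : n%:R * h = b - a by rewrite /h mulrC divfK// gt_eqF.
have hd : h < delta.
  rewrite ltr_pdivrMr// mulrC -ltr_pdivrMr//.
  by rewrite archi_boundP// divr_ge0 ?subr_ge0 ?ltW.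
have key k : (k <= n)%N -> (TV a (a + k%:R * h) f <= k%:R%:E)%E.
  elim: k => [_|k ih kn]; first by rewrite mul0r addr0 total_variationxx.
  have hk : a <= a + k%:R * h by rewrite lerDl mulr_ge0// ltW.
  have hk1 : a + k%:R * h <= a + k.+1%:R * h.
    by rewrite lerD2l ler_pM2r// ler_nat.
  rewrite (total_variationD f hk hk1).
  have -> : k.+1%:R%:E = (k%:R%:E + 1%:E)%E :> \bar R by rewrite -EFinD natr1.
  apply: leeD; first exact/ih/ltnW.
  have := H [:: (a + k%:R * h, a + k.+1%:R * h)].
  rewrite big_seq1 /itv_family /total_length /= big_seq1/=; apply.
    rewrite /subitv/= hk hk1/= !andbT -lerBrDl -hn.
    by rewrite ler_wpM2r ?ler_nat// ltW.
  have -> : k.+1%:R = k%:R + 1 :> R by rewrite natr1.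
  by rewrite mulrDl mul1r; lra.
have TVab : TV a b f \is a fin_num.
  rewrite ge0_fin_numE; last by apply: total_variation_ge0; exact: ltW.
  have := key n (leqnn _); rewrite hn subrKC => /le_lt_trans; apply.
  by rewrite ltry.
have xb : x <= b := le_trans xy yb.
move: TVab; rewrite !ge0_fin_numE; [|exact: total_variation_ge0|by apply: total_variation_ge0; exact: ltW].
apply: le_lt_trans.
rewrite (total_variationD f ax xb) (total_variationD f xy yb).
rewrite addeCA leeDl// adde_ge0//; exact: total_variation_ge0.
Qed.

Let clip := clamp a b.

Let clip_in x : a <= clip x <= b.
Proof. by apply: clamp_in; exact: ltW. Qed.

Let clip_id x : a <= x <= b -> clip x = x.
Proof. by move=> /andP[ax xb]; rewrite /clip /clamp (min_idPl xb) (max_idPr ax). Qed.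

Let clip_mono x y : x <= y -> clip x <= clip y.
Proof.
move=> xy; rewrite /clip /clamp ge_max !le_max lexx/= le_min !ge_min.
by rewrite xy lexx !orbT.
Qed.

Let clip_lo x : x <= a -> clip x = clip a.
Proof.
by move=> xa; rewrite (clip_id (x := a)) ?lexx ?ltW// /clip /clamp;
  apply/max_idPl; rewrite ge_min xa.
Qed.

Let clip_hi x : b <= x -> clip x = clip b.
Proof.
move=> bx; rewrite (clip_id (x := b)) ?lexx ?ltW// /clip /clamp (min_idPr bx).
by apply/max_idPr; exact: ltW.
Qed.

Let T x := fine (TV a (clip x) f).

Let TVE x y : a <= x -> x <= y -> y <= b -> (T y - T x)%:E = TV x y f.
Proof.
move=> ax xy yb; rewrite /T !clip_id ?ax ?yb ?(le_trans ax xy) ?(le_trans xy yb)//.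
rewrite (total_variationD f ax xy) fineD ?TV_fin// ?(le_trans xy)//.
by rewrite addrAC subrr add0r fineK// TV_fin.
Qed.

Let acT e : 0 < e -> exists2 delta, 0 < delta &
  forall s, itv_family a b s -> total_length s < delta ->
    \sum_(p <- s) (T p.2 - T p.1) <= e.
Proof.
move=> /TV_family[delta d0 H]; exists delta => // s fs /(H _ fs).
rewrite -lee_fin -sumEFin big_seq [in X in _ -> X]big_seq; apply: le_trans.
apply: lee_sum => p ps; rewrite TVE//;
  by case/andP: fs => /allP/(_ _ ps)/and3P[].
Qed.

Let ndT : {homo T : x y / x <= y}.
Proof.
move=> x y xy; rewrite -subr_ge0 -lee_fin.
have TT z : T z = T (clip z) by rewrite /T (clip_id (clip_in z)).
have /andP[ax _] := clip_in x; have /andP[_ yb] := clip_in y.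
have cxy := clip_mono xy.
by rewrite (TT y) (TT x) TVE//; exact: total_variation_ge0.
Qed.

Let G x := T x - f (clip x).

Let G_le x y : a <= x -> x <= y -> y <= b -> 0 <= G y - G x <= 2 * (T y - T x).
Proof.
move=> ax xy yb; have := total_variation_ge f xy; rewrite -[in X in X -> _]TVE//.
rewrite lee_fin /G !(clip_id (x := x)) ?(clip_id (x := y)) ?ax ?yb ?(le_trans ax xy) ?(le_trans xy yb)//.
by rewrite ler_norml => /andP[h1 h2]; apply/andP; split; lra.
Qed.

Let ndG : {homo G : x y / x <= y}.
Proof.
move=> x y xy; rewrite -subr_ge0.
have GG z : G z = G (clip z) by rewrite /G /T (clip_id (clip_in z)).
have /andP[ax _] := clip_in x; have /andP[_ yb] := clip_in y.
by rewrite (GG y) (GG x); have /andP[] := G_le ax (clip_mono xy) yb.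
Qed.

Let acG e : 0 < e -> exists2 delta, 0 < delta &
  forall s, itv_family a b s -> total_length s < delta ->
    \sum_(p <- s) (G p.2 - G p.1) <= e.
Proof.
move=> e0; have /acT[delta d0 H] : 0 < e / 2 by lra.
exists delta => // s fs /(H _ fs) h.
apply: (@le_trans _ _ (2 * \sum_(p <- s) (T p.2 - T p.1))); last by lra.
rewrite mulr_sumr big_seq [leRHS]big_seq; apply: ler_sum => p ps.
have /and3P[ap pp pb] : subitv a b p by case/andP: fs => /allP/(_ _ ps).
by have /andP[] := G_le ap pp pb.
Qed.

(** Jordan decomposition: [f = T - G] on [[a, b]], with [T] the variation function. Both parts are
    nondecreasing and inherit absolute continuity, and both are extended by constants outside
    [[a, b]], so derivatives are only compared in the open interval. *)
Lemma abs_continuous_density : exists g : R -> R,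
  [/\ mu.-integrable setT (EFin \o g),
      forall x y, a <= x -> x <= y -> y <= b ->
        (f y - f x)%:E = (\int[mu]_(z in `]x, y]) (g z)%:E)%E &
      {ae mu, forall x, a < x < b -> derivable f x 1 /\ f^`()%classic x = g x}].
Proof.
have Tlo x : x <= a -> T x = T a by move=> xa; rewrite /T clip_lo.
have Thi x : b <= x -> T x = T b by move=> xa; rewrite /T clip_hi.
have Glo x : x <= a -> G x = G a by move=> xa; rewrite /G Tlo// clip_lo.
have Ghi x : b <= x -> G x = G b by move=> xa; rewrite /G Thi// clip_hi.
have [g1 [i1 E1 D1]] := monotone_density ab ndT Tlo Thi acT.
have [g2 [i2 E2 D2]] := monotone_density ab ndG Glo Ghi acG.
have fE x : a <= x <= b -> f x = T x - G x by move=> axb; rewrite /G clip_id//; lra.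
exists (g1 \- g2); split.
- have -> : EFin \o (g1 \- g2) = ((EFin \o g1) \- (EFin \o g2))%E by [].
  exact: integrableB.
- move=> x y ax xy yb.
  have -> : f y - f x = (T y - T x) - (G y - G x).
    rewrite !fE ?ax ?yb ?(le_trans ax xy) ?(le_trans xy yb)//; lra.
  rewrite EFinB E1// E2// -integralB//.
  + by apply: integrableS i1 => //; exact: (@measurable_itv R).
  + by apply: integrableS i2 => //; exact: (@measurable_itv R).
- have DD : {ae mu, forall x, (derivable T x 1 /\ T^`()%classic x = g1 x) /\
                             (derivable G x 1 /\ G^`()%classic x = g2 x)}.
    exact: (@filterI _ _ (ae_filter_ringOfSetsType mu)) D1 D2.
  apply: filterS DD; first exact: (ae_filter_ringOfSetsType mu).
  move=> x [[dT T'] [dG G']] axb.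
  have nf : \forall y \near x, T y - G y = f y.
    near=> y; apply/esym/fE/andP; split; apply: ltW; near: y.
      by apply: lt_nbhsr; case/andP: axb.
    by apply: lt_nbhsl; case/andP: axb.
  have dT1 : is_derive x 1 T (g1 x) by apply: DeriveDef dT _; rewrite -derive1E.
  have dG1 : is_derive x 1 G (g2 x) by apply: DeriveDef dG _; rewrite -derive1E.
  have dTG : is_derive x 1 (T \- G) (g1 x - g2 x).
    exact: (@is_deriveB _ _ _ T G x 1 (g1 x) (g2 x) dT1 dG1).
  have : is_derive x 1 f (g1 x - g2 x).
    by apply: near_eq_is_derive dTG => //; exact: oner_neq0.
  by move=> [df dE]; split => //; rewrite derive1E.
Unshelve. all: by end_near. Qed.

End abs_continuous_density.

Section ge0_le_integral_subset.
Local Open Scope ereal_scope.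
Context d (T : measurableType d) (R : realType).
Variable mu : {measure set T -> \bar R}.

(* The integral of a nonnegative function is a supremum over simple functions
   below it, hence monotone without any measurability. *)
Lemma ge0_le_integral_subset (D1 D2 : set T) (f1 f2 : T -> \bar R) :
  (forall x, D1 x -> 0 <= f1 x) -> (forall x, D2 x -> 0 <= f2 x) ->
  (forall x, D1 x -> D2 x /\ f1 x <= f2 x) ->
  \int[mu]_(x in D1) f1 x <= \int[mu]_(x in D2) f2 x.
Proof.
move=> f10 f20 f12; rewrite !ge0_integralE//; apply: le_ereal_sup.
move=> _ [h /= hf <-]; exists h => //= x; apply: (le_trans (hf x)).
rewrite /patch; case: ifPn => [/[1!inE] /f12[D2x f12x]|_]; first by rewrite mem_set.
by case: ifPn => // /[1!inE] /f20.
Qed.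

(** Here [f1] may change sign: its integral is at most that of its positive part. *)
Lemma integral_le_ge0 (D1 D2 : set T) (f1 f2 : T -> \bar R) :
  (forall x, D2 x -> 0 <= f2 x) ->
  (forall x, D1 x -> D2 x /\ f1 x <= f2 x) ->
  \int[mu]_(x in D1) f1 x <= \int[mu]_(x in D2) f2 x.
Proof.
move=> f20 f12; rewrite integralE.
apply: (@le_trans _ _ (\int[mu]_(x in D1) f1 ^\+ x)).
  by rewrite geeDl// oppe_le0 integral_ge0.
apply: ge0_le_integral_subset => // x /f12[D2x f12x]; split => //.
by rewrite funeposE ge_max f12x f20.
Qed.

End ge0_le_integral_subset.

(** * Modulus of continuity of paths of finite energy *)

Section energy.
Context {R : realType}.
Local Notation mu := (@lebesgue_measure R).

Lemma integrable_cst_itv (b0 b1 : bool) (a b c : R) :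
  mu.-integrable [set` Interval (BSide b0 a) (BSide b1 b)] (fun=> c%:E).
Proof.
apply/integrableP; split; first exact: measurable_cst.
have -> : (fun x : measurableTypeR R => `|c%:E|%E) = cst `|c|%:E by [].
rewrite integral_cst// [X in (_ * X)%E]lebesgue_measure_itv/=.
by case: ifPn => _; rewrite ?mule0// -EFinB -EFinM ltry.
Qed.

(** [Phi] is the primitive of the square of the density, and the increment bound is the
    Cauchy-Schwarz inequality. Stated without derivatives, it passes to the running supremum of
    [|f|]. *)
Lemma energy_modulus (a b : R) (f : R -> R) : a < b -> abs_continuous a b f ->
  (\int[mu]_(s in `[a, b]) ((f^`()%classic s) ^+ 2)%:E < +oo)%E ->
  exists Phi : R -> R,
  [/\ forall x y, a <= x -> x <= y -> y <= b ->
        0 <= Phi y - Phi x /\ (f y - f x) ^+ 2 <= (y - x) * (Phi y - Phi x),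
      Phi a = 0 &
      ((Phi b)%:E <= \int[mu]_(s in `[a, b]) ((f^`()%classic s) ^+ 2)%:E)%E].
Proof.
move=> ab acf fin.
have [g [ig gE gD]] := abs_continuous_density ab acf.
pose p s := (g s ^+ 2)%:E.
have mg : measurable_fun setT g by case/integrableP: ig => /measurable_EFinP.
have mp : measurable_fun setT p.
  by apply/measurable_EFinP; exact: measurable_funX.
have p0 s : (0 <= p s)%E by rewrite lee_fin sqr_ge0.
have mitv x y : measurable (`]x, y]%classic : set (measurableTypeR R)).
  exact: (@measurable_itv R).
have pab : (\int[mu]_(s in `]a, b]) p s <=
    \int[mu]_(s in `[a, b]) ((f^`()%classic s) ^+ 2)%:E)%E.
  have [N [mN N0 NP]] := gD.
  (* The end point [b] is added because the derivative is only known inside the open interval. *)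
  pose M := N `|` [set b].
  have M0 : mu M = 0%E.
    apply/eqP; rewrite eq_le measure_ge0 andbT.
    rewrite (le_trans (measureU2 _ _ _))//.
    by rewrite [X in (_ + X <= _)%E]lebesgue_measure_set1 adde0 [X in (X <= _)%E]N0.
  rewrite (@ge0_negligible_integral _ _ _ _ _ M)//; last 2 first.
  - exact: measurableU.
  - exact: measurable_funS mp.
  apply: ge0_le_integral_subset => //; first by move=> s _; rewrite lee_fin sqr_ge0.
  move=> s [] /=; rewrite in_itv/= => /andP[xs sy] /not_orP[nN ny].
  split; first by rewrite in_itv/= (ltW xs).
  have sb : a < s < b by rewrite xs/= lt_neqAle sy andbT; apply/eqP.
  have -> : f^`()%classic s = g s.
    by have [] := contrapT (contra_not (NP s) nN) sb.
  exact: lexx.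
have pfin y : y <= b -> (\int[mu]_(s in `]a, y]) p s)%E \is a fin_num.
  move=> yb; rewrite ge0_fin_numE; last exact: integral_ge0.
  apply: le_lt_trans fin; apply: le_trans pab.
  apply: ge0_le_integral_subset => // s; rewrite /= !in_itv/= => /andP[-> sy].
  by rewrite (le_trans sy yb).
pose Phi y := fine (\int[mu]_(s in `]a, y]) p s)%E.
have PhiE x y : a <= x -> x <= y -> y <= b ->
    (\int[mu]_(s in `]x, y]) p s = (Phi y - Phi x)%:E)%E.
  move=> ax xy yb; rewrite EFinB !fineK ?pfin// ?(le_trans xy)//.
  have -> : `]a, y]%classic = `]a, x]%classic `|` `]x, y]%classic.
    by rewrite -itv_bndbnd_setU.
  rewrite ge0_integral_setU//; last 2 first.
  - exact: measurable_funS mp.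
  - apply/disj_set2P; rewrite -subset0 => z [] /=; rewrite !in_itv/= => /andP[_ zx] /andP[xz _].
    by move: (le_lt_trans zx xz); rewrite ltxx.
  by rewrite addeAC subee ?add0e// pfin// (le_trans xy).
exists Phi; split.
- move=> x y ax xy yb.
  have Phi0 : 0 <= Phi y - Phi x by rewrite -lee_fin -PhiE//; exact: integral_ge0.
  split => //; move: xy; rewrite le_eqVlt => /predU1P[<-|xy].
    by rewrite !subrr expr0n mulr0.
  have yx0 : 0 < y - x by rewrite subr_gt0.
  (* With [c] the mean slope, [g^2 >= 2 * c * g - c^2], and the integral of the right-hand side is
     [c * (f y - f x)]. *)
  pose c := (f y - f x) / (y - x).
  suff h : c * (f y - f x) <= Phi y - Phi x.
    have -> : (f y - f x) ^+ 2 = (y - x) * (c * (f y - f x)).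
      by rewrite mulrA (mulrC (y - x)) divfK ?gt_eqF// expr2.
    by rewrite ler_pM2l.
  have igxy : mu.-integrable `]x, y] (EFin \o g) by exact: integrableS ig.
  pose h s := ((2 * c) * g s - c ^+ 2)%:E.
  have ig2 : mu.-integrable `]x, y] (fun s => (2 * c)%:E * (g s)%:E)%E.
    exact: integrableZl.
  have ic : mu.-integrable `]x, y] (fun=> (c ^+ 2)%:E) by exact: integrable_cst_itv.
  have hE : (c * (f y - f x))%:E = (\int[mu]_(s in `]x, y]) h s)%E.
    rewrite /h; under eq_integral do rewrite EFinB EFinM.
    rewrite integralB// integralZl// -gE// ?ltW// integral_cst//.
    rewrite [X in (_ - _ * X)%E]lebesgue_measure_itv/= lte_fin xy.
    rewrite -!EFinB -?EFinM -?EFinB; congr EFin.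
    have -> : f y - f x = c * (y - x) by rewrite /c divfK// gt_eqF.
    by ring.
  rewrite -lee_fin -PhiE ?(ltW xy)// hE; apply: integral_le_ge0 => // s sxy; split => //.
  by rewrite lee_fin -subr_ge0 (_ : _ - _ = (g s - c) ^+ 2) ?sqr_ge0//; ring.
- rewrite /Phi (_ : `]a, a]%classic = set0) ?integral_set0//.
  apply/seteqP; split => // s /=; rewrite in_itv/= => /andP[h1 h2].
  by move: (lt_le_trans h1 h2); rewrite ltxx.
- by rewrite fineK ?pfin.
Qed.

End energy.

(** * Primitives and an upper bound of the minimal action *)

Section primitive.
Context {R : realType}.
Local Notation mu := (@lebesgue_measure R).

Import HBNNSimple.

(** A simple function below [f] is measurable, so its values on the null set [N] do not count;
    elsewhere it lies below [g]. *)
Lemma ge0_le_integral_ae d (T : measurableType d) (m : {measure set T -> \bar R})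
    (D N : set T) (f g : T -> \bar R) : measurable N -> m N = 0%E ->
  (forall x, D x -> (0 <= f x)%E) -> (forall x, D x -> (0 <= g x)%E) ->
  (forall x, D x -> ~ N x -> (f x <= g x)%E) ->
  (\int[m]_(x in D) f x <= \int[m]_(x in D) g x)%E.
Proof.
move=> mN N0 f0 g0 fg; rewrite ge0_integralE//.
apply: ge_ereal_sup => _ [h /= hf <-].
rewrite -integralT_nnsfun (@ge0_negligible_integral _ _ _ _ _ N)//; last 2 first.
- by apply/measurable_EFinP.
- by move=> x _; rewrite lee_fin.
rewrite (integral_mkcond D); apply: ge0_le_integral_subset.
- by move=> x _; rewrite lee_fin.
- by move=> x _; apply: erestrict_ge0.
move=> x [_ nNx]; split => //; apply: (le_trans (hf x)).
rewrite /patch; case: ifPn => // /[1!inE] Dx; exact: fg.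
Qed.

Variables (a b : R) (g psi : R -> R).
Hypotheses (ab : a < b) (ig : mu.-integrable setT (EFin \o g)).
Hypothesis psiE : forall x y, a <= x -> x <= y -> y <= b ->
  (psi y - psi x)%:E = (\int[mu]_(z in `]x, y]) (g z)%:E)%E.

Let mg : measurable_fun setT g.
Proof. by case/integrableP: ig => /measurable_EFinP. Qed.

(** The increments are bounded by the integral of [|g|] over the union of the intervals, which is
    small with the measure of this union. *)
Lemma primitive_abs_continuous : abs_continuous a b psi.
Proof.
move=> e e0.
have [delta [d0 H]] := integral_normr_continuous ig e0.
exists delta => // n u v uv tI len.
pose I (i : 'I_n) : set (measurableTypeR R) := `]u i, v i[%classic.
have mI i : measurable (I i) by exact: (@measurable_itv R).
pose U := \big[setU/set0]_(i < n) I i.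
have mU : measurable U by exact: bigsetU_measurable.
have muU : (mu U < delta%:E)%E.
  apply: le_lt_trans (_ : ((\sum_(i < n) (v i - u i))%:E < _)%E); last by rewrite lte_fin.
  rewrite /U [X in (X <= _)%E]measure_bigsetU_ord// -sumEFin.
  apply: lee_sum => i _; have [_ uvi _] := uv i.
  rewrite [X in (X <= _)%E]lebesgue_measure_itv/= lte_fin.
  by case: ltP => _; rewrite -?EFinB// lee_fin subr_ge0.
have mng A : measurable_fun A (fun x : measurableTypeR R => `|g x|%:E).
  apply/measurable_EFinP; apply: measurableT_comp => //.
  exact: measurable_funS mg.
have := H U mU muU; rewrite -!lte_fin => /(le_lt_trans _); apply.
have -> : ((\int[mu]_(x in U) `|g x|)%R%:E = \int[mu]_(x in U) `|g x|%:E)%E.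
  rewrite fineK// ge0_fin_numE; last by apply: integral_ge0.
  case/integrableP: ig => _ /(le_lt_trans _); apply.
  by apply: ge0_le_integral_subset.
rewrite ge0_integral_bigsetU//; last 2 first.
- exact: index_enum_uniq.
- exact: sub_trivIset tI.
rewrite -sumEFin; apply: lee_sum => i _.
have [au uvi vb] := uv i.
rewrite -abse_EFin psiE// integral_itv_bndo_bndc//.
apply: le_abse_integral => //.
by apply/measurable_EFinP; exact: measurable_funS mg.
exact: mng.
Qed.

Lemma primitive_derive :
  {ae mu, forall x, a < x < b -> psi^`()%classic x = g x}.
Proof.
have intS y : mu.-integrable `]-oo, y] (EFin \o g).
  by apply: integrableS ig => //; exact: (@measurable_itv R).
have locf : locally_integrable [set: R] g.
  by apply: open_integrable_locally => //; exact: openT.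
pose G x : R := (\int[mu]_(t in `]-oo, x]) g t)%R.
have dG : {ae mu, forall x, derivable G x 1 /\ G^`()%classic x = g x}.
  exact: FTC1Ny.
have GE x y : x <= y -> (G y - G x)%:E = (\int[mu]_(z in `]x, y]) (g z)%:E)%E.
  move=> xy; rewrite /G Rintegral_itvB//.
    rewrite fineK//; apply: integrable_fin_num => //.
    by apply: integrableS ig => //; exact: (@measurable_itv R).
apply: filterS dG; first exact: (ae_filter_ringOfSetsType mu).
move=> x [dGx <-] /andP[ax xb].
have psiG : \forall y \near x, psi y = (G + cst (psi a - G a)) y.
  near=> y.
  have ay : a < y by near: y; exact: lt_nbhsr.
  have yb : y < b by near: y; exact: lt_nbhsl.
  rewrite fctE /=; have := psiE (lexx a) (ltW ay) (ltW yb); rewrite -GE ?(ltW ay)//.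
  by move=> [] ?; lra.
rewrite !derive1E (near_eq_derive _ psiG).
by rewrite deriveD// derive_cst addr0.
Unshelve. all: by end_near. Qed.

Lemma primitive_energy :
  (\int[mu]_(s in `[a, b]) ((psi^`()%classic s) ^+ 2)%:E <=
   \int[mu]_(s in `[a, b]) ((g s) ^+ 2)%:E)%E.
Proof.
have [N [mN N0 NP]] := primitive_derive.
pose M := N `|` ([set a] `|` [set b]).
have M0 : mu M = 0%E.
  apply/eqP; rewrite eq_le measure_ge0 andbT.
  rewrite (le_trans (measureU2 _ _ _))//; first exact: measurableU.
  rewrite [X in (X + _ <= _)%E]N0 add0e (le_trans (measureU2 _ _ _))//.
  by rewrite ![X in (X + _ <= _)%E]lebesgue_measure_set1 add0e [X in (X <= _)%E]lebesgue_measure_set1.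
apply: (@ge0_le_integral_ae _ _ _ _ M) => //.
- by apply: measurableU => //; exact: measurableU.
- by move=> s _; rewrite lee_fin sqr_ge0.
- by move=> s _; rewrite lee_fin sqr_ge0.
move=> s; rewrite /= in_itv/= => /andP[as_ sb] /not_orP[nN /not_orP[na nb]].
rewrite (contrapT (contra_not (NP s) nN))// !lt_neqAle as_ sb !andbT.
by apply/andP; split; apply/eqP => // sa; apply: na.
Qed.

End primitive.

Section climbing_paths.
Context {R : realType}.
Local Notation mu := (@lebesgue_measure R).

(** For [a < 1] the integrand is singular at 0: the fundamental theorem of calculus is used on
    [[s / (k + 1), s]], followed by monotone convergence. *)
Lemma powR_integral (a s : R) : 0 < a -> 0 <= s ->
  (\int[mu]_(u in `]0%R, s]) (u `^ (a - 1))%:E = (s `^ a / a)%:E)%E.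
Proof.
move=> a0; rewrite le_eqVlt => /predU1P[<-|s0].
  rewrite powR0 ?gt_eqF// mul0r (_ : `]0, 0]%classic = set0) ?integral_set0//.
  by apply/seteqP; split => // u /=; rewrite in_itv/= => /andP[h1 h2];
    move: (lt_le_trans h1 h2); rewrite ltxx.
pose F k : set (measurableTypeR R) := `]s / k.+1%:R, s]%classic.
have mF k : measurable (F k) by exact: (@measurable_itv R).
have cont u : 0 < u -> {for u, continuous ((@powR R) ^~ (a - 1))}.
  move=> u0; apply/differentiable_continuous/derivable1_diffP/derivable_powR.
  by rewrite in_itv/= u0.
have mp : measurable_fun setT (fun u : measurableTypeR R => (u `^ (a - 1))%:E).
  by apply/measurable_EFinP; exact: measurable_powR.
have UF : `]0, s]%classic = \bigcup_k F k.
  apply/seteqP; split => [u|u [k _]].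
    rewrite /= in_itv/= => /andP[u0 us]; have [k ku] : exists k : nat, s / u < k.+1%:R.
      exists (Num.bound (s / u)); rewrite (lt_trans (archi_boundP _))// ?ltr_nat//.
      by rewrite divr_ge0// ltW.
    exists k => //; rewrite /F /= in_itv/= us andbT ltr_pdivrMr// mulrC -ltr_pdivrMr//.
  rewrite /F /= in_itv/= => /andP[u0 us]; rewrite in_itv/= us andbT.
  by rewrite (lt_trans _ u0)// divr_gt0.
have ndF : nondecreasing_seq F.
  move=> i j ij; apply/subsetPset => u; rewrite /F /= !in_itv/= => /andP[iu ->].
  rewrite andbT (le_lt_trans _ iu)// ler_pM2l// lef_pV2 ?posrE// ler_nat//.
have cv : (\int[mu]_(u in F k) (u `^ (a - 1))%:E)%E @[k --> \oo] -->
    (\int[mu]_(u in `]0%R, s]) (u `^ (a - 1))%:E)%E.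
  rewrite UF; apply: ge0_nondecreasing_set_cvg_integral => //.
  - by move=> k; exact: measurable_funS mp.
  - by move=> k u _; rewrite lee_fin powR_ge0.
have intF k : (\int[mu]_(u in F k) (u `^ (a - 1))%:E =
    (s `^ a / a - (s / k.+1%:R) `^ a / a)%:E)%E.
  have [k0|k0] := eqVneq k 0%N.
    rewrite k0 divr1 subrr (_ : F 0%N = set0) ?integral_set0//.
    apply/seteqP; split => // u; rewrite /F /= divr1 in_itv/= => /andP[h1 h2].
    by move: (lt_le_trans h1 h2); rewrite ltxx.
  have lts : s / k.+1%:R < s.
    by rewrite ltr_pdivrMr// ltr_pMr// ltr1n ltnS lt0n.
  have pos : 0 < s / k.+1%:R by rewrite divr_gt0.
  have dF (u : R) : 0 < u -> is_derive u (1 : R) (fun v : R => v `^ a / a) (u `^ (a - 1)).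
    move=> u0.
    have du : is_derive u (1 : R) ((@powR R) ^~ a) (a * u `^ (a - 1)).
      have uI : u \in (`]0, +oo[ : interval R) by rewrite in_itv/= u0.
      split; first exact: derivable_powR.
      by rewrite -derive1E powR_derive1.
    have := @is_deriveZ _ _ _ ((@powR R) ^~ a) a^-1 u 1 _ du.
    rewrite (_ : a^-1 \*: _ = fun v => v `^ a / a); last first.
      by apply/funext => v /=; rewrite [RHS]mulrC.
    by rewrite -[X in is_derive _ _ _ X]/(a^-1 * (a * u `^ (a - 1))) mulrA mulVf ?gt_eqF// mul1r.
  have cF (u : R) : 0 < u -> {for u, continuous (fun v : R => v `^ a / a)}.
    move=> u0; apply/differentiable_continuous/derivable1_diffP.
    by case: (dF u u0).
  rewrite integral_itv_obnd_cbnd; last exact: measurable_funS mp.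
  rewrite (@continuous_FTC2 _ _ (fun v => v `^ a / a))//.
  - apply: continuous_in_subspaceT => u; rewrite inE/= in_itv/= => /andP[u1 _].
    by apply: cont; exact: lt_le_trans u1.
  - split.
    + move=> u; rewrite in_itv/= => /andP[u1 _].
      by have [] := dF u (lt_trans pos u1).
    + apply: cvg_at_right_filter.
      exact: cF.
    + apply: cvg_at_left_filter.
      exact: cF.
  - move=> u; rewrite in_itv/= => /andP[u1 _]; rewrite derive1E.
    by have [] := dF u (lt_trans pos u1).
have cv2 : (\int[mu]_(u in F k) (u `^ (a - 1))%:E)%E @[k --> \oo] --> (s `^ a / a)%:E.
  under eq_fun do rewrite intF.
  apply: cvg_EFin; first exact: nearW.
  rewrite -[X in _ --> X]subr0; apply: cvgB; first exact: cvg_cst.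
  rewrite -[X in _ --> X](mulr0 (s `^ a / a)).
  rewrite (_ : (fun k => _) = (fun k => s `^ a / a * (k.+1%:R^-1) `^ a)); last first.
    by apply/funext => k /=; rewrite powRM ?invr_ge0 ?ltW// mulrAC.
  apply: cvgM; first exact: cvg_cst.
  have /cvg_at_rightP := powR_cvg0 a0; apply; split => [k|].
    by rewrite invr_gt0.
  exact: cvg_harmonic.
exact: (cvg_unique _ cv cv2).
Qed.

End climbing_paths.

(** * Construction of competitors for the minimal action *)

Section climb.
Context {R : realType}.
Local Notation mu := (@lebesgue_measure R).
Variables (alpha : R).
Hypothesis alpha_gt0 : 0 < alpha.

(* A path [psi] on [0, b] with derivative [g], ending at height [y], of energy at
   most [E], whose inverse potential is dominated by a measurable [V] of integral
   at most [Q]. *)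
Definition climb (b y E Q : R) := exists psi g V : R -> R,
  [/\ [/\ mu.-integrable setT (EFin \o g), measurable_fun setT V &
          forall s, 0 <= V s],
      [/\ psi 0 = 0, psi b = y & forall u v, 0 <= u -> u <= v -> v <= b ->
            (psi v - psi u)%:E = (\int[mu]_(s in `]u, v]) (g s)%:E)%E],
      (\int[mu]_(s in `]0%R, b]) ((g s) ^+ 2)%:E <= E%:E)%E,
      (\int[mu]_(s in `]0%R, b]) (V s)%:E <= Q%:E)%E &
      forall s, 0 < s -> s <= b -> 0 < psi s /\ (psi s `^ alpha)^-1 <= V s].

Lemma integral_itv_cat (f : R -> \bar R) (u v w : R) : u <= v -> v <= w ->
  measurable_fun setT f -> (forall s, 0 <= f s)%E ->
  (\int[mu]_(s in `]u, w]) f s =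
   \int[mu]_(s in `]u, v]) f s + \int[mu]_(s in `]v, w]) f s)%E.
Proof.
move=> uv vw mf f0.
have -> : `]u, w]%classic = `]u, v]%classic `|` `]v, w]%classic.
  by rewrite -itv_bndbnd_setU.
rewrite ge0_integral_setU//.
- exact: measurable_funS mf.
- apply/disj_set2P; rewrite -subset0 => z [] /=; rewrite !in_itv/= => /andP[_ zx] /andP[xz _].
  by move: (le_lt_trans zx xz); rewrite ltxx.
Qed.

Lemma integrable_itv_cat (g : R -> R) (u v w : R) : u <= v -> v <= w ->
  mu.-integrable setT (EFin \o g) ->
  (\int[mu]_(s in `]u, w]) (g s)%:E =
   \int[mu]_(s in `]u, v]) (g s)%:E + \int[mu]_(s in `]v, w]) (g s)%:E)%E.
Proof.
move=> uv vw ig.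
have -> : `]u, w]%classic = `]u, v]%classic `|` `]v, w]%classic.
  by rewrite -itv_bndbnd_setU.
rewrite integral_setU_EFin//.
- by case/integrableP: ig => /measurable_EFinP mg _; exact: measurable_funS mg.
- apply/disj_set2P; rewrite -subset0 => z [] /=; rewrite !in_itv/= => /andP[_ zx] /andP[xz _].
  by move: (le_lt_trans zx xz); rewrite ltxx.
Qed.

(** The path [u^beta] has energy density [beta^2 * u^(2 * beta - 2)] and inverse potential
    [u^(- alpha * beta)]; both are integrable at 0 by the conditions on [beta]. *)
Lemma climb_powR (beta r : R) : 0 < r -> 1 < 2 * beta -> alpha * beta < 1 ->
  climb r (r `^ beta) (beta ^+ 2 * (r `^ (2 * beta - 1) / (2 * beta - 1)))
    (r `^ (1 - alpha * beta) / (1 - alpha * beta)).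
Proof.
move=> r0 b1 ab1.
have b0 : 0 < beta by lra.
have mpow c : measurable_fun setT (fun u : R => u `^ c).
  exact: measurable_powR.
have mitv x y : measurable (`]x, y]%classic : set (measurableTypeR R)).
  exact: (@measurable_itv R).
(* The cut-off outside []0, r]] makes the density integrable on the whole line, as [climb]
   demands. *)
pose g := (fun u : R => beta * u `^ (beta - 1)) \_ `]0, r].
have gE u v : 0 <= u -> u <= v -> v <= r ->
    (\int[mu]_(s in `]u, v]) (g s)%:E =
     \int[mu]_(s in `]u, v]) (beta * s `^ (beta - 1))%:E)%E.
  move=> u0 uv vr; apply: eq_integral => s; rewrite inE /= in_itv/= => /andP[us sv].
  rewrite /g /patch mem_set//= in_itv/= (le_lt_trans u0 us)/=.
  exact: le_trans vr.
have mbp : measurable_fun setT (fun u : R => (beta * u `^ (beta - 1))%:E).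
  by apply/measurable_EFinP; apply: measurable_funM => //; exact: mpow.
have powE s : 0 <= s ->
    (\int[mu]_(u in `]0%R, s]) (beta * u `^ (beta - 1))%:E = (s `^ beta)%:E)%E.
  move=> s0; under eq_integral do rewrite EFinM.
  rewrite ge0_integralZl_EFin//.
  - by rewrite powR_integral// -EFinM mulrC divfK// gt_eqF.
  - by move=> u _; rewrite lee_fin powR_ge0.
  - by apply/measurable_EFinP; exact: measurable_funS (mpow _).
  - exact: ltW.
exists (fun s => s `^ beta), g, (fun s => s `^ ((1 - alpha * beta) - 1)); split.
- split.
  + apply/integrableP; split.
      apply/measurable_EFinP.
      apply: (measurable_restrictT (fun u : measurableTypeR R => beta * u `^ (beta - 1)) (mitv 0 r)).1.
      by apply/measurable_EFinP; exact: measurable_funS mbp.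
    have nE : (\int[mu]_s `|(EFin \o g) s| =
        \int[mu]_(s in `]0%R, r]) (beta * s `^ (beta - 1))%:E)%E.
      rewrite [RHS]integral_mkcond; apply: eq_integral => s _ /=.
      rewrite /g /patch; case: ifPn => _; last by rewrite normr0.
      by rewrite ger0_norm// mulr_ge0 ?powR_ge0// ltW.
    by rewrite [X in (X < _)%E]nE powE ?ltry// ltW.
  + exact: mpow.
  + by move=> s; exact: powR_ge0.
- split; [by rewrite powR0// gt_eqF|by []|].
  move=> u v u0 uv vr; rewrite gE//.
  have nn s : (0 <= (beta * s `^ (beta - 1))%:E)%E.
    by rewrite lee_fin mulr_ge0 ?powR_ge0// ltW.
  have := integral_itv_cat u0 uv mbp nn.
  rewrite !powE// ?(le_trans u0)// EFinB => ->.
  by rewrite addeAC subee ?add0e.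
- rewrite [X in (X <= _)%E](_ : _ = \int[mu]_(s in `]0%R, r]) ((beta ^+ 2)%:E *
      (s `^ ((2 * beta - 1) - 1))%:E))%E; last first.
    apply: eq_integral => s; rewrite inE /= in_itv/= => sr.
    have sr' : `]0, r]%classic s by rewrite /= in_itv.
    rewrite /g /patch (mem_set sr').
    rewrite exprMn EFinM -[(s `^ _) ^+ 2]powR_mulrn ?powR_ge0// -powRrM; congr (_ * (_ `^ _)%:E)%E; ring.
  rewrite ge0_integralZl_EFin//.
  + by rewrite powR_integral ?subr_gt0// ltW.
  + by move=> u _; rewrite lee_fin powR_ge0.
  + by apply/measurable_EFinP; exact: measurable_funS (mpow _).
  + exact: sqr_ge0.
- by rewrite powR_integral ?subr_gt0// ltW.
- move=> s s0 sr; split; first exact: powR_gt0.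
  by rewrite -powRrM -powRN; rewrite le_eqVlt; apply/orP; left; apply/eqP; congr (_ `^ _); ring.
Qed.

(** The path is prolonged by a segment of slope [dy / db]; being nondecreasing, the segment stays
    above [y], which bounds its inverse potential by that at [y]. *)
Lemma climb_step (b y E Q db dy : R) : 0 < b -> 0 < y -> 0 < db -> 0 <= dy ->
  climb b y E Q ->
  climb (b + db) (y + dy) (E + dy ^+ 2 / db) (Q + db * (y `^ alpha)^-1).
Proof.
move=> b0 y0 db0 dy0 [psi [g [V [[ig mV V0] [psi0 psib psiE] gE VQ psiV]]]].
pose c := dy / db.
have c0 : 0 <= c by rewrite divr_ge0// ltW.
have mitv x z : measurable (`]x, z]%classic : set (measurableTypeR R)).
  exact: (@measurable_itv R).
have mg : measurable_fun setT g by case/integrableP: ig => /measurable_EFinP.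
pose g' s := if s <= b then g s else c * \1_(`]b, b + db]%classic) s.
pose psi' s := if s <= b then psi s else y + c * (s - b).
pose V' s := if s <= b then V s else (y `^ alpha)^-1.
have mle : measurable_fun setT (fun s : R => s <= b).
  exact: measurable_fun_ler.
have m1 : measurable_fun setT (fun s : R => c * \1_(`]b, b + db]%classic) s).
  by apply: measurable_funM => //; apply: measurable_indic; exact: measurable_itv.
have mg' : measurable_fun setT g' by exact: measurable_fun_ifT.
have mV' : measurable_fun setT V' by exact: measurable_fun_ifT.
have lo (F G : R -> R) u v : v <= b -> (forall s, s <= b -> F s = G s) ->
    (\int[mu]_(s in `]u, v]) (F s)%:E = \int[mu]_(s in `]u, v]) (G s)%:E)%E.
  move=> vb FG; apply: eq_integral => s; rewrite inE /= in_itv/= => /andP[_ sv].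
  by rewrite FG// (le_trans sv).
have hi (F : R -> R) (k u v : R) : b <= u -> u <= v -> v <= b + db ->
    (forall s, b < s -> s <= b + db -> F s = k) ->
    (\int[mu]_(s in `]u, v]) (F s)%:E = (k * (v - u))%:E)%E.
  move=> bu uv vb Fk; rewrite (eq_integral (cst k%:E)); last first.
    move=> s; rewrite inE /= in_itv/= => /andP[us sv].
    by rewrite /= Fk// ?(le_lt_trans bu us)// (le_trans sv).
  rewrite integral_cst// [X in (_ * X)%E]lebesgue_measure_itv/= lte_fin -EFinB EFinM.
  move: uv; rewrite le_eqVlt => /predU1P[->|->//].
  by rewrite ltxx subrr.
have g'hi s : b < s -> s <= b + db -> g' s = c.
  by move=> bs sb; rewrite /g' leNgt bs/= indicE mem_set ?mulr1//= in_itv/= bs.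
have ig' : mu.-integrable setT (EFin \o g').
  apply: (@le_integrable _ _ _ mu setT measurableT (EFin \o g')
     (fun s => `|(g s)%:E| + `|(c * \1_(`]b, b + db]%classic) s)%:E|)%E).
  - exact/measurable_EFinP.
  - move=> s _; rewrite [leRHS]gee0_abs ?adde_ge0//= /g'.
    by case: ifPn => _; [rewrite leeDl|rewrite leeDr].
  - apply: integrableD => //; first exact: integrable_abse.
    apply: integrable_abse.
    rewrite (_ : (fun _ => _) = (fun s => c%:E * (\1_(`]b, b + db]%classic) s)%:E)%E); last first.
      by apply/funext => s; rewrite EFinM.
    apply: integrableZl => //; exact: integrable_indic_itv.
exists psi', g', V'; split.
- by split => // s; rewrite /V'; case: ifPn => // _; rewrite invr_ge0 powR_ge0.
- split.
  + by rewrite /psi' ltW.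
  + rewrite /psi' leNgt ltrDl db0/= [b + db - b]addrAC subrr add0r.
    by rewrite /c divfK// gt_eqF.
  + move=> u v u0 uv vb.
    have [vb'|bv] := leP v b.
      rewrite (lo g' g)//; last by move=> s sb; rewrite /g' sb.
      by rewrite /psi' vb' (le_trans uv vb') psiE.
    have [ub|bu] := leP u b; last first.
      rewrite (hi g' c u v (ltW bu) uv vb g'hi).
      by rewrite /psi' leNgt bv leNgt bu/=; congr EFin; ring.
    rewrite (integrable_itv_cat ub (ltW bv) ig') (lo g' g)//; last first.
      by move=> s sb; rewrite /g' sb.
    rewrite (hi g' c b v (lexx b) (ltW bv) vb g'hi).
    by rewrite -psiE// -EFinD /psi' ub leNgt bv/= psib; congr EFin; ring.
- rewrite (@integral_itv_cat _ _ b)//; last 4 first.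
  + exact: ltW.
  + by rewrite lerDl ltW.
  + by apply/measurable_EFinP; exact: measurable_funX.
  + by move=> s; rewrite lee_fin sqr_ge0.
  rewrite EFinD leeD//.
    by rewrite (lo _ (fun s => g s ^+ 2))// => s sb; rewrite /g' sb.
  rewrite (hi _ (c ^+ 2)) ?lerDl ?(ltW db0)//; last by move=> s s1 s2; rewrite g'hi.
  rewrite lee_fin [b + db - b]addrAC subrr add0r /c le_eqVlt; apply/orP; left; apply/eqP.
  by field; rewrite gt_eqF.
- rewrite (@integral_itv_cat _ _ b)//; last 4 first.
  + exact: ltW.
  + by rewrite lerDl ltW.
  + exact/measurable_EFinP.
  + by move=> s; rewrite lee_fin /V'; case: ifPn => // _; rewrite invr_ge0 powR_ge0.
  rewrite EFinD leeD//.
    by rewrite (lo _ V)// => s sb; rewrite /V' sb.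
  rewrite (hi _ (y `^ alpha)^-1) ?lerDl ?(ltW db0)//; last first.
    by move=> s s1 s2; rewrite /V' leNgt s1.
  by rewrite lee_fin [b + db - b]addrAC subrr add0r mulrC.
- move=> s s0 sb; rewrite /psi' /V'; case: ifPn => [sb'|]; first exact: psiV.
  rewrite -ltNge => bs; have yy : y <= y + c * (s - b).
    by rewrite lerDl mulr_ge0// subr_ge0 ltW.
  split; first exact: lt_le_trans yy.
  rewrite lef_pV2 ?posrE ?powR_gt0//; last exact: lt_le_trans yy.
  by rewrite ge0_ler_powR ?nnegrE ?(ltW alpha_gt0)// ?(ltW y0)// (le_trans _ yy)// ltW.
Qed.

Lemma abs_continuous_continuous (a b : R) (f : R -> R) :
  abs_continuous a b f -> {within `[a, b], continuous f}.
Proof.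
move=> acf; apply/subspace_continuousP => x xab.
apply/cvgrPdist_lt => e e0.
have [delta d0 H] := abs_continuous_family acf e0.
rewrite near_withinE; near=> y => yab.
have /andP[ax xb] : a <= x <= b by move: xab; rewrite /= in_itv.
have /andP[ay yb] : a <= y <= b by move: yab; rewrite /= in_itv.
have yx : `|x - y| < delta by near: y; exact: nbhsx_ballx.
have [xy|xy] := leP x y.
  have := H [:: (x, y)]; rewrite /itv_family /total_length /subitv/= !big_seq1/=.
  rewrite ax xy yb distrC; apply => //; by move: yx; rewrite distrC ger0_norm ?subr_ge0.
have := H [:: (y, x)]; rewrite /itv_family /total_length /subitv/= !big_seq1/=.
rewrite ay xb ltW//; apply => //.
by move: yx; rewrite ger0_norm ?subr_ge0// ltW.
Unshelve. all: by end_near. Qed.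

(** The path may last longer than 1: what it spends after time 1 is nonnegative. *)
Lemma I0_le_climb (lambda b y E Q : R) : 0 <= lambda -> 1 <= b ->
  climb b y E Q -> (I0 alpha lambda <= (E + lambda * Q)%:E)%E.
Proof.
move=> l0 b1 [psi [g [V [[ig mV V0] [psi0 psib psiE] gE VQ psiV]]]].
have psiE1 u v : 0 <= u -> u <= v -> v <= 1 ->
    (psi v - psi u)%:E = (\int[mu]_(s in `]u, v]) (g s)%:E)%E.
  by move=> u0 uv v1; apply: psiE => //; exact: le_trans b1.
have mg : measurable_fun setT g by case/integrableP: ig => /measurable_EFinP.
have acpsi := primitive_abs_continuous ig psiE1.
apply: (@le_trans _ _ (action alpha lambda psi)).
  apply: ereal_inf_lbound; exists psi => //; split => //.
  exact: abs_continuous_continuous.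
rewrite /action EFinD; apply: leeD.
  rewrite /energy asboolT//; apply: le_trans gE.
  apply: (@le_trans _ _ (\int[mu]_(s in `[0%R, 1%R]) ((g s) ^+ 2)%:E)%E).
    exact: (primitive_energy ig psiE1).
  rewrite -integral_itv_obnd_cbnd; last first.
    by apply/measurable_EFinP; apply: measurable_funX; exact: measurable_funS mg.
  apply: ge0_le_integral_subset => [s _|s _|s].
  - by rewrite lee_fin sqr_ge0.
  - by rewrite lee_fin sqr_ge0.
  - by rewrite /= !in_itv/= => /andP[-> s1]; rewrite (le_trans s1 b1).
rewrite EFinM lee_wpmul2l// ?lee_fin//; apply: le_trans VQ.
apply: (@le_trans _ _ (\int[mu]_(s in `[0%R, 1%R]) (V s)%:E)%E).
  (* At time 0 the inverse potential is [+oo] in [\bar R], so this point is discarded as a null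
     set. *)
  apply: (@ge0_le_integral_ae _ _ _ mu _ [set 0]) => //.
  - by rewrite [LHS]lebesgue_measure_set1.
  - by move=> s _; rewrite inve_ge0 lee_fin powR_ge0.
  - by move=> s _; rewrite lee_fin.
  move=> s; rewrite /= in_itv/= => /andP[s0 s1] ns0.
  have {}s0 : 0 < s by rewrite lt_neqAle s0 andbT; apply/eqP => s0'; apply: ns0.
  have [ps psV] := psiV s s0 (le_trans s1 b1).
  by rewrite gtr0_norm// inver gt_eqF ?powR_gt0.
rewrite -integral_itv_obnd_cbnd; last first.
  by apply/measurable_EFinP; exact: measurable_funS mV.
apply: ge0_le_integral_subset => [s _|s _|s].
- by rewrite lee_fin.
- by rewrite lee_fin.
- by rewrite /= !in_itv/= => /andP[-> s1]; rewrite (le_trans s1 b1).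
Qed.

End climb.

(** * Comparison of discrete paths with the minimal action *)

Section discrete_path.
Context {R : realType}.
Local Notation mu := (@lebesgue_measure R).
Variables (alpha lambda : R).
Hypotheses (alpha_gt0 : 0 < alpha) (lambda_gt0 : 0 < lambda).

Lemma climb_sum (b q E Q : R) (d m : nat -> R) (k : nat) : 0 < b -> 0 < q ->
  (forall j, 0 < d j) -> (forall j, m j <= m j.+1) -> climb alpha b q E Q ->
  climb alpha (b + \sum_(j < k) d j) (q + (m k - m 0%N))
    (E + \sum_(j < k) (m j.+1 - m j) ^+ 2 / d j)
    (Q + \sum_(j < k) d j * ((q + (m j - m 0%N)) `^ alpha)^-1).
Proof.
move=> b0 q0 d0 mS H; elim: k => [|k IH]; first by rewrite !big_ord0 subrr !addr0.
rewrite !big_ord_recr/= ![_ + (\sum_(_ < k) _ + _)]addrA.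
have -> : q + (m k.+1 - m 0%N) = q + (m k - m 0%N) + (m k.+1 - m k) by ring.
apply: climb_step => //.
- by rewrite ltr_wpDr// sumr_ge0// => j _; exact: ltW.
- rewrite ltr_wpDr// subr_ge0; elim: k {IH} => // k; move/le_trans; exact.
- by rewrite subr_ge0.
Qed.

(* The energy, and the potential up to twice the first step, of the path which
   first climbs as [s `^ beta] up to time [r]. *)
Definition rise_cost (beta r : R) :=
  beta ^+ 2 * (r `^ (2 * beta - 1) / (2 * beta - 1)) +
  lambda * (r `^ (1 - alpha * beta) / (1 - alpha * beta) + 2 * r `^ (1 - alpha * beta)).

Fixpoint running_max (y : nat -> R) (i : nat) : R :=
  if i is j.+1 then Num.max (running_max y j) `|y i| else `|y 0%N|.

Lemma running_maxS y i : running_max y i <= running_max y i.+1.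
Proof. by rewrite /= le_max lexx. Qed.

Lemma le_running_max y i : `|y i| <= running_max y i.
Proof. by case: i => //= i; rewrite le_max lexx orbT. Qed.

(** When the maximum rises, it rises to [|y i.+1|] from a value that is at least [|y i|]. *)
Lemma running_max_incr y i :
  (running_max y i.+1 - running_max y i) ^+ 2 <= (y i.+1 - y i) ^+ 2.
Proof.
have h := le_running_max y i.
have h2 : `|y i.+1| - `|y i| <= `|y i.+1 - y i| by exact: lerB_dist.
rewrite -[leRHS]real_normK ?num_real// ler_sqr ?nnegrE// ?subr_ge0 ?running_maxS//=.
by rewrite /Num.max; case: ifP => _; [lra|rewrite subrr].
Qed.

(* The path rises to [q := r `^ beta] during the first mesh [r], and then interpolates
   [q + running_max y - `|y 0|] linearly with a delay [r], so that over each step its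
   height is at least its value at the beginning of the step. *)
Lemma I0_le_discrete (beta kappa eps e : R) (N : nat) (d y : nat -> R) :
  1 < 2 * beta -> alpha * beta < 1 -> 0 <= kappa -> 0 < e -> 0 < eps ->
  eps <= kappa * e `^ alpha -> `|y 0%N| + e <= N.+2%:R^-1 `^ beta ->
  N.+2%:R^-1 <= d 0%N -> d 0%N <= 2 * N.+2%:R^-1 ->
  (forall j, d j.+1 = N.+2%:R^-1) ->
  (I0 alpha lambda <= (rise_cost beta N.+2%:R^-1 +
     \sum_(j < N.+1) (y j.+1 - y j) ^+ 2 / d j +
     lambda * (1 + kappa) * N.+2%:R^-1 *
       \sum_(i < N) (eps + `|y i.+1| `^ alpha)^-1)%:E)%E.
Proof.
move=> b1 ab1 k0 e0 eps0 epse yq d0l d0u dS.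
set r := N.+2%:R^-1 in yq d0l d0u dS *.
have r0 : 0 < r by rewrite invr_gt0.
have q0 : 0 < r `^ beta by exact: powR_gt0.
have dp j : 0 < d j by case: j => [|j]; [exact: lt_le_trans d0l|rewrite dS].
have H := climb_sum N.+1 r0 q0 dp (running_maxS y) (climb_powR r0 b1 ab1).
(* The rise, the first step and the [N] others last at least [N + 2] meshes, that is 1. *)
have tot : 1 <= r + \sum_(j < N.+1) d j.
  rewrite big_ord_recl/=; under eq_bigr do rewrite /bump/= dS.
  rewrite sumr_const card_ord.
  have -> : 1 = r + (r + r *+ N).
    have <- : N.+2%:R * r = 1 by rewrite mulfV.
    by rewrite -addn2 natrD -mulr_natr; ring.
  by rewrite !lerD.
apply: le_trans (I0_le_climb (ltW lambda_gt0) tot H) _.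
rewrite lee_fin /rise_cost.
have SE : \sum_(j < N.+1) (running_max y j.+1 - running_max y j) ^+ 2 / d j <=
          \sum_(j < N.+1) (y j.+1 - y j) ^+ 2 / d j.
  apply: ler_sum => j _; rewrite ler_wpM2r ?invr_ge0 ?(ltW (dp _))//.
  exact: running_max_incr.
(* The first step starts from the height [r^beta] and lasts at most [2 * r]: this is the last term
   of [rise_cost]. *)
have SQ : \sum_(j < N.+1) d j * ((r `^ beta + (running_max y j - running_max y 0)) `^ alpha)^-1
   <= 2 * r `^ (1 - alpha * beta) +
      (1 + kappa) * r * \sum_(i < N) (eps + `|y i.+1| `^ alpha)^-1.
  rewrite big_ord_recl/= subrr addr0; apply: lerD.
    rewrite -powRrM -powRN (mulrC beta) powRD ?gt_eqF ?subr_gt0//.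
    rewrite powRr1 ?(ltW r0)// mulrA ler_wpM2r ?powR_ge0//.
  rewrite mulr_sumr; apply: ler_sum => i _; rewrite /bump /= add0n dS [_ * r]mulrC -[leRHS]mulrA.
  rewrite ler_wpM2l ?(ltW r0)//.
  set m := Num.max _ _.
  have ym : `|y i.+1| <= m by exact: (le_running_max y i.+1).
  have m0 : 0 <= m by exact: le_trans ym.
  (* The initial rise pays for the subtraction of [|y 0|] and leaves the margin [e], whose power
     absorbs [eps] at the price of a factor [1 + kappa]. *)
  have eqm : e + m <= r `^ beta + (m - `|y 0%N|) by lra.
  have P1 : eps + `|y i.+1| `^ alpha <=
     (1 + kappa) * (r `^ beta + (m - `|y 0%N|)) `^ alpha.
    rewrite mulrDl mul1r addrC; apply: lerD.
      by rewrite ge0_ler_powR ?nnegrE ?(ltW alpha_gt0)//; lra.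
    apply: (le_trans epse); rewrite ler_wpM2l//.
    by rewrite ge0_ler_powR ?nnegrE ?(ltW alpha_gt0)//; lra.
  have P2 : 0 < eps + `|y i.+1| `^ alpha by rewrite ltr_pwDl// powR_ge0.
  have P3 : 0 < (r `^ beta + (m - `|y 0%N|)) `^ alpha.
    by apply: powR_gt0; lra.
  by rewrite -ler_pdivrMl ?ltr_pwDl// -invfM lef_pV2 ?posrE ?mulr_gt0// ltr_pwDl.
have := ler_wpM2l (ltW lambda_gt0) SQ; set X := \sum_(j < N.+1) d j * _.
set Y := \sum_(i < N) _; set W := r `^ (1 - alpha * beta) / _; move=> SQ'.
have -> : lambda * (1 + kappa) * r * Y = lambda * ((1 + kappa) * r * Y) by ring.
move: SE SQ'; rewrite !mulrDr; lra.
Qed.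

Lemma rise_cost_cvg (beta : R) : 1 < 2 * beta -> alpha * beta < 1 ->
  forall e, 0 < e -> \forall n \near \oo, rise_cost beta n.+2%:R^-1 < e.
Proof.
move=> b1 ab1 e e0.
have invc : (fun n => (n.+2%:R^-1 : R)) @ \oo --> (0 : R).
  by have := @cvg_harmonic R; rewrite -cvg_shiftS.
have powc c : 0 < c -> (fun n => (n.+2%:R^-1 : R) `^ c) @ \oo --> (0 : R).
  move=> c0; have /cvg_at_rightP := powR_cvg0 c0; apply; split => // n.
have : (fun n => rise_cost beta n.+2%:R^-1) @ \oo --> (0 : R).
  rewrite [X in _ --> X](_ : 0 = beta ^+ 2 * (0 / (2 * beta - 1)) +
    lambda * (0 / (1 - alpha * beta) + 2 * 0)); last by ring.
  apply: cvgD.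
    apply: cvgMr; apply: cvgMl; apply: powc; lra.
  apply: cvgMr; apply: cvgD; [apply: cvgMl|apply: cvgMr]; apply: powc; lra.
move/cvgr_lt; exact.
Qed.

Lemma supercritical_exponent : alpha < 2 ->
  exists beta, 1 < 2 * beta /\ alpha * beta < 1.
Proof.
(* This is the midpoint of [1 / 2] and [1 / alpha]. *)
move=> a2; have a0 := alpha_gt0; exists (2^-1 + (2 - alpha) / (4 * alpha)).
have h : 0 < (2 - alpha) / (4 * alpha) by rewrite divr_gt0// ?mulr_gt0//; lra.
split; first lra.
rewrite mulrDr (_ : alpha * ((2 - alpha) / (4 * alpha)) = (2 - alpha) / 4); first lra.
by field; rewrite gt_eqF.
Qed.

Lemma I0_ltoo : alpha < 2 -> (I0 alpha lambda < +oo)%E.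
Proof.
move=> /supercritical_exponent[b [b1 ab1]].
have := I0_le_climb (ltW lambda_gt0) (lexx 1) (climb_powR ltr01 b1 ab1).
by move/le_lt_trans; apply; rewrite ltry.
Qed.

(** The action is at least [min 1 lambda]: if the energy is less than 1, the modulus of continuity
    keeps [|psi|] below 1 on [[0, 1]], and the integral of the inverse potential is at least 1. *)
Lemma I0_gt0 : (0 < I0 alpha lambda)%E.
Proof.
apply: (@lt_le_trans _ _ (Num.min 1 lambda)%:E); first by rewrite lte_fin lt_min ltr01.
apply: le_ereal_inf_tmp => _ [psi [cpsi psi0] <-]; rewrite /action.
have pos : (0 <= \int[mu]_(s in `[0%R, 1%R]) ((`|psi s| `^ alpha)%:E)^-1)%E.
  by apply: integral_ge0 => s _; rewrite inve_ge0 lee_fin powR_ge0.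
rewrite /energy; case: asboolP => [ac|_]; last first.
  by rewrite addye ?leey// gt_eqF// (lt_le_trans (ltNyr 0))// mule_ge0// lee_fin ltW.
have epos : (0 <= \int[mu]_(s in `[0%R, 1%R]) ((psi^`()%classic s) ^+ 2)%:E)%E.
  by apply: integral_ge0 => s _; rewrite lee_fin sqr_ge0.
have [e1|e1] := leP 1%E (\int[mu]_(s in `[0%R, 1%R]) ((psi^`()%classic s) ^+ 2)%:E)%E.
  apply: (@le_trans _ _ 1%E); first by rewrite lee_fin ge_min lexx.
  by rewrite (le_trans e1)// leeDl// mule_ge0// lee_fin ltW.
have [Phi [inc Phi0 Phi1]] := energy_modulus ltr01 ac (lt_trans e1 (ltry 1)).
have {}Phi1 : Phi 1 < 1 by rewrite -lte_fin (le_lt_trans Phi1).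
apply: (@le_trans _ _ lambda%:E); first by rewrite lee_fin ge_min lexx orbT.
rewrite -[leLHS]add0e; apply: leeD => //.
rewrite -[leLHS]mule1 lee_wpmul2l ?lee_fin ?(ltW lambda_gt0)//.
have -> : (1 = \int[mu]_(s in `[0%R, 1%R]) 1)%E.
  rewrite integral_cst// mul1e [RHS]lebesgue_measure_itv/= lte_fin ltr01.
  by rewrite oppr0 adde0.
apply: ge0_le_integral_subset => [s _|s _|s] //.
  by rewrite inve_ge0 lee_fin powR_ge0.
rewrite /= in_itv/= => /andP[s0 s1]; split; first by rewrite s0.
have [_ h] := inc 0 s (lexx 0) s0 s1; have [h1 _] := inc s 1 s0 s1 (lexx 1).
have psi1 : `|psi s| `^ alpha <= 1.
  have -> : 1 = 1 `^ alpha :> R by rewrite powR1.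
  rewrite ge0_ler_powR ?nnegrE ?(ltW alpha_gt0)//.
  rewrite -(@ler_sqr _ _ 1) ?nnegrE// real_normK ?num_real// expr1n.
  move: h h1; rewrite psi0 Phi0 !subr0 => h h1.
  apply: (le_trans h); rewrite -[leRHS](mulr1 1).
  apply: ler_pM => //; last by lra.
  by have [+ _] := inc 0 s (lexx 0) s0 s1; rewrite Phi0 subr0.
rewrite inver; case: ifPn => [_|n0]; first exact: leey.
by rewrite lee_fin invf_ge1// lt_neqAle eq_sym n0 powR_ge0.
Qed.

End discrete_path.

(** * Expectations of functions of independent Gaussian variables *)

Section staircase.
Context {R : realType}.

(** For [x >= 0] and [h > 0], this is [h * floor (x / h)] capped at [N * h]. As a sum of indicators
    of half-lines, it makes products expand into indicators of the events of
    [mutually_independent]. *)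
Definition staircase (N : nat) (h x : R) : R :=
  \sum_(j < N) h * \1_(`[j.+1%:R * h, +oo[%classic) x.

Lemma staircase_ge0 N h x : 0 <= h -> 0 <= staircase N h x.
Proof. by move=> h0; apply: sumr_ge0 => j _; rewrite mulr_ge0. Qed.

Lemma staircase_top N h x : 0 <= h -> N%:R * h <= x ->
  staircase N h x = N%:R * h.
Proof.
move=> h0 Nx; rewrite /staircase (eq_bigr (fun=> h)); last first.
  move=> j _; rewrite indicE mem_set ?mulr1//= in_itv/= andbT.
  by apply: le_trans Nx; rewrite ler_wpM2r// ler_nat.
by rewrite sumr_const card_ord [RHS]mulr_natl.
Qed.

Lemma staircaseS N h x : staircase N.+1 h x =
  staircase N h x + h * \1_(`[N.+1%:R * h, +oo[%classic) x.
Proof. by rewrite /staircase big_ord_recr. Qed.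

Lemma staircase_le N h x : 0 <= h -> 0 <= x -> staircase N h x <= x.
Proof.
move=> h0 x0; elim: N => [|N ih]; first by rewrite /staircase big_ord0.
have [Nx|xN] := leP (N.+1%:R * h) x; first by rewrite staircase_top.
rewrite staircaseS indicE memNset ?mulr0 ?addr0//= in_itv/= andbT.
by rewrite leNgt xN.
Qed.

Lemma staircase_gt N h x : 0 < h -> x < N.+1%:R * h -> x - h < staircase N h x.
Proof.
move=> h0; elim: N => [|N ih] xN.
  by rewrite /staircase big_ord0 subr_lt0 -[ltRHS]mul1r.
have [Nx|{}xN] := leP (N.+1%:R * h) x.
  rewrite (staircase_top (ltW h0) Nx); move: xN.
  have -> : N.+2%:R = N.+1%:R + 1 :> R by rewrite natr1.
  by rewrite mulrDl mul1r; lra.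
rewrite staircaseS indicE memNset ?mulr0 ?addr0 ?ih//= in_itv/= andbT.
by rewrite leNgt xN.
Qed.

(** The cap is [k + 1]; once it exceeds [x], the error is at most the mesh [1 / (k + 1)]. *)
Lemma staircase_cvg x : 0 <= x ->
  staircase (k.+1 * k.+1) k.+1%:R^-1 x @[k --> \oo] --> x.
Proof.
move=> x0; apply/cvgrPdist_le => e e0.
near=> k.
have k0 : 0 < k.+1%:R^-1 :> R by rewrite invr_gt0.
rewrite ger0_norm ?subr_ge0 ?(staircase_le _ (ltW k0) x0)//.
have xk : x < k%:R by near: k; exact: nbhs_infty_gtr.
have ke : k.+1%:R^-1 <= e.
  rewrite invf_ple ?posrE// (@le_trans _ _ k%:R) ?ler_nat//.
  by near: k; exact: nbhs_infty_ger.
have : x < (k.+1 * k.+1).+1%:R * k.+1%:R^-1.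
  apply: (lt_le_trans xk); rewrite ler_pdivlMr// -natrM ler_nat.
  by rewrite (leq_trans _ (leqnSn _))// leq_mul.
move/(staircase_gt k0); rewrite ltrBlDr => /ltW xh.
by rewrite lerBlDl (le_trans xh)// lerD2l.
Unshelve. all: by end_near. Qed.

Lemma measurable_staircase N h : measurable_fun setT (staircase N h).
Proof.
rewrite /staircase; apply: measurable_sum => j.
by apply: measurable_funM => //; exact: measurable_indic.
Qed.

End staircase.

Lemma cvg_prod_seq {R : realType} (I : Type) (s : seq I) (u : I -> nat -> R)
    (l : I -> R) : (forall i, u i k @[k --> \oo] --> l i) ->
  \prod_(i <- s) u i k @[k --> \oo] --> \prod_(i <- s) l i.
Proof.
move=> ul; elim: s => [|i s ih].
  by rewrite big_nil; under eq_fun do rewrite big_nil; exact: cvg_cst.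
by rewrite big_cons; under eq_fun do rewrite big_cons; exact: cvgM.
Qed.

Section independent_product.
Context {d : measure_display} {T : measurableType d} {R : realType}.
Variable P : probability T R.
Variables (n : nat) (X : 'I_n -> T -> R).
Hypothesis mX : forall i, measurable_fun setT (X i).
Hypothesis indX : mutually_independent P X.
Hypothesis X0 : forall i w, 0 <= X i w.
Hypothesis finX : forall i, (\int[P]_w (X i w)%:E < +oo)%E.

Let intX i : P.-integrable setT (EFin \o X i).
Proof.
apply/integrableP; split; first exact/measurable_EFinP.
by rewrite (eq_integral (fun w => (X i w)%:E)) ?finX// => w _; rewrite /= ger0_norm.
Qed.

(** Distributing the product over the sums gives one term per map [g] from factors to levels;
    independence factorizes the probability of each event [G g]. *)
Lemma integral_prod_staircase N h : 0 <= h ->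
  (\int[P]_w (\prod_i staircase N h (X i w))%:E =
   (\prod_i fine (\int[P]_w (staircase N h (X i w))%:E))%:E)%E.
Proof.
move=> h0.
pose A (j : 'I_N) : set R := `[j.+1%:R * h, +oo[%classic.
have mA j : measurable (A j) by exact: measurable_itv.
have mXA i j : measurable (X i @^-1` A j) by rewrite -[_ @^-1` _]setTI; exact: mX.
have one i : fine (\int[P]_w (staircase N h (X i w))%:E) =
    \sum_(j < N) h * fine (P (X i @^-1` A j)).
  rewrite /staircase.
  under eq_integral do rewrite -sumEFin.
  rewrite ge0_integral_sum//; last 2 first.
  - move=> j; apply/measurable_EFinP; apply: measurable_funM => //.
    by apply: measurableT_comp; [exact: measurable_indic|exact: mX].
  - by move=> j w _; rewrite lee_fin mulr_ge0.
  rewrite (eq_bigr (fun j : 'I_N => (h * fine (P (X i @^-1` A j)))%:E)); last first.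
    move=> j _; under eq_integral do rewrite EFinM.
    rewrite ge0_integralZl_EFin//.
    - rewrite EFinM fineK ?fin_num_measure//; congr (_ * _)%E.
      by rewrite -[in RHS](setIT (X i @^-1` A j)) -integral_indic//; apply: eq_integral.
    - apply/measurable_EFinP.
      by apply: measurableT_comp; [exact: measurable_indic|exact: mX].
  by rewrite sumEFin.
under eq_bigr do rewrite one.
rewrite bigA_distr_bigA /=.
pose G (g : {ffun 'I_n -> 'I_N}) := [set w | forall i, A (g i) (X i w)].
have mG g : measurable (G g).
  have -> : G g = \bigcap_(i in [set: 'I_n]) (X i @^-1` A (g i)).
    by apply/seteqP; split => [w Gw i _|w Gw i]; [exact: Gw|exact: Gw].
  by apply: fin_bigcap_measurable => // i _; exact: mXA.
have prodE w : (\prod_i staircase N h (X i w))%:E =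
    (\sum_(g : {ffun 'I_n -> 'I_N}) ((h ^+ n)%:E * (\1_(G g) w)%:E))%E.
  rewrite /staircase bigA_distr_bigA/= -sumEFin; apply: eq_bigr => g _.
  rewrite -EFinM big_split/= prodr_const card_ord; congr (_ * _)%:E.
  rewrite [RHS]indicE; have [Gw|nGw] := pselect (G g w).
    by rewrite mem_set// big1// => i _; rewrite indicE mem_set//; exact: Gw.
  rewrite memNset//.
  have [i nAi] : exists i, ~ A (g i) (X i w) by apply/existsNP.
  by rewrite (bigD1 i)//= indicE memNset// mul0r.
under eq_integral do rewrite prodE.
rewrite ge0_integral_sum//; last 2 first.
- move=> g; apply: emeasurable_funM => //; apply/measurable_EFinP.
  exact: measurable_indic.
- by move=> g w _; rewrite -EFinM lee_fin mulr_ge0// exprn_ge0.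
rewrite -sumEFin; apply: eq_bigr => g _.
rewrite ge0_integralZl_EFin//; last 2 first.
- by apply/measurable_EFinP; exact: measurable_indic.
- exact: exprn_ge0.
rewrite integral_indic// setIT big_split/= prodr_const card_ord EFinM.
congr (_ * _)%E.
rewrite (indX (A := fun i => A (g i)))// (big_morph EFin EFinM erefl).
by apply: eq_bigr => i _; rewrite fineK// fin_num_measure.
Qed.

Let stair k x : R := staircase (k.+1 * k.+1) k.+1%:R^-1 x.

Let stair_ge0 k x : 0 <= stair k x.
Proof. exact: staircase_ge0. Qed.

Let stair_le k x : 0 <= x -> stair k x <= x.
Proof. by move=> x0; rewrite /stair staircase_le//. Qed.

Let mstair k i : measurable_fun setT (fun w => stair k (X i w)).
Proof. by apply: measurableT_comp; [exact: measurable_staircase|exact: mX]. Qed.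

Let cvg_stair i :
  fine (\int[P]_w (stair k (X i w))%:E) @[k --> \oo] --> fine (\int[P]_w (X i w)%:E).
Proof.
apply: fine_cvg; rewrite fineK; last exact: (integrable_fin_num measurableT (intX i)).
apply: (@dominated_cvg _ _ _ P setT measurableT
  (fun k w => (stair k (X i w))%:E) (fun w => (X i w)%:E) (fun w => (X i w)%:E)).
- by move=> k; apply/measurable_EFinP; exact: mstair.
- move=> w _; apply: cvg_EFin; first exact: nearW.
  exact: staircase_cvg.
- by [].
- exact: intX.
- by move=> k w _; rewrite /= ger0_norm ?lee_fin ?stair_le.
Qed.

(** Staircases converge from below. Fatou gives [<=], hence also the finiteness of the mean, and the
    staircases lying below the variables give [>=]. *)
Lemma expectation_prod :
  (\int[P]_w (\prod_i X i w)%:E = (\prod_i fine (\int[P]_w (X i w)%:E))%:E)%E.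
Proof.
set L := \prod_i _.
pose a k := \prod_i fine (\int[P]_w (stair k (X i w))%:E).
have aL : a k @[k --> \oo] --> L by apply: cvg_prod_seq => i; exact: cvg_stair.
have aE k : (\int[P]_w (\prod_i stair k (X i w))%:E = (a k)%:E)%E.
  exact: integral_prod_staircase.
have mprod (Y : 'I_n -> T -> R) : (forall i, measurable_fun setT (Y i)) ->
    measurable_fun setT (fun w => (\prod_i Y i w)%:E).
  by move=> mY; apply/measurable_EFinP; exact: measurable_prod.
set J := (X in X = _).
have J0 : (0 <= J)%E by apply: integral_ge0 => w _; rewrite lee_fin prodr_ge0.
have JL : (J <= L%:E)%E.
  have := @fatou _ _ _ P setT measurableT (fun k w => (\prod_i stair k (X i w))%:E).
  have -> : limn_einf (fun k => \int[P]_w (\prod_i stair k (X i w))%:E)%E = L%:E.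
    under eq_fun do rewrite aE.
    have := @cvg_limn_einf_sup _ (fun k => (a k)%:E) L%:E.
    by case=> //; apply: cvg_EFin => //; exact: nearW.
  move=> h; apply: le_trans (h _ _); last 2 first.
  - by move=> k; apply: mprod => i; exact: mstair.
  - by move=> k w _; rewrite lee_fin prodr_ge0.
  have einfE w : limn_einf (fun k => (\prod_i stair k (X i w))%:E) = (\prod_i X i w)%:E.
    have [] // := @cvg_limn_einf_sup _ (fun k => (\prod_i stair k (X i w))%:E)
       (\prod_i X i w)%:E.
    apply: cvg_EFin; first exact: nearW.
    by apply: cvg_prod_seq => i; exact: staircase_cvg.
  by rewrite /J (eq_integral _ _ (fun w _ => einfE w)).
have Jfin : J \is a fin_num by rewrite ge0_fin_numE// (le_lt_trans JL)// ltry.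
apply/eqP; rewrite eq_le JL/= -(fineK Jfin) lee_fin.
apply: (ler_cvg_to aL (@cvg_cst _ (fine J) _ _ _)); apply: nearW => k.
rewrite -lee_fin fineK// -aE; apply: ge0_le_integral_subset => w _.
- by rewrite lee_fin prodr_ge0.
- by rewrite lee_fin prodr_ge0.
- by split => //; rewrite lee_fin ler_prod// => i _; rewrite stair_ge0 stair_le.
Qed.

End independent_product.

Section density.
Context {R : realType}.
Local Notation mu := (@lebesgue_measure R).

Lemma fatou_le d (T : measurableType d) (m : {measure set T -> \bar R})
    (f_ : (T -> \bar R)^nat) (f : T -> \bar R) (C : \bar R) :
  (forall k, measurable_fun setT (f_ k)) -> (forall k w, 0 <= f_ k w)%E ->
  (forall w, f_ k w @[k --> \oo] --> f w) ->
  (forall k, (\int[m]_w f_ k w <= C)%E) -> (\int[m]_w f w <= C)%E.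
Proof.
move=> mf f0 cf fC.
have fE w : limn_einf (fun k => f_ k w) = f w by have [] := cvg_limn_einf_sup (cf w).
rewrite (eq_integral _ _ (fun w _ => esym (fE w))).
apply: le_trans (@fatou _ _ _ m setT measurableT f_ mf (fun k w _ => f0 k w)) _.
apply: (le_trans (limn_einf_sup _)).
rewrite limn_esup_lim; apply: lime_le; first exact: is_cvg_esups.
by apply: nearW => n; apply: ge_ereal_sup => _ [k _ <-]; exact: fC.
Qed.

Context {d : measure_display} {T : measurableType d}.
Variable P : probability T R.

(** For staircases of [f] the identity is linear in the law of [X] on level sets. Their meshes are
    not nested, so each inequality comes from Fatou and the bound by [f] instead of monotone
    convergence. *)
Lemma expectation_density (X : T -> R) (p f : R -> R) :
  measurable_fun setT X -> measurable_fun setT p -> measurable_fun setT f ->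
  (forall x, 0 <= p x) -> (forall x, 0 <= f x) ->
  (forall A, measurable A -> P (X @^-1` A) = (\int[mu]_(x in A) (p x)%:E)%E) ->
  (\int[P]_w (f (X w))%:E = \int[mu]_x (f x * p x)%:E)%E.
Proof.
move=> mX mp mf p0 f0 law.
pose s k x : R := staircase (k.+1 * k.+1) k.+1%:R^-1 x.
have s0 k x : 0 <= s k x by exact: staircase_ge0.
have ms k : measurable_fun setT (s k) by exact: measurable_staircase.
have msf k : measurable_fun setT (fun x => s k (f x)) by exact: measurableT_comp.
have cs x : s k (f x) @[k --> \oo] --> f x by exact: staircase_cvg.
have sle k x : s k (f x) <= f x by exact: staircase_le.
have key k : (\int[P]_w (s k (f (X w)))%:E = \int[mu]_x (s k (f x) * p x)%:E)%E.
  rewrite /s /staircase; set N := (k.+1 * k.+1)%N; set h := k.+1%:R^-1 : R.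
  have h0 : 0 <= h by rewrite invr_ge0.
  pose A (j : 'I_N) : set R := f @^-1` `[j.+1%:R * h, +oo[%classic.
  have mA j : measurable (A j).
    by rewrite /A -[X in measurable X]setTI; apply: mf => //; exact: measurable_itv.
  have iA (j : 'I_N) x : \1_(`[j.+1%:R * h, +oo[%classic) (f x) = \1_(A j) x :> R.
    by [].
  have mi (j : 'I_N) :
      measurable_fun setT (fun x => \1_(`[j.+1%:R * h, +oo[%classic) (f x) : R).
    by apply: measurableT_comp => //; apply: measurable_indic; exact: measurable_itv.
  have miX (j : 'I_N) :
      measurable_fun setT (fun w => \1_(`[j.+1%:R * h, +oo[%classic) (f (X w)) : R).
    exact: (measurableT_comp (mi j) mX).
  under eq_integral do rewrite -sumEFin.
  under [RHS]eq_integral do rewrite mulr_suml -sumEFin.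
  rewrite ge0_integral_sum//; last 2 first.
  - by move=> j; apply/measurable_EFinP; apply: measurable_funM.
  - by move=> j x _; rewrite lee_fin !mulr_ge0.
  rewrite ge0_integral_sum//; last 2 first.
  - move=> j; apply/measurable_EFinP; apply: measurable_funM => //.
    by apply: measurable_funM => //; exact: mi.
  - by move=> j x _; rewrite lee_fin !mulr_ge0.
  apply: eq_bigr => j _.
  under eq_integral do rewrite EFinM.
  under [RHS]eq_integral do rewrite -mulrA EFinM.
  rewrite ge0_integralZl_EFin//; last exact/measurable_EFinP.
  rewrite ge0_integralZl_EFin//; last 2 first.
  - by move=> x _; rewrite lee_fin mulr_ge0.
  - by apply/measurable_EFinP; apply: measurable_funM => //; exact: mi.
  congr (_ * _)%E.
  have mXA : measurable (X @^-1` A j) by rewrite -[X in measurable X]setTI; exact: mX.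
  transitivity (P (X @^-1` A j)).
    transitivity (\int[P]_w (\1_(X @^-1` A j) w)%:E)%E; first exact: eq_integral.
    by rewrite integral_indic// setIT.
  rewrite law// [LHS]integral_mkcond; apply: eq_integral => x _.
  rewrite /patch iA indicE; case: ifPn => _; first by rewrite mul1r.
  by rewrite mul0r.
apply/eqP; rewrite eq_le; apply/andP; split.
- apply: (@fatou_le _ _ P (fun k w => (s k (f (X w)))%:E)).
  + by move=> k; apply/measurable_EFinP; exact: (measurableT_comp (msf k) mX).
  + by move=> k w; rewrite lee_fin.
  + by move=> w; apply: cvg_EFin; [exact: nearW|exact: cs].
  + move=> k; rewrite key; apply: ge0_le_integral_subset => x _.
    * by rewrite lee_fin mulr_ge0.
    * by rewrite lee_fin mulr_ge0.
    * by split => //; rewrite lee_fin ler_wpM2r.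
- apply: (@fatou_le _ _ mu (fun k x => (s k (f x) * p x)%:E)).
  + by move=> k; apply/measurable_EFinP; apply: measurable_funM; [exact: msf|exact: mp].
  + by move=> k w; rewrite lee_fin mulr_ge0.
  + move=> x; apply: cvg_EFin; first exact: nearW.
    by apply: cvgM; [exact: cs|exact: cvg_cst].
  + move=> k; rewrite -key; apply: ge0_le_integral_subset => x _.
    * by rewrite lee_fin.
    * by rewrite lee_fin.
    * by split => //; rewrite lee_fin.
Qed.

End density.

(** * Exponential moments of a Gaussian variable *)

Section gaussian.
Context {d : measure_display} {T : measurableType d} {R : realType}.
Variable P : probability T R.
Local Notation mu := (@lebesgue_measure R).
Variables (X : T -> R) (s : R).
Hypothesis s0 : 0 < s.
Hypothesis mX : measurable_fun setT X.
Hypothesis law : forall A, measurable A -> P (X @^-1` A) = normal_prob 0 s A.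

(** Completing the square: the tilted density is a multiple of the density of mean [c * s^2] and the
    same variance. *)
Lemma gaussian_mgf (c : R) :
  (\int[P]_w (expR (c * X w))%:E = (expR (c ^+ 2 * s ^+ 2 / 2))%:E)%E.
Proof.
rewrite (@expectation_density _ _ _ P X (normal_pdf 0 s) (fun x => expR (c * x)))//.
- transitivity (\int[mu]_x ((expR (c ^+ 2 * s ^+ 2 / 2))%:E *
     (normal_pdf (c * s ^+ 2) s x)%:E))%E.
    apply: eq_integral => x _; rewrite -EFinM !normal_pdfE ?gt_eqF//; congr EFin.
    rewrite mulrCA [RHS]mulrCA; congr (_ * _).
    rewrite /normal_fun -!expRD; congr expR.
    by field; rewrite gt_eqF.
  rewrite ge0_integralZl_EFin//; last 2 first.
  - by move=> x _; rewrite lee_fin normal_pdf_ge0.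
  - by apply/measurable_EFinP; exact: measurable_normal_pdf.
  by rewrite integral_normal_pdf mule1.
- exact: measurable_normal_pdf.
- by apply: measurableT_comp => //; exact: measurable_funM.
- by move=> x; exact: normal_pdf_ge0.
Qed.

(** The tilted density is a multiple of the centred one of variance [s^2 / (1 - c)]. The value is
    free of [s]: this makes the constant of the upper bound independent of [t]. *)
Lemma gaussian_sqr_mgf (c : R) : c < 1 ->
  (\int[P]_w (expR (c * (X w) ^+ 2 / (2 * s ^+ 2)))%:E =
   ((Num.sqrt (1 - c))^-1)%:E)%E.
Proof.
move=> c1; have c0 : 0 < 1 - c by rewrite subr_gt0.
pose r := Num.sqrt (1 - c).
have r0 : 0 < r by rewrite sqrtr_gt0.
have r2 : r ^+ 2 = 1 - c by rewrite sqr_sqrtr// ltW.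
rewrite (@expectation_density _ _ _ P X (normal_pdf 0 s)
  (fun x => expR (c * x ^+ 2 / (2 * s ^+ 2))))//.
- transitivity (\int[mu]_x ((r^-1)%:E * (normal_pdf 0 (s / r) x)%:E))%E.
    apply: eq_integral => x _; rewrite -EFinM !normal_pdfE ?gt_eqF// ?divr_gt0//; congr EFin.
    rewrite mulrCA [RHS]mulrA; congr (_ * _).
      rewrite /normal_peak -invfM; congr (_^-1).
      rewrite exprMn exprVn r2 (_ : _ *+ 2 = (r ^+ 2) * (s ^+ 2 / (1 - c) * pi *+ 2)).
        by rewrite sqrtrM ?sqr_ge0// sqrtr_sqr gtr0_norm.
      by rewrite r2 [RHS]mulrnAr; congr (_ *+ 2); field; rewrite gt_eqF.
    rewrite /normal_fun -!expRD; congr expR.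
    by rewrite exprMn exprVn r2; field; rewrite !gt_eqF.
  rewrite ge0_integralZl_EFin ?invr_ge0 ?(ltW r0)//; last 2 first.
  - by move=> x _; rewrite lee_fin normal_pdf_ge0.
  - by apply/measurable_EFinP; exact: measurable_normal_pdf.
  by rewrite integral_normal_pdf mule1.
- exact: measurable_normal_pdf.
- apply: measurableT_comp => //; apply: measurable_funM => //.
  by apply: measurable_funM => //; exact: measurable_funX.
- by move=> x; exact: normal_pdf_ge0.
Qed.

End gaussian.

(** * Discretization of the partition function *)

Section riemann.
Context {R : realType}.
Local Notation mu := (@lebesgue_measure R).

Lemma grid_cell (N : nat) (h s : R) : 0 < s -> s <= N%:R * h ->
  exists2 k : 'I_N, k%:R * h < s & s <= k.+1%:R * h.
Proof.
move=> s0; elim: N => [|N ih] sN.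
  by move: (lt_le_trans s0 sN); rewrite mul0r ltxx.
have [/ih[k k1 k2]|Ns] := leP s (N%:R * h).
  by exists (widen_ord (leqnSn N) k).
by exists ord_max.
Qed.

Definition step_fun (N : nat) (h : R) (a : nat -> R) (s : R) : R :=
  \sum_(k < N) a k * \1_(`]k%:R * h, k.+1%:R * h]%classic) s.

Lemma measurable_step_fun N h a : measurable_fun setT (step_fun N h a).
Proof.
apply: measurable_sum => k; apply: measurable_funM => //.
Qed.

Lemma step_funE N h a (k : 'I_N) s : 0 < h -> k%:R * h < s -> s <= k.+1%:R * h ->
  step_fun N h a s = a k.
Proof.
move=> h0 k1 k2; rewrite /step_fun (bigD1 k)//= big1 ?addr0.
  by rewrite indicE mem_set ?mulr1//= in_itv/= k1.
move=> j jk; rewrite indicE memNset ?mulr0//= in_itv/= => /andP[j1 j2].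
have : (k < j.+1)%N.
  by rewrite -(ltr_nat R) -(ltr_pM2r h0); exact: lt_le_trans j2.
have : (j < k.+1)%N.
  by rewrite -(ltr_nat R) -(ltr_pM2r h0); exact: lt_le_trans k2.
rewrite !ltnS => jk' kj; move: jk; rewrite -val_eqE/=.
by rewrite eqn_leq jk' kj.
Qed.

Lemma integral_step_fun N h a : 0 < h -> (forall k, 0 <= a k) ->
  (\int[mu]_(s in `]0%R, (N%:R * h)%R]) (step_fun N h a s)%:E =
   (h * \sum_(k < N) a k)%:E)%E.
Proof.
move=> h0 a0; have mI : measurable (`]0, N%:R * h]%classic : set (measurableTypeR R)).
  exact: (@measurable_itv R).
have m1 k : measurable_fun `]0, N%:R * h]%classic
    (\1_(`]k%:R * h, k.+1%:R * h]%classic) : measurableTypeR R -> R).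
  exact: (@measurable_indic _ _ R _ _ (@measurable_itv R _)).
under eq_integral do rewrite -sumEFin.
rewrite ge0_integral_sum//; last 2 first.
- by move=> k; apply/measurable_EFinP; apply: measurable_funM.
- by move=> k s _; rewrite lee_fin mulr_ge0.
rewrite mulr_sumr -sumEFin; apply: eq_bigr => k _.
under eq_integral do rewrite EFinM.
rewrite ge0_integralZl_EFin//; last exact/measurable_EFinP.
rewrite integral_indic//.
rewrite setIidl; last first.
  move=> s; rewrite /= in_itv/= => /andP[s1 s2]; rewrite in_itv/=; apply/andP; split.
    by apply: le_lt_trans s1; rewrite mulr_ge0// ltW.
  by rewrite (le_trans s2)// ler_wpM2r ?ler_nat// ltW.
rewrite [X in (_ * X)%E]lebesgue_measure_itv/= lte_fin.
rewrite ltr_pM2r// ltr_nat ltnSn -EFinB -EFinM mulrC; congr (_ * _)%:E.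
by rewrite -mulrBl -natrB// subSnn mul1r.
Qed.

(** Right end points: time 0 is never sampled, and continuity on []0, +oo[] suffices for
    convergence. *)
Definition riemann_sum (f : R -> R) (t : R) (m : nat) : R :=
  t / m%:R * \sum_(k < m) f (k.+1%:R * (t / m%:R)).

(** The sum is the integral of a step function that converges pointwise on []0, t]] and is bounded
    by 1: dominated convergence. *)
Lemma riemann_sum_cvg (f : R -> R) (t : R) : 0 < t ->
  (forall s, 0 <= f s <= 1) -> {in `]0, +oo[, continuous f} ->
  riemann_sum f t m.+1 @[m --> \oo] --> (\int[mu]_(s in `[0, t]) f s)%R.
Proof.
move=> t0 f01 cf.
have mt : measurable (`]0, t]%classic : set (measurableTypeR R)) by exact: (@measurable_itv R).
pose h m : R := t / m.+1%:R.
have h0 m : 0 < h m by rewrite divr_gt0.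
have hm m : m.+1%:R * h m = t by rewrite mulrC divfK.
pose g m := step_fun m.+1 (h m) (fun k => f (k.+1%:R * h m)).
have mg m : measurable_fun setT (g m) by exact: measurable_step_fun.
have gE m s (k : 'I_m.+1) : k%:R * h m < s -> s <= k.+1%:R * h m ->
    g m s = f (k.+1%:R * h m) by exact: step_funE.
have int_g m : (\int[mu]_(s in `]0%R, t]) (g m s)%:E)%E = (riemann_sum f t m.+1)%:E.
  rewrite -[X in `]0%R, X]](hm m) integral_step_fun// => k.
  by case/andP: (f01 (k.+1%:R * h m)).
have cg s : `]0, t]%classic s -> (g m s)%:E @[m --> \oo] --> (f s)%:E.
  rewrite /= in_itv/= => /andP[s0 st].
  apply: cvg_EFin; first exact: nearW.
  apply/cvgrPdist_le => e e0.
  have sI : s \in (`]0, +oo[ : interval R) by rewrite in_itv/= s0.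
  have /cvgrPdist_le/(_ _ e0) := cf s sI.
  move=> /nbhs_ballP[delta /= d0 H].
  near=> m.
  have [|k k1 k2] := @grid_cell m.+1 (h m) s s0; first by rewrite hm.
  rewrite /= (gE _ _ k)//; apply: H; rewrite /ball/=.
  rewrite ler0_norm ?subr_le0// opprB ltrBlDl.
  apply: (@le_lt_trans _ _ (s + h m)).
    have -> : k.+1%:R = k%:R + 1 :> R by rewrite natr1.
    by rewrite mulrDl mul1r lerD2r ltW.
  rewrite ltrD2l ltr_pdivrMr// mulrC -ltr_pdivrMr//.
  rewrite (@lt_trans _ _ m%:R) ?ltr_nat//.
  by near: m; exact: nbhs_infty_gtr.
have -> : (\int[mu]_(s in `[0, t]) f s)%R = fine (\int[mu]_(s in `]0%R, t]) (f s)%:E)%E.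
  rewrite /Rintegral; congr fine.
  rewrite -integral_itv_obnd_cbnd//.
  apply: (@emeasurable_fun_cvg _ _ _ _ (fun m s => (g m s)%:E)) => //.
  by move=> m; apply/measurable_EFinP; exact: measurable_funS (mg m).
have fint : (\int[mu]_(s in `]0%R, t]) (f s)%:E)%E \is a fin_num.
  rewrite ge0_fin_numE; last by apply: integral_ge0 => s _; rewrite lee_fin; have /andP[] := f01 s.
  apply: (@le_lt_trans _ _ (\int[mu]_(s in `]0%R, t]) (cst 1%:E s))%E).
    apply: ge0_le_integral_subset => s st //.
    - by rewrite lee_fin; have /andP[] := f01 s.
    - by split => //; rewrite lee_fin; have /andP[] := f01 s.
  rewrite integral_cst// [X in (_ * X)%E]lebesgue_measure_itv/= lte_fin t0.
  by rewrite -EFinB -EFinM ltry.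
have -> : (fun m => riemann_sum f t m.+1) =
    fine \o (fun m => \int[mu]_(s in `]0%R, t]) (g m s)%:E)%E.
  by apply/funext => m; rewrite /= int_g.
apply: fine_cvg; rewrite fineK//.
apply: (@dominated_cvg _ _ _ mu `]0, t]%classic mt
  (fun m s => (g m s)%:E) (fun s => (f s)%:E) (cst 1%:E)) => //.
- by move=> m; apply/measurable_EFinP; exact: measurable_funS (mg m).
- exact: integrable_cst_itv.
- move=> m s; rewrite /= in_itv/= => /andP[s0 st].
  have [|k k1 k2] := @grid_cell m.+1 (h m) s s0; first by rewrite hm.
  rewrite (gE _ _ k)// lee_fin; have /andP[f0 f1] := f01 (k.+1%:R * h m).
  by rewrite ger0_norm.
Unshelve. all: by end_near. Qed.

End riemann.

Section potential.
Context {R : realType}.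

Definition potential (alpha b : R) : R := (1 + `|b| `^ alpha)^-1.

Lemma potential_bounds alpha b : 0 <= potential alpha b <= 1.
Proof.
have h : 1 <= 1 + `|b| `^ alpha by rewrite lerDl powR_ge0.
by rewrite invr_ge0 invf_le1 ?(le_trans ler01)//= (lt_le_trans ltr01).
Qed.

Lemma continuous_norm_powR (alpha : R) : 0 < alpha ->
  continuous (fun b : R => `|b| `^ alpha).
Proof.
move=> a0 b; have [->|b0] := eqVneq b 0.
  rewrite /continuous_at normr0 powR0 ?gt_eqF//.
  apply/cvgr0Pnorm_le => e e0.
  have := powR_cvg0 a0 => /cvgr0Pnorm_le/(_ _ e0).
  rewrite near_withinE => /nbhs_ballP[delta /= d0 H].
  apply/nbhs_ballP; exists delta => //= z; rewrite /ball/= sub0r normrN => zd.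
  have [->|z0] := eqVneq z 0.
    by rewrite normr0 powR0 ?gt_eqF// normr0 ltW.
  apply: H; last by rewrite normr_gt0.
  by rewrite /ball/= sub0r normrN normr_id.
have h : {for `|b|, continuous ((@powR R) ^~ alpha)}.
  apply/differentiable_continuous/derivable1_diffP/derivable_powR.
  by rewrite in_itv/= normr_gt0 b0.
exact: (continuous_comp (@norm_continuous _ _ b) h).
Qed.

Lemma continuous_potential (alpha : R) : 0 < alpha -> continuous (potential alpha).
Proof.
move=> a0 b; apply: cvgV; first by rewrite gt_eqF// ltr_wpDr ?powR_ge0.
by apply: cvgD; [exact: cvg_cst|exact: continuous_norm_powR].
Qed.

Lemma measurable_potential (alpha : R) : 0 < alpha ->
  measurable_fun setT (potential alpha).
Proof. by move=> a0; apply: continuous_measurable_fun; exact: continuous_potential. Qed.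

End potential.

Section partition_function.
Context {d : measure_display} {T : measurableType d} {R : realType}.
Variables (P : probability T R) (x : R) (B : R -> {RV P >-> R}).
Hypothesis BM : brownian_motion P x B.
Variables (alpha lambda t : R).
Hypotheses (alpha_gt0 : 0 < alpha) (lambda_gt0 : 0 < lambda) (t_gt0 : 0 < t).

Definition grid_weight (m : nat) (w : T) : R :=
  expR (- (lambda / 2) * riemann_sum (fun s => potential alpha (B s w)) t m).

Lemma measurable_path_potential s :
  measurable_fun setT (fun w => potential alpha (B s w)).
Proof. by apply: measurableT_comp => //; exact: measurable_potential. Qed.

Lemma measurable_grid_weight m : measurable_fun setT (grid_weight m).
Proof.
apply: measurableT_comp => //; apply: measurable_funM => //.
rewrite /riemann_sum; apply: measurable_funM => //.
by apply: measurable_sum => k; exact: measurable_path_potential.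
Qed.

Lemma grid_weight_bounds m w : 0 <= grid_weight m w <= 1.
Proof.
rewrite expR_ge0 -expR0 ler_expR mulNr oppr_le0 mulr_ge0 ?divr_ge0 ?(ltW lambda_gt0)//.
rewrite /riemann_sum mulr_ge0 ?divr_ge0 ?(ltW t_gt0)//.
by apply: sumr_ge0 => k _; case/andP: (potential_bounds alpha (B (k.+1%:R * (t / m%:R)) w)).
Qed.

(** All paths are continuous, so the weights converge everywhere, and they are bounded by 1. *)
Lemma grid_weight_cvg :
  fine (\int[P]_w (grid_weight m.+1 w)%:E) @[m --> \oo] --> Z P alpha lambda B t.
Proof.
rewrite /Z.
pose f w := expR (- (lambda / 2) *
    \int[lebesgue_measure]_(s in `[0%R, t]) (1 + `|B s w| `^ alpha)^-1).
rewrite (_ : ('E_P[_])%E = \int[P]_w (f w)%:E)%E; last by rewrite unlock.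
have intf : (\int[P]_w (f w)%:E \is a fin_num)%E.
  rewrite ge0_fin_numE; last by apply: integral_ge0 => w _; rewrite lee_fin expR_ge0.
  apply: (@le_lt_trans _ _ (\int[P]_w cst 1%:E w)%E); last first.
    by rewrite integral_cst//= mul1e (le_lt_trans (probability_le1 P measurableT)) ?ltry.
  apply: ge0_le_integral_subset => w _ //; first by rewrite lee_fin expR_ge0.
  split => //; rewrite lee_fin -expR0 ler_expR mulNr oppr_le0 mulr_ge0 ?divr_ge0 ?(ltW lambda_gt0)//.
  apply: Rintegral_ge0 => s _.
  by case/andP: (potential_bounds alpha (B s w)).
apply: fine_cvg; rewrite fineK//.
apply: (@dominated_cvg _ _ _ P setT measurableT
  (fun m w => (grid_weight m.+1 w)%:E) (fun w => (f w)%:E) (cst 1%:E)) => //.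
- by move=> m; apply/measurable_EFinP; exact: measurable_grid_weight.
- move=> w _; apply: cvg_EFin; first exact: nearW.
  apply: (@continuous_cvg _ _ _ _ _ _ expR); first exact: continuous_expR.
  apply: cvgM; first exact: cvg_cst.
  apply: riemann_sum_cvg => //; first by move=> s; exact: potential_bounds.
  have /continuous_within_itvcyP[cB _] := @bm_continuous_paths _ _ _ _ _ _ BM w.
  move=> s sI; apply: (@continuous_comp _ _ _ (fun s => B s w) (potential alpha)).
    exact: cB.
  exact: continuous_potential.
- exact: finite_measure_integrable_cst.
- move=> m w _; have /andP[h0 h1] := grid_weight_bounds m.+1 w.
  by rewrite lee_fin ger0_norm.
Qed.

End partition_function.

(** * Exponential moments of Brownian increments *)

Section increments.
Context {d : measure_display} {T : measurableType d} {R : realType}.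
Variables (P : probability T R) (x : R) (B : R -> {RV P >-> R}).
Hypothesis BM : brownian_motion P x B.
Variable tau : nat -> R.
Hypotheses (tau_ge0 : 0 <= tau 0%N) (tau_lt : forall i, tau i < tau i.+1).

Definition incr (i : nat) (w : T) : R := B (tau i.+1) w - B (tau i) w.

Let dtau i := tau i.+1 - tau i.

Let dtau_gt0 i : 0 < dtau i. Proof. by rewrite subr_gt0. Qed.

Let tau_homo : {homo tau : i j / (i <= j)%N >-> i <= j}.
Proof. by apply: homo_leq => [//|y z u|i]; [exact: le_trans|exact: ltW]. Qed.

Lemma measurable_incr i : measurable_fun setT (incr i).
Proof. exact: measurable_funB. Qed.

Lemma incr_law i A : measurable A ->
  P (incr i @^-1` A) = normal_prob 0 (Num.sqrt (dtau i)) A.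
Proof.
move=> mA; rewrite -(bm_normal_increments BM _ (tau_lt i))//.
by rewrite (le_trans tau_ge0)// tau_homo.
Qed.

Lemma incr_expectation_prod (n : nat) (f : nat -> R -> R) :
  (forall i, measurable_fun setT (f i)) -> (forall i y, 0 <= f i y) ->
  (forall i, (\int[P]_w (f i (incr i w))%:E < +oo)%E) ->
  (\int[P]_w (\prod_(i < n) f i (incr i w))%:E =
   (\prod_(i < n) fine (\int[P]_w (f i (incr i w))%:E))%:E)%E.
Proof.
move=> mf f0 fin.
apply: (@expectation_prod _ _ _ P n (fun i w => f i (incr i w))) => //.
- by move=> i; apply: measurableT_comp => //; exact: measurable_incr.
- move=> A mA.
  have mfA (i : 'I_n) : measurable (f i @^-1` A i).
    by rewrite -[X in measurable X]setTI; apply: mf.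
  exact: (@bm_independent_increments _ _ _ _ _ _ BM tau n tau_ge0 tau_homo _ mfA).
Qed.

Lemma incr_expectation_exp (n : nat) (c : nat -> R) (r : R) :
  (\int[P]_w (expR (\sum_(i < n) c i * incr i w + r))%:E =
   (expR (\sum_(i < n) c i ^+ 2 * dtau i / 2 + r))%:E)%E.
Proof.
have mgf i : (\int[P]_w (expR (c i * incr i w))%:E =
    (expR (c i ^+ 2 * dtau i / 2))%:E)%E.
  have s0 : 0 < Num.sqrt (dtau i) by rewrite sqrtr_gt0.
  rewrite (gaussian_mgf s0 (measurable_incr i) (@incr_law i)).
  by rewrite sqr_sqrtr// ltW.
transitivity (\int[P]_w ((expR r)%:E * (\prod_(i < n) expR (c i * incr i w))%:E))%E.
  by apply: eq_integral => w _; rewrite -EFinM -expR_sum -expRD addrC.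
rewrite ge0_integralZl_EFin//; last 2 first.
- by move=> w _; rewrite lee_fin; apply: prodr_ge0 => i _; exact: expR_ge0.
- apply/measurable_EFinP; apply: measurable_prod => i _.
  by apply: measurableT_comp => //; apply: measurable_funM => //; exact: measurable_incr.
rewrite (@incr_expectation_prod n (fun i y => expR (c i * y))).
- under eq_bigr do rewrite mgf/=.
  by rewrite -EFinM -expR_sum -expRD addrC.
- by move=> i; apply: measurableT_comp => //; exact: measurable_funM.
- by move=> i y; exact: expR_ge0.
- by move=> i; rewrite mgf ltry.
Qed.

Lemma measurable_exp_incr (n : nat) (c : nat -> R) (r : R) :
  measurable_fun setT (fun w => (expR (\sum_(i < n) c i * incr i w + r))%:E).
Proof.
apply/measurable_EFinP; apply: measurableT_comp => //; apply: measurable_funD => //.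
by apply: measurable_sum => i; apply: measurable_funM => //; exact: measurable_incr.
Qed.

Lemma sum_incr n w : \sum_(i < n) incr i w = B (tau n) w - B (tau 0%N) w.
Proof.
by rewrite -(big_mkord xpredT (incr^~ w)) telescope_sumr.
Qed.

End increments.

(** * Cameron-Martin lower bound on a grid *)

Section nonneg_mean.
Context {d : measure_display} {T : measurableType d} {R : realType}.
Variable P : probability T R.
Implicit Types (f g : T -> R) (r s : R).

(** Measurability, sign and finite mean are carried together, so that means can be added, scaled and
    compared as real numbers. *)
Definition nonneg_mean f r := [/\ measurable_fun setT f, forall w, 0 <= f w &
  (\int[P]_w (f w)%:E = r%:E)%E].

Lemma nonneg_mean_fine f : measurable_fun setT f -> (forall w, 0 <= f w <= 1) ->
  nonneg_mean f (fine (\int[P]_w (f w)%:E)).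
Proof.
move=> mf f01; split => //; first by move=> w; case/andP: (f01 w).
rewrite fineK// ge0_fin_numE; last first.
  by apply: integral_ge0 => w _; rewrite lee_fin; case/andP: (f01 w).
apply: (@le_lt_trans _ _ (\int[P]_w cst 1%:E w)%E); last first.
  by rewrite integral_cst//= mul1e (le_lt_trans (probability_le1 P measurableT)) ?ltry.
by apply: ge0_le_integral_subset => w _ //; have /andP[] := f01 w; rewrite lee_fin.
Qed.

Lemma nonneg_meanD f g r s : nonneg_mean f r -> nonneg_mean g s ->
  nonneg_mean (fun w => f w + g w) (r + s).
Proof.
move=> [mf f0 fr] [mg g0 gs]; split.
- exact: measurable_funD.
- by move=> w; rewrite addr_ge0.
- under eq_integral do rewrite EFinD.
  rewrite ge0_integralD//; last 4 first.
  + by move=> w _; rewrite lee_fin.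
  + exact/measurable_EFinP.
  + by move=> w _; rewrite lee_fin.
  + exact/measurable_EFinP.
  by rewrite fr gs.
Qed.

Lemma nonneg_meanZ c f r : 0 <= c -> nonneg_mean f r ->
  nonneg_mean (fun w => c * f w) (c * r).
Proof.
move=> c0 [mf f0 fr]; split.
- exact: measurable_funM.
- by move=> w; rewrite mulr_ge0.
- under eq_integral do rewrite EFinM.
  rewrite ge0_integralZl_EFin//; last 2 first.
  + by move=> w _; rewrite lee_fin.
  + exact/measurable_EFinP.
  by rewrite fr.
Qed.

Lemma nonneg_mean_sum (n : nat) (f : nat -> T -> R) (r : nat -> R) :
  (forall i, (i < n)%N -> nonneg_mean (f i) (r i)) ->
  nonneg_mean (fun w => \sum_(i < n) f i w) (\sum_(i < n) r i).
Proof.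
elim: n => [_|n ih H].
  split.
  - by under eq_fun do rewrite big_ord0; exact: measurable_cst.
  - by move=> w; rewrite big_ord0.
  - by under eq_integral do rewrite big_ord0; rewrite integral0 big_ord0.
rewrite big_ord_recr/=; under eq_fun do rewrite big_ord_recr/=.
by apply: nonneg_meanD; [apply: ih => i ni; apply: H; exact: ltnW|exact: H].
Qed.

(** The comparison is restricted to a sure event [D] because the motion starts at [x] only almost
    surely. *)
Lemma nonneg_mean_le (D : set T) f g r s : measurable D -> P D = 1%E ->
  nonneg_mean f r -> nonneg_mean g s -> (forall w, D w -> f w <= g w) -> r <= s.
Proof.
move=> mD PD [mf f0 fr] [mg g0 gs] fg.
rewrite -lee_fin -fr -gs.
rewrite (@ge0_negligible_integral _ _ _ _ _ (~` D))//.
- apply: ge0_le_integral_subset => w.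
  + by move=> _; rewrite lee_fin.
  + by move=> _; rewrite lee_fin.
  + by move=> [_ /contrapT Dw]; split => //; rewrite lee_fin fg.
- exact: measurableC.
- exact/measurable_EFinP.
- by move=> w _; rewrite lee_fin.
- have PDC : P (~` D) = (1 - P D)%E := probability_setC P mD.
  by rewrite [LHS]PDC PD subee.
Qed.

End nonneg_mean.

Lemma sum_ord_lt {R : nzRingType} (F : nat -> R) (n m : nat) : (n <= m)%N ->
  \sum_(i < m) (i < n)%:R * F i = \sum_(i < n) F i.
Proof.
move=> nm; rewrite (big_ord_widen _ F nm) [RHS]big_mkcond/=.
by apply: eq_bigr => i _; case: ltnP; rewrite ?mul1r ?mul0r.
Qed.

Section lower_bound_grid.
Context {d : measure_display} {T : measurableType d} {R : realType}.
Variables (P : probability T R) (x : R) (B : R -> {RV P >-> R}).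
Hypothesis BM : brownian_motion P x B.
Variables (alpha lambda t : R) (m : nat).
Hypotheses (alpha_gt0 : 0 < alpha) (lambda_gt0 : 0 < lambda) (t_gt0 : 0 < t).
Hypothesis m_gt0 : (0 < m)%N.

Let h := t / m%:R.

Let h_gt0 : 0 < h. Proof. by rewrite divr_gt0// ltr0n. Qed.

Let tau (k : nat) : R := k%:R * h.

Let tau0 : 0 <= tau 0. Proof. by rewrite /tau mul0r. Qed.

Let tau_lt i : tau i < tau i.+1.
Proof. by rewrite /tau ltr_pM2r// ltr_nat. Qed.

Let dtau i : tau i.+1 - tau i = h.
Proof. by rewrite /tau -mulrBl -natrB// subSnn mul1r. Qed.

Local Notation X := (incr B tau).

Lemma exp_linear_mean (c : nat -> R) (r : R) :
  nonneg_mean P (fun w => expR (\sum_(i < m) c i * X i w + r))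
    (expR (\sum_(i < m) c i ^+ 2 * h / 2 + r)).
Proof.
split.
- by apply/measurable_EFinP; exact: measurable_exp_incr.
- by move=> w; exact: expR_ge0.
- rewrite (incr_expectation_exp BM tau0 tau_lt).
  by under eq_bigr do rewrite dtau.
Qed.

Variables (g v A : nat -> R).
Hypotheses (g0 : g 0%N = 0) (v_ge0 : forall k, 0 <= v k).
(** [v k] bounds the potential while the noise [y] is below [A k]; beyond, an exponential takes
    over. The slope [A k / tau k.+1] is the optimal Chernoff parameter for variance [tau k.+1]. *)
Hypothesis potential_le : forall k y, (k < m)%N ->
  potential alpha (x + g k.+1 + y) <=
  v k + expR (A k / tau k.+1 * (y - A k)) + expR (A k / tau k.+1 * (- y - A k)).

Let e := \sum_(i < m) (g i.+1 - g i) ^+ 2 / (2 * h).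

Let a i := (g i.+1 - g i) / h.

Let sum_a2 : \sum_(i < m) a i ^+ 2 * h / 2 = e.
Proof. by apply: eq_bigr => i _; rewrite /a; field; rewrite gt_eqF. Qed.

(** The logarithm of the Cameron-Martin density for the shift [g]; [e] is its relative entropy. *)
Let L w := \sum_(i < m) a i * X i w + - e.

Let mean_L : nonneg_mean P (fun w => expR (L w)) 1.
Proof.
have := exp_linear_mean a (- e).
by rewrite sum_a2 subrr expR0.
Qed.

Let mean_qL q : nonneg_mean P (fun w => expR (q * L w)) (expR ((q ^+ 2 - q) * e)).
Proof.
have := exp_linear_mean (fun i => q * a i) (- (q * e)).
have -> : \sum_(i < m) (q * a i) ^+ 2 * h / 2 + - (q * e) = (q ^+ 2 - q) * e.
  rewrite mulrBl; congr (_ - _); rewrite -sum_a2 mulr_sumr.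
  by apply: eq_bigr => i _; ring.
congr nonneg_mean; apply/funext => w; congr expR.
rewrite /L mulrDr mulrN; congr (_ - _); rewrite mulr_sumr.
by apply: eq_bigr => i _; rewrite mulrA.
Qed.

Let N k w := B (tau k.+1) w - B (tau 0%N) w - g k.+1.

(** Under the tilted law the noise [N k] is centred Gaussian of variance [tau k.+1]: the shift [g]
    disappears from the mean. *)
Let mean_LN k theta q : (k < m)%N ->
  nonneg_mean P (fun w => expR (L w + theta * N k w - q))
    (expR (theta ^+ 2 * tau k.+1 / 2 - q)).
Proof.
move=> km.
have := exp_linear_mean (fun i => a i + theta * (i < k.+1)%:R) (- e - theta * g k.+1 - q).
have -> : \sum_(i < m) (a i + theta * (i < k.+1)%:R) ^+ 2 * h / 2 +
    (- e - theta * g k.+1 - q) = theta ^+ 2 * tau k.+1 / 2 - q.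
  rewrite (eq_bigr (fun i : 'I_m => a i ^+ 2 * h / 2 +
     (i < k.+1)%:R * (theta * (a i * h) + theta ^+ 2 * h / 2))); last first.
    by move=> i _; case: (_ < _)%N => /=; field.
  rewrite big_split/= sum_a2.
  rewrite (sum_ord_lt (fun i => theta * (a i * h) + theta ^+ 2 * h / 2) km).
  rewrite big_split/= sumr_const card_ord -mulr_sumr.
  rewrite (eq_bigr (fun i : 'I_k.+1 => g i.+1 - g i)); last first.
    by move=> i _; rewrite /a divfK// gt_eqF.
  rewrite -(big_mkord xpredT (fun i => g i.+1 - g i)) telescope_sumr// g0 subr0.
  by rewrite -mulr_natl /tau; field.
congr nonneg_mean; apply/funext => w; congr expR; rewrite /L /N.
rewrite (eq_bigr (fun i : 'I_m => a i * X i w + (i < k.+1)%:R * (theta * X i w))); last first.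
  by move=> i _; ring.
rewrite big_split/= (sum_ord_lt (fun i => theta * X i w) km) -mulr_sumr.
by rewrite sum_incr; ring.
Qed.

Let U := lambda / 2 * h * \sum_(k < m) (v k + 2 * expR (- (A k ^+ 2 / (2 * tau k.+1)))).

(* Under the tilted law of density [expR (L w)], whose mean is 1, the path is [x + g]
   plus a Brownian motion. With [c := e + 1 + U] and [W] the potential energy,
   [expR (- W) >= expR (L - c) * (1 + c - W - L)]; the tilted mean of [L] is [e], and
   it is reached from nonnegative integrals only through
   [L <= (expR (eta * L) - 1) / eta] with [eta] small. *)
Lemma grid_lower_bound :
  expR (- (e + 1 + U)) <= fine (\int[P]_w (grid_weight B alpha lambda t m w)%:E).
Proof.
set Zg := fine _.
have mean_Z : nonneg_mean P (grid_weight B alpha lambda t m) Zg.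
  apply: nonneg_mean_fine; first exact: measurable_grid_weight.
  exact: grid_weight_bounds.
have e0 : 0 <= e by apply: sumr_ge0 => i _; rewrite divr_ge0 ?sqr_ge0// mulr_ge0// ltW.
(* With this value, the factor of [expR (- c)] left at the end is at least
   [1 + c - U - (e + 1) = 1]. *)
pose c := e + 1 + U.
(* Small enough that [(expR ((eta + eta^2) * e) - 1) / eta <= e + 1]: the tilted mean [e] of [L] is
   exceeded by at most 1, which is the 1 in [c]. *)
pose eta := (1 + e + 2 * (e + 1) * e)^-1.
have eta_den : 0 < 1 + e + 2 * (e + 1) * e.
  by rewrite -addrA ltr_pwDl// addr_ge0// !mulr_ge0// addr_ge0.
have eta0 : 0 < eta by rewrite invr_gt0.
have eta1 : eta * (1 + e + 2 * (e + 1) * e) = 1 by rewrite mulVf// gt_eqF.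
have eta_le1 : eta <= 1.
  by rewrite invf_le1// -addrA lerDl addr_ge0// !mulr_ge0// addr_ge0.
have etae : eta^-1 * expR (((1 + eta) ^+ 2 - (1 + eta)) * e) <= eta^-1 + (e + 1).
  have -> : ((1 + eta) ^+ 2 - (1 + eta)) * e = (eta + eta ^+ 2) * e by ring.
  set y := _ * e.
  have y0 : 0 <= y by rewrite mulr_ge0// addr_ge0 ?sqr_ge0// ltW.
  have yle : y <= 2 * eta * e.
    by rewrite ler_wpM2r// mulr_natl mulr2n lerD2l expr2 ler_piMl// ltW.
  (* Combined with [expR y * (1 - y) <= 1], this yields [expR y <= 1 + eta * (e + 1)]. *)
  have key : 1 <= (1 + eta * (e + 1)) * (1 - y).
    have h1 : eta * (e + 1) * y <= eta * (e + 1) * (2 * eta * e).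
      by rewrite ler_wpM2l// mulr_ge0 ?addr_ge0// ltW.
    have h2 : y = eta * e + eta ^+ 2 * e by rewrite /y mulrDl.
    have h3 : eta ^+ 2 * (1 + e + 2 * (e + 1) * e) = eta by rewrite expr2 -mulrA eta1 mulr1.
    have h4 : 0 <= eta ^+ 2 by rewrite sqr_ge0.
    nra.
  have y1 : 0 < 1 - y.
    rewrite ltNge; apply/negP => y1.
    have : (1 + eta * (e + 1)) * (1 - y) <= 0.
      by rewrite mulr_ge0_le0// addr_ge0// mulr_ge0 ?addr_ge0// ltW.
    by move=> /(le_trans key); rewrite ler10.
  have ey : expR y * (1 - y) <= 1.
    rewrite -[leRHS](expR0) -(subrr y) expRD ler_wpM2l ?expR_ge0//.
    by rewrite expR_ge1Dx.
  have ey2 : expR y <= 1 + eta * (e + 1).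
    by rewrite -(ler_pM2r y1) (le_trans ey).
  rewrite -(ler_pM2l eta0) mulrA divff ?gt_eqF// mul1r mulrDr divff ?gt_eqF//.
pose D := [set w | B 0 w = x].
have mD : measurable D.
  rewrite (_ : D = B 0 @^-1` [set x]); last by apply/seteqP; split.
  by rewrite -[X in measurable X]setTI; exact: measurable_funP.
have PD : P D = 1%E := bm_start BM.
pose kap := lambda / 2 * h.
have kap0 : 0 <= kap by rewrite mulr_ge0 ?divr_ge0// ltW.
pose th k := A k / tau k.+1.
pose q k := A k ^+ 2 / tau k.+1.
pose f2 w := \sum_(k < m) kap * (v k * expR (L w) +
   (expR (L w + th k * N k w - q k) + expR (L w + (- th k) * N k w - q k))).
have tau_gt0 k : 0 < tau k.+1 by rewrite /tau mulr_gt0.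
have mean_f2 : nonneg_mean P f2 U.
  rewrite /U mulr_sumr; apply: (@nonneg_mean_sum _ _ _ P m (fun k w => kap * (v k * expR (L w) +
   (expR (L w + th k * N k w - q k) + expR (L w + (- th k) * N k w - q k))))
   (fun k => kap * (v k + 2 * expR (- (A k ^+ 2 / (2 * tau k.+1)))))) => k km.
  apply: nonneg_meanZ => //; rewrite -[X in nonneg_mean _ _ (X + _)]mulr1.
  apply: nonneg_meanD; first exact: nonneg_meanZ.
  have -> : 2 * expR (- (A k ^+ 2 / (2 * tau k.+1))) =
     expR ((th k) ^+ 2 * tau k.+1 / 2 - q k) + expR ((- th k) ^+ 2 * tau k.+1 / 2 - q k).
    rewrite sqrrN mulr_natl mulr2n; congr (expR _ + expR _);
      by rewrite /th /q; field; rewrite gt_eqF.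
  by apply: nonneg_meanD; exact: mean_LN.
have := nonneg_meanZ (_ : 0 <= expR (- c) * (1 + c + eta^-1)) mean_L.
have U0 : 0 <= U.
  rewrite mulr_ge0//; apply: sumr_ge0 => k _.
  by rewrite addr_ge0// mulr_ge0// expR_ge0.
have c0 : 0 <= c by rewrite !addr_ge0.
have K0 : 0 <= expR (- c) * (1 + c + eta^-1).
  by rewrite mulr_ge0 ?expR_ge0// !addr_ge0// invr_ge0 ltW.
move=> /(_ K0) mean1.
have mean2 := nonneg_meanD mean_Z (nonneg_meanZ (expR_ge0 (- c))
  (nonneg_meanD mean_f2 (nonneg_meanZ (_ : 0 <= eta^-1) (mean_qL (1 + eta))))).
have ieta0 : 0 <= eta^-1 by rewrite invr_ge0 ltW.
have := nonneg_mean_le mD PD mean1 (mean2 ieta0).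
rewrite mulr1 => H.
(* The pointwise bound, with the negative terms moved across so that both sides are nonnegative. *)
suff /H : forall w, D w -> expR (- c) * (1 + c + eta^-1) * expR (L w) <=
    grid_weight B alpha lambda t m w + expR (- c) *
      (f2 w + eta^-1 * expR ((1 + eta) * L w)).
  move=> H2; rewrite -lerBlDr -mulrBr in H2.
  apply: le_trans H2; rewrite -[leLHS]mulr1 ler_wpM2l ?expR_ge0//.
  rewrite /c; lra.
move=> w Dw.
pose W := lambda / 2 * riemann_sum (fun s => potential alpha (B s w)) t m.
have WE : grid_weight B alpha lambda t m w = expR (- W) by rewrite /grid_weight mulNr.
have h1 : expR (- c) * expR (L w) * (1 + (c - W - L w)) <= expR (- W).
  have -> : expR (- W) = expR (- c) * expR (L w) * expR (c - W - L w).
    by rewrite -!expRD; congr expR; ring.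
  by rewrite ler_wpM2l ?mulr_ge0 ?expR_ge0// expR_ge1Dx.
have h2 : L w <= eta^-1 * (expR (eta * L w) - 1).
  rewrite -(ler_pM2l eta0) mulrA divff ?gt_eqF// mul1r.
  by have := expR_ge1Dx (eta * L w); lra.
have h3 : W * expR (L w) <= f2 w.
  rewrite /W /riemann_sum mulrA -/h -/kap mulr_sumr mulr_suml; apply: ler_sum => k _.
  rewrite -mulrA ler_wpM2l//.
  have -> : B (k.+1%:R * (t / m%:R)) w = x + g k.+1 + N k w.
    have t0E : tau 0%N = 0 by rewrite /tau mul0r.
    by rewrite /N t0E Dw -/h /tau; ring.
  apply: le_trans (ler_wpM2r (expR_ge0 (L w)) (potential_le (N k w) (ltn_ord k))) _.
  rewrite !mulrDl -addrA -!expRD lerD2l; apply: lerD; rewrite ler_expR;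
    rewrite /th /q le_eqVlt; apply/orP; left; apply/eqP; field; rewrite gt_eqF//.
have eL : expR ((1 + eta) * L w) = expR (L w) * expR (eta * L w).
  by rewrite -expRD; congr expR; ring.
rewrite WE eL.
have h4 : expR (- c) * (W * expR (L w)) <= expR (- c) * f2 w.
  by rewrite ler_wpM2l ?expR_ge0.
have h5 : expR (- c) * expR (L w) * L w <=
    expR (- c) * expR (L w) * (eta^-1 * (expR (eta * L w) - 1)).
  by rewrite ler_wpM2l// mulr_ge0 ?expR_ge0.
lra.
Qed.

End lower_bound_grid.

(** * Upper asymptotics *)

Lemma sum_ord_mul {V : nmodType} (n l : nat) (F : nat -> V) :
  \sum_(k < n * l) F k = \sum_(i < n) \sum_(j < l) F (i * l + j)%N.
Proof.
elim: n => [|n ih]; first by rewrite mul0n !big_ord0.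
by rewrite big_ord_recr/= -ih mulSnr big_split_ord.
Qed.

(** Jensen's inequality, from the tangent of [expR] at the mean [A]. *)
Lemma expR_mean {R : realType} (l : nat) (a : nat -> R) :
  expR (l.+1%:R^-1 * \sum_(j < l.+1) a j) <= \sum_(j < l.+1) l.+1%:R^-1 * expR (a j).
Proof.
set r := l.+1%:R^-1; set A := r * _.
have r0 : 0 <= r by rewrite invr_ge0.
have -> : expR A = \sum_(j < l.+1) r * (expR A * (1 + (a j - A))).
  rewrite -!mulr_sumr big_split/= sumrB !sumr_const card_ord.
  rewrite -[A *+ _]mulr_natr; have h : r * l.+1%:R = 1 by rewrite mulVf.
  rewrite mulrCA mulrDr h mulrBr -/A [A * _]mulrC mulrA h mul1r subrr addr0 mulr1//.
apply: ler_sum => j _; rewrite ler_wpM2l//.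
have -> : expR (a j) = expR A * expR (a j - A) by rewrite -expRD addrC subrK.
by rewrite ler_wpM2l ?expR_ge0// expR_ge1Dx.
Qed.

(** * Brownian scaling of the discrete bound *)

Section scaling.
Context {R : realType}.
Variables (alpha lambda : R).
Hypotheses (alpha_gt0 : 0 < alpha) (alpha_lt2 : alpha < 2) (lambda_gt0 : 0 < lambda).

(** The solution of [2 * scale - 1 = 1 - alpha * scale], which balances energy against potential;
    the common value is [rate]. *)
Definition scale : R := 2 / (2 + alpha).
Definition rate : R := (2 - alpha) / (2 + alpha).

Lemma rate_gt0 : 0 < rate.
Proof. by rewrite /rate divr_gt0 ?subr_gt0 ?addr_gt0. Qed.

Lemma powR_rate_scale (t : R) : 0 < t ->
  t `^ rate * (t `^ scale) `^ alpha = t /\ t `^ rate * t = (t `^ scale) ^+ 2.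
Proof.
move=> t0; have a0 : 2 + alpha != 0 by rewrite gt_eqF// addr_gt0.
have tD u v : t `^ u * t `^ v = t `^ (u + v).
  by rewrite powRD// (gt_eqF t0) implybT.
split.
  rewrite -powRrM tD (_ : _ + _ = 1) ?powRr1 ?ltW// /rate /scale; field; exact: a0.
rewrite -powR_mulrn ?powR_ge0// -powRrM -{2}[t]powRr1 ?ltW// tD; congr (_ `^ _).
by rewrite /rate /scale; field.
Qed.

(** The discrete bound on [I0] is applied to [b / t^scale], where the 1 of the potential becomes
    [eps] and [c] becomes the margin. Multiplying by [(1 + kappa)^-1] cancels the loss on the
    potential; the same factor, being less than 1, leaves the Gaussian squares exponentially
    integrable. *)
Lemma discrete_exponent (beta kappa c x t : R) (N : nat) (d b : nat -> R) :
  1 < 2 * beta -> alpha * beta < 1 -> 0 < kappa -> 0 < c -> 0 < t ->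
  1 <= kappa * c `^ alpha -> `|x| + c <= t `^ scale * N.+2%:R^-1 `^ beta ->
  N.+2%:R^-1 <= d 0%N -> d 0%N <= 2 * N.+2%:R^-1 ->
  (forall j, d j.+1 = N.+2%:R^-1) -> b 0%N = x ->
  (1 + kappa)^-1 / 2 * t `^ rate *
    (fine (I0 alpha lambda) - rise_cost alpha lambda beta N.+2%:R^-1) <=
  \sum_(j < N.+1) (1 + kappa)^-1 * (b j.+1 - b j) ^+ 2 / (2 * (t * d j)) +
  lambda / 2 * (t * N.+2%:R^-1 * \sum_(i < N) potential alpha (b i.+1)).
Proof.
move=> b1 ab1 k0 c0 t0 kc xc d0l d0u dS b0.
have [tr1 tr2] := powR_rate_scale t0.
set s := t `^ scale in xc tr1 tr2; set r := N.+2%:R^-1 in xc d0l d0u dS *.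
have s0 : 0 < s by exact: powR_gt0.
have r0 : 0 < r by rewrite invr_gt0.
have sa0 : 0 < s `^ alpha by exact: powR_gt0.
have sV : s^-1 `^ alpha = (s `^ alpha)^-1.
  by rewrite -[s^-1]powR_inv1 ?ltW// -powRrM mulN1r powRN.
have trp : 0 < t `^ rate by exact: powR_gt0.
have dp j : 0 < d j by case: j => [|j]; [exact: lt_le_trans d0l|rewrite dS].
have := @I0_le_discrete _ alpha lambda alpha_gt0 lambda_gt0 beta kappa (s `^ alpha)^-1
  (c / s) N d (fun i => b i / s) b1 ab1 (ltW k0) (divr_gt0 c0 s0).
rewrite invr_gt0 sa0 => /(_ isT).
have -> : (s `^ alpha)^-1 <= kappa * (c / s) `^ alpha.
  rewrite powRM ?invr_ge0 ?(ltW c0) ?(ltW s0)// sV mulrA ler_peMl//.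
  by rewrite invr_ge0 ltW.
have -> : `|b 0%N / s| + c / s <= N.+2%:R^-1 `^ beta.
  by rewrite normrM b0 [`|s^-1|]gtr0_norm ?invr_gt0// -mulrDl ler_pdivrMr// mulrC.
move=> /(_ isT isT d0l d0u dS).
have I0fin : I0 alpha lambda \is a fin_num.
  rewrite ge0_fin_numE; first exact: I0_ltoo.
  by rewrite ltW// I0_gt0.
rewrite -/r -[X in (X <= _)%E](fineK I0fin) lee_fin => H.
set k' := (1 + kappa)^-1 / 2 * t `^ rate.
have k'0 : 0 <= k' by rewrite !mulr_ge0// ?invr_ge0 ltW// ltr_wpDl.
have {}H := ler_wpM2l k'0 H.
rewrite mulrBr lerBlDl; apply: (le_trans H).
rewrite !mulrDr -addrA lerD2l; apply: lerD.
  rewrite mulr_sumr; apply: ler_sum => j _.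
  rewrite le_eqVlt; apply/orP; left; apply/eqP.
  have -> : (b j.+1 / s - b j / s) ^+ 2 = (b j.+1 - b j) ^+ 2 / (t `^ rate * t).
    by rewrite -mulrBl exprMn tr2 exprVn.
  by rewrite /k'; field; rewrite !gt_eqF// ltr_wpDl// ltW.
have -> : \sum_(i < N) ((s `^ alpha)^-1 + `|b i.+1 / s| `^ alpha)^-1 =
    s `^ alpha * \sum_(i < N) potential alpha (b i.+1).
  rewrite mulr_sumr; apply: eq_bigr => i _.
  rewrite /potential -[s `^ alpha in RHS]invrK -invfM; congr (_^-1).
  rewrite mulrDr mulr1; congr (_ + _).
  rewrite normrM [`|s^-1|]gtr0_norm ?invr_gt0// powRM ?invr_ge0 ?(ltW s0)//.
  by rewrite sV mulrC.
rewrite -[in leRHS]tr1 /k' le_eqVlt; apply/orP; left; apply/eqP.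
by field; rewrite gt_eqF// ltr_wpDl// ltW.
Qed.

End scaling.

(** * Upper bound of the partition function at fixed time *)

Section upper_bound.
Context {d : measure_display} {T : measurableType d} {R : realType}.
Variables (P : probability T R) (x : R) (B : R -> {RV P >-> R}).
Hypothesis BM : brownian_motion P x B.
Variables (alpha lambda beta kappa c t : R) (N : nat).
Hypotheses (alpha_gt0 : 0 < alpha) (alpha_lt2 : alpha < 2) (lambda_gt0 : 0 < lambda).
Hypotheses (beta_gt : 1 < 2 * beta) (alpha_beta : alpha * beta < 1).
Hypotheses (kappa_gt0 : 0 < kappa) (c_gt0 : 0 < c) (t_gt0 : 0 < t).
Hypotheses (kappa_c : 1 <= kappa * c `^ alpha)
  (t_large : `|x| + c <= t `^ scale alpha * N.+2%:R^-1 `^ beta).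

Let r : R := N.+2%:R^-1.
Let theta := (1 + kappa)^-1.

Let r_gt0 : 0 < r. Proof. by rewrite invr_gt0. Qed.

Let theta_lt1 : theta < 1.
Proof. by rewrite invf_lt1 ?ltrDl// ltr_wpDl// ltW. Qed.

Let theta_gt0 : 0 < theta.
Proof. by rewrite invr_gt0 ltr_wpDl// ltW. Qed.

(* Averaging over the shifts [v] recovers the sum over a finer grid. *)
Let tau v (i : nat) : R := if i is j.+1 then t * ((j.+1%:R + v) * r) else 0.

Let slice v w := expR (- (lambda / 2 *
  (t * r * \sum_(i < N) potential alpha (B (tau v i.+1) w)))).

Definition upper_value : R :=
  expR (- (theta / 2 * t `^ rate alpha *
    (fine (I0 alpha lambda) - rise_cost alpha lambda beta r))) *
  (Num.sqrt (1 - theta))^-1 ^+ N.+1.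

Let measurable_slice v : measurable_fun setT (slice v).
Proof.
apply: measurableT_comp => //; apply: measurableT_comp => //.
apply: measurable_funM => //; apply: measurable_funM => //.
by apply: measurable_sum => k; exact: measurable_path_potential.
Qed.

Let slice_bounds v w : 0 <= slice v w <= 1.
Proof.
rewrite expR_ge0 -expR0 ler_expR oppr_le0 mulr_ge0 ?divr_ge0 ?(ltW lambda_gt0)//.
rewrite mulr_ge0 ?mulr_ge0 ?(ltW t_gt0)// ?(ltW r_gt0)//.
by apply: sumr_ge0 => k _; case/andP: (potential_bounds alpha (B (tau v k.+1) w)).
Qed.

(* With [S] the sum of the [incr ^+ 2 / (2 * variance)], the deterministic bound
   makes [slice * expR (- theta * S)] small, and [expR (theta * S)] has finite mean
   since [theta < 1]. *)
Let slice_mean v : 0 <= v -> v <= 1 ->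
  fine (\int[P]_w (slice v w)%:E) <= upper_value.
Proof.
move=> v0 v1.
(* The first step is [(1 + v) * r], between [r] and [2 * r], which is why the discrete bound leaves
   it free in this range. *)
pose dl j := (tau v j.+1 - tau v j) / t.
have dlS j : dl j.+1 = r.
  rewrite /dl /tau -mulrBr mulrC mulKf ?gt_eqF// -mulrBl.
  by rewrite -[j.+2%:R]natr1 [_ - _](_ : _ = 1) ?mul1r//; ring.
have dl0 : dl 0%N = (1 + v) * r.
  by rewrite /dl /tau subr0 mulrC mulKf ?gt_eqF.
have dlp j : 0 < dl j.
  by case: j => [|j]; [rewrite dl0 mulr_gt0// ltr_pwDl|rewrite dlS].
have tdl j : tau v j.+1 - tau v j = t * dl j by rewrite /dl mulrC divfK// gt_eqF.
have tau_lt i : tau v i < tau v i.+1 by rewrite -subr_gt0 tdl mulr_gt0.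
have tau0 : 0 <= tau v 0 by [].
pose f j y := expR (theta * y ^+ 2 / (2 * (t * dl j))).
have mf j : measurable_fun setT (f j).
  apply: measurableT_comp => //; apply: measurable_funM => //.
  by apply: measurable_funM => //; exact: measurable_funX.
have Ef j : (\int[P]_w (f j (incr B (tau v) j w))%:E = ((Num.sqrt (1 - theta))^-1)%:E)%E.
  have s0 : 0 < Num.sqrt (tau v j.+1 - tau v j) by rewrite sqrtr_gt0 subr_gt0.
  have := gaussian_sqr_mgf s0 (measurable_incr B (tau v) j)
    (fun A => @incr_law _ _ _ P x B BM (tau v) tau0 tau_lt j A) theta_lt1.
  by rewrite sqr_sqrtr ?subr_ge0 ?(ltW (tau_lt j))// tdl.
pose G w := \prod_(j < N.+1) f j (incr B (tau v) j w).
have meanG : nonneg_mean P G ((Num.sqrt (1 - theta))^-1 ^+ N.+1).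
  split.
  - apply: measurable_prod => j _; apply: measurableT_comp => //; exact: measurable_incr.
  - by move=> w; apply: prodr_ge0 => j _; exact: expR_ge0.
  - rewrite (incr_expectation_prod BM tau0 tau_lt)//.
    + under eq_bigr do rewrite Ef/=.
      by rewrite prodr_const card_ord.
    + by move=> i y; exact: expR_ge0.
    + by move=> i; rewrite Ef ltry.
pose D := [set w | B 0 w = x].
have mD : measurable D.
  rewrite (_ : D = B 0 @^-1` [set x]); last by apply/seteqP; split.
  by rewrite -[X in measurable X]setTI; exact: measurable_funP.
have PD : P D = 1%E := bm_start BM.
rewrite /upper_value; set E0 := - (_ / _ * _ * _).
have mU := nonneg_meanZ (expR_ge0 E0) meanG.
have mS := nonneg_mean_fine P (measurable_slice v) (slice_bounds v).
apply: (nonneg_mean_le mD PD mS mU) => w Dw; rewrite /E0 {E0 mU}.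
rewrite /slice /G -expR_sum -expRD ler_expR.
have dl0l : r <= dl 0%N by rewrite dl0 ler_peMl ?(ltW r_gt0)// lerDl.
have dl0u : dl 0%N <= 2 * r by rewrite dl0 ler_pM2r//; lra.
have := @discrete_exponent _ alpha lambda alpha_gt0 alpha_lt2 lambda_gt0 beta kappa c x t N dl
  (fun i => B (tau v i) w) beta_gt alpha_beta kappa_gt0 c_gt0 t_gt0 kappa_c t_large
  dl0l dl0u dlS Dw.
rewrite -/r -/theta /incr; lra.
Qed.

(** The fine Riemann sum is a mean over the [l + 1] shifts of coarse sums, and Jensen's inequality
    takes the mean out of the exponential. *)
Lemma grid_weight_le_slices (l : nat) w :
  grid_weight B alpha lambda t (N.+2 * l.+1) w <=
  \sum_(j < l.+1) l.+1%:R^-1 * slice (j.+1%:R / l.+1%:R) w.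
Proof.
apply: le_trans (expR_mean l (fun j => - (lambda / 2 *
  (t * r * \sum_(i < N) potential alpha (B (tau (j.+1%:R / l.+1%:R) i.+1) w))))).
rewrite /grid_weight ler_expR /riemann_sum sumrN mulrN mulNr lerN2.
rewrite -mulr_sumr mulrCA ler_wpM2l ?divr_ge0 ?(ltW lambda_gt0)//.
rewrite -mulr_sumr mulrA (sum_ord_mul N.+2 l.+1
   (fun k => potential alpha (B (k.+1%:R * (t / (N.+2 * l.+1)%:R)) w))).
have -> : t / (N.+2 * l.+1)%:R = l.+1%:R^-1 * (t * r).
  by rewrite natrM invfM /r mulrA mulrC.
rewrite ler_wpM2l//; first by rewrite !mulr_ge0 ?invr_ge0// ltW.
rewrite [leRHS]exchange_big/=; apply: ler_sum => j _.
have pp u : 0 <= potential alpha u by case/andP: (potential_bounds alpha u).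
(* The first and the last of the [N + 2] coarse cells are dropped, since the potential is
   nonnegative. *)
rewrite big_ord_recl big_ord_recr/= addrCA -[leLHS]addr0.
rewrite lerD ?addr_ge0//.
apply: ler_sum => i _; rewrite /bump/= add1n.
rewrite le_eqVlt; apply/orP; left; apply/eqP; congr potential; congr (B _ w).
rewrite -addnS natrD natrM; field.
by rewrite nat1r pnatr_eq0.
Qed.

Lemma Z_le_upper_value : Z P alpha lambda B t <= upper_value.
Proof.
rewrite leNgt; apply/negP => lt.
have /cvgr_gt/(_ _ lt)[M _ HM] := grid_weight_cvg BM alpha_gt0 lambda_gt0 t_gt0.
(* The fine grid must refine the coarse one: a multiple of [N + 2] is taken beyond the rank [M]. *)
have E : (N.+2 * M.+1).-1.+1 = (N.+2 * M.+1)%N by [].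
have Mle : (M <= (N.+2 * M.+1).-1)%N by rewrite -ltnS E leq_pmull.
have := HM _ Mle; rewrite /= E.
apply/negP; rewrite -leNgt.
have mg : nonneg_mean P (grid_weight B alpha lambda t (N.+2 * M.+1)) _ :=
  nonneg_mean_fine P (measurable_grid_weight B lambda t alpha_gt0 _)
    (grid_weight_bounds B alpha lambda_gt0 t_gt0 _).
pose v (j : nat) : R := j.+1%:R / M.+1%:R.
have M0 : 0 <= M.+1%:R^-1 :> R by rewrite invr_ge0.
have ms := @nonneg_mean_sum _ _ _ P M.+1 _ _ (fun j (_ : (j < M.+1)%N) =>
  nonneg_meanZ M0
    (nonneg_mean_fine P (measurable_slice (v j)) (slice_bounds (v j)))).
have H := nonneg_mean_le measurableT (@probability_setT _ _ _ P) mg ms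
  (fun w _ => grid_weight_le_slices M w).
apply: (le_trans H).
have -> : upper_value = \sum_(j < M.+1) M.+1%:R^-1 * upper_value.
  by rewrite sumr_const card_ord -[RHS]mulr_natr mulrAC mulVf// mul1r.
apply: ler_sum => j _; rewrite ler_wpM2l//.
apply: slice_mean; first by rewrite divr_ge0.
by rewrite ler_pdivrMr// mul1r ler_nat.
Qed.

End upper_bound.

(** * Lower asymptotics *)

Section elementary.
Context {R : realType}.

(** The [p]-th power of [z / p <= expR (z / p)]. *)
Lemma expR_tail_le (p : nat) (z : R) : (0 < p)%N -> 0 < z ->
  expR (- z) <= (p%:R / z) ^+ p.
Proof.
move=> p0 z0; have pR : 0 < p%:R :> R by rewrite ltr0n.
have e1 : z / p%:R <= expR (z / p%:R).
  by rewrite (le_trans _ (expR_ge1Dx _))// lerDr.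
have -> : expR (- z) = (expR (z / p%:R) ^+ p)^-1.
  by rewrite -expRM_natl mulrC divfK ?gt_eqF// expRN.
rewrite -[p%:R / z]invf_div exprVn.
rewrite lef_pV2 ?posrE ?exprn_gt0 ?expR_gt0 ?divr_gt0//.
by rewrite lerXn2r ?nnegrE ?expR_ge0// divr_ge0 ?ltW.
Qed.

Lemma sum_inv_sqrt_le (m : nat) :
  \sum_(k < m) (Num.sqrt k.+1%:R)^-1 <= 2 * Num.sqrt m%:R :> R.
Proof.
elim: m => [|m ih]; first by rewrite big_ord0 sqrtr0 mulr0.
rewrite big_ord_recr/=.
have s0 : 0 < Num.sqrt (m.+1%:R : R) by rewrite sqrtr_gt0.
have h1 : Num.sqrt (m.+1%:R : R) ^+ 2 = m%:R + 1 by rewrite sqr_sqrtr// natr1.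
have h2 : Num.sqrt (m%:R : R) ^+ 2 = m%:R by rewrite sqr_sqrtr.
suff : (Num.sqrt (m.+1%:R : R))^-1 <= 2 * (Num.sqrt m.+1%:R - Num.sqrt m%:R) by lra.
rewrite -(ler_pM2l s0) divff ?gt_eqF//.
have := sqr_ge0 (Num.sqrt (m.+1%:R : R) - Num.sqrt m%:R); nra.
Qed.

(** The modulus of [u^beta], in the same form as for paths of finite energy. Homogeneity reduces it
    to [v = 1], [u = x]; there [1 - x^beta] is at most [1 - x], and at most
    [n * (1 - x^(2 * beta - 1))] by Bernoulli's inequality. *)
Lemma powR_sqr_incr (beta : R) (n : nat) (u v : R) :
  1 < 2 * beta -> beta <= 1 -> beta <= n%:R * (2 * beta - 1) -> 0 <= u -> u <= v ->
  (v `^ beta - u `^ beta) ^+ 2 <=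
  (v - u) * (n%:R * (v `^ (2 * beta - 1) - u `^ (2 * beta - 1))).
Proof.
move=> b1 b2 bn u0 uv; set del := 2 * beta - 1 in bn *.
have d0 : 0 < del by rewrite /del; lra.
have b0 : 0 < beta by lra.
have [v0|v0] := leP v 0.
  have -> : v = u by apply/eqP; rewrite eq_le uv andbT (le_trans v0).
  by rewrite !subrr expr0n/= mul0r.
have n0 : (0 < n)%N.
  by rewrite lt0n; apply/eqP => n0; move: bn; rewrite n0 mul0r; lra.
pose x := u / v.
have x0 : 0 <= x by rewrite divr_ge0// ltW.
have x1 : x <= 1 by rewrite ler_pdivrMr// mul1r.
have -> : u = v * x by rewrite mulrC divfK// gt_eqF.
move: x x0 x1 => x x0 x1 {uv u0 u}.
rewrite !powRM ?(ltW v0)//.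
have vb : (v `^ beta) ^+ 2 = v * v `^ del.
  rewrite -powR_mulrn ?powR_ge0// -powRrM -{2}[v]powRr1 ?(ltW v0)//.
  rewrite -powRD ?(gt_eqF v0) ?implybT//; congr (_ `^ _); rewrite /del; ring.
have -> : (v `^ beta - v `^ beta * x `^ beta) ^+ 2 = v * v `^ del * (1 - x `^ beta) ^+ 2.
  by rewrite -vb; ring.
have -> : (v - v * x) * (n%:R * (v `^ del - v `^ del * x `^ del)) =
    v * v `^ del * ((1 - x) * (n%:R * (1 - x `^ del))) by ring.
rewrite ler_pM2l ?mulr_gt0 ?powR_gt0//.
move: x0; rewrite le_eqVlt => /predU1P[<-|x0].
  by rewrite !powR0 ?gt_eqF// !subr0 expr1n mul1r mulr1 ler1n.
have x01 : 0 < x <= 1 by rewrite x0.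
have xb1 : x `^ beta <= 1 by rewrite -[leRHS](powRr0 x) ger_powR// ltW.
have xd1 : x `^ del <= 1 by rewrite -[leRHS](powRr0 x) ger_powR// ltW.
have h1 : x <= x `^ beta by rewrite -[leLHS]powRr1 ?(ltW x0)// ger_powR.
have h2 : x `^ del ^+ n <= x `^ beta.
  by rewrite -powR_mulrn ?powR_ge0// -powRrM ger_powR// mulrC.
have h3 : 1 - n%:R * (1 - x `^ del) <= x `^ del ^+ n.
  have := powR_ge0 x del; move: xd1; set y := x `^ del => y1 y0.
  elim: n {bn n0 h2} => [|n ih]; first by rewrite mul0r subr0 expr0.
  have yn1 : y ^+ n <= 1 by exact: exprn_ile1.
  rewrite exprS -natr1; nra.
rewrite expr2; apply: ler_pM; rewrite ?subr_ge0//; lra.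
Qed.

End elementary.

(** * Running supremum of a path of finite energy *)

Section running_sup.
Context {R : realType}.
Local Notation mu := (@lebesgue_measure R).
Variables (psi Phi : R -> R).
Hypothesis modulus : forall u v, 0 <= u -> u <= v -> v <= 1 ->
  0 <= Phi v - Phi u /\ (psi v - psi u) ^+ 2 <= (v - u) * (Phi v - Phi u).
Hypotheses (psi0 : psi 0 = 0) (Phi0 : Phi 0 = 0).

Definition running_sup (u : R) : R := sup [set `|psi s| | s in `[0, u]].

Let dist_le u s v : 0 <= u -> u <= s -> s <= v -> v <= 1 ->
  `|psi s - psi u| <= Num.sqrt ((v - u) * (Phi v - Phi u)).
Proof.
move=> u0 us sv v1.
have [p1 p2] := modulus u0 us (le_trans sv v1).
have [p3 _] := modulus (le_trans u0 us) sv v1.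
rewrite -sqrtr_sqr ler_wsqrtr// (le_trans p2)//; apply: ler_pM => //; lra.
Qed.

Let has_sup_psi u : 0 <= u -> u <= 1 -> has_sup [set `|psi s| | s in `[0, u]].
Proof.
move=> u0 u1; split; first by exists `|psi 0|; exists 0 => //=; rewrite in_itv/= lexx.
exists (Num.sqrt ((u - 0) * (Phi u - Phi 0))) => _ /= [s + <-].
by rewrite in_itv/= => /andP[s0 su]; have := dist_le (lexx 0) s0 su u1; rewrite psi0 subr0.
Qed.

Lemma le_running_sup s u : 0 <= s -> s <= u -> u <= 1 -> `|psi s| <= running_sup u.
Proof.
move=> s0 su u1; apply: ub_le_sup.
  by have [] := has_sup_psi (le_trans s0 su) u1.
by exists s => //=; rewrite in_itv/= s0.
Qed.

Lemma running_sup_ge0 u : 0 <= u -> u <= 1 -> 0 <= running_sup u.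
Proof. by move=> u0 u1; rewrite (le_trans _ (le_running_sup u0 (lexx u) u1)). Qed.

Lemma running_sup0 : running_sup 0 = 0.
Proof.
rewrite /running_sup set_itv1 image_set1 sup1 psi0 normr0//.
Qed.

(** After time [u], [|psi|] exceeds [|psi u|] by at most the square root of the right-hand side, and
    so does the supremum. No derivative of the supremum is involved. *)
Lemma running_sup_incr u v : 0 <= u -> u <= v -> v <= 1 ->
  (running_sup v - running_sup u) ^+ 2 <= (v - u) * (Phi v - Phi u).
Proof.
move=> u0 uv v1; have [p1 p2] := modulus u0 uv v1.
have u1 := le_trans uv v1; have v0 := le_trans u0 uv.
have q0 : 0 <= (v - u) * (Phi v - Phi u) by rewrite mulr_ge0// subr_ge0.
have le1 : running_sup u <= running_sup v.
  apply: ge_sup; first by have [] := has_sup_psi u0 u1.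
  move=> _ /= [s + <-]; rewrite in_itv/= => /andP[s0 su].
  exact: le_running_sup (le_trans su uv) v1.
have le2 : running_sup v <= running_sup u + Num.sqrt ((v - u) * (Phi v - Phi u)).
  apply: ge_sup; first by have [] := has_sup_psi v0 v1.
  move=> _ /= [s + <-]; rewrite in_itv/= => /andP[s0 sv].
  have [su|us] := leP s u.
    by rewrite (le_trans (le_running_sup s0 su u1))// lerDl sqrtr_ge0.
  have := dist_le u0 (ltW us) sv v1; have := le_running_sup u0 (lexx u) u1.
  have := lerB_dist (psi s) (psi u); lra.
rewrite -[leRHS]sqr_sqrtr// ler_sqr ?nnegrE ?sqrtr_ge0 ?subr_ge0//; lra.
Qed.

Variables (alpha beta kappa c Pot : R) (n m : nat).
Hypotheses (alpha_gt0 : 0 < alpha) (beta_gt : 1 < 2 * beta) (beta_le1 : beta <= 1)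
  (beta_n : beta <= n%:R * (2 * beta - 1)).
Hypotheses (kappa_gt0 : 0 < kappa) (c_gt0 : 0 < c) (m_gt0 : (0 < m)%N).
Hypothesis PotE :
  (\int[mu]_(s in `[0%R, 1%R]) ((`|psi s| `^ alpha)%:E)^-1 <= Pot%:E)%E.

(** The supremum dominates [|psi|], so the potential does not grow; the power provides an explicit
    lower bound near 0, to which the noise can be compared. *)
Definition rising (u : R) : R := running_sup u + c * u `^ beta.

Let node (k : nat) : R := k%:R / m%:R.

Let mR : 0 < m%:R :> R. Proof. by rewrite ltr0n. Qed.

Let node_ge0 k : 0 <= node k. Proof. by rewrite divr_ge0. Qed.

Let node_le1 k : (k <= m)%N -> node k <= 1.
Proof. by move=> km; rewrite ler_pdivrMr// mul1r ler_nat. Qed.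

Let nodeS k : node k.+1 - node k = m%:R^-1.
Proof. by rewrite /node -mulrBl -natrB// subSnn mul1r. Qed.

Lemma rising0 : rising 0 = 0.
Proof.
have b0 : beta != 0 by apply/eqP => b0; move: beta_gt; rewrite b0 mulr0 ltr10.
by rewrite /rising running_sup0 powR0// mulr0 addr0.
Qed.

Lemma rising_ge u : 0 <= u -> u <= 1 -> c * u `^ beta <= rising u.
Proof. by move=> u0 u1; rewrite lerDr running_sup_ge0. Qed.

(** From [(X + Y)^2 <= (1 + kappa) * X^2 + (1 + 1 / kappa) * Y^2] and the two moduli, whose
    right-hand sides telescope. *)
Lemma rising_energy :
  \sum_(k < m) m%:R * (rising (node k.+1) - rising (node k)) ^+ 2 <=
  (1 + kappa) * Phi 1 + (1 + kappa^-1) * (c ^+ 2 * n%:R).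
Proof.
pose del := 2 * beta - 1.
pose G k := (1 + kappa) * Phi (node k) + (1 + kappa^-1) * (c ^+ 2 * (n%:R * node k `^ del)).
have -> : (1 + kappa) * Phi 1 + (1 + kappa^-1) * (c ^+ 2 * n%:R) = G m - G 0%N.
  rewrite /G /node mul0r Phi0 divff ?gt_eqF// powR1 powR0 ?gt_eqF ?subr_gt0//; ring.
rewrite -(telescope_sumr (fun k => G k))// big_mkord; apply: ler_sum => k _.
have uv : node k <= node k.+1 by rewrite -subr_ge0 nodeS invr_ge0 ltW.
have v1 : node k.+1 <= 1 by exact: node_le1.
have H1 := running_sup_incr (node_ge0 k) uv v1.
have H2 := powR_sqr_incr beta_gt beta_le1 beta_n (node_ge0 k) uv.
rewrite /rising; move: H1 H2; rewrite nodeS -/del /G.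
set a := running_sup _; set b := running_sup _; set a' := _ `^ beta; set b' := _ `^ beta.
move=> H1 H2.
have H3 : (a + c * a' - (b + c * b')) ^+ 2 <=
    (1 + kappa) * (a - b) ^+ 2 + (1 + kappa^-1) * (c ^+ 2 * (a' - b') ^+ 2).
  set X := a - b; set Y := c * (a' - b').
  have -> : a + c * a' - (b + c * b') = X + Y by rewrite /X /Y; ring.
  have -> : c ^+ 2 * (a' - b') ^+ 2 = Y ^+ 2 by rewrite /Y exprMn.
  have : 0 <= (kappa * X - Y) ^+ 2 / kappa by rewrite divr_ge0 ?sqr_ge0// ltW.
  have -> : (kappa * X - Y) ^+ 2 / kappa = kappa * X ^+ 2 - 2 * (X * Y) + kappa^-1 * Y ^+ 2.
    by field; rewrite gt_eqF.
  move: X Y kappa^-1 => X Y i; nra.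
have k1 : 0 <= 1 + kappa by rewrite addr_ge0// ltW.
have k2 : 0 <= (1 + kappa^-1) * c ^+ 2 by rewrite mulr_ge0 ?sqr_ge0// addr_ge0// invr_ge0 ltW.
have H4 := ler_wpM2l k1 H1; have H5 := ler_wpM2l k2 H2.
rewrite -ler_pdivlMl// (le_trans H3)//; move: H4 H5; lra.
Qed.

(** At the right end of a cell, [rising] dominates [|psi|] over the whole cell, so the sum is the
    integral of a step function below the inverse potential of [psi]. *)
Lemma rising_potential :
  m%:R^-1 * \sum_(k < m) (rising (node k.+1) `^ alpha)^-1 <= Pot.
Proof.
rewrite -lee_fin (le_trans _ PotE)//.
have h0 : 0 < m%:R^-1 :> R by rewrite invr_gt0.
have mh : m%:R * m%:R^-1 = 1 :> R by rewrite mulfV// gt_eqF.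
rewrite -(@integral_step_fun _ m _ (fun k => (rising (node k.+1) `^ alpha)^-1))//; last first.
  by move=> k; rewrite invr_ge0 powR_ge0.
rewrite [X in `]0%R, X]]mh.
have st0 s : 0 <= step_fun m m%:R^-1 (fun k => (rising (node k.+1) `^ alpha)^-1) s.
  by apply: sumr_ge0 => k _; rewrite mulr_ge0// invr_ge0 powR_ge0.
apply: ge0_le_integral_subset => [s _|s _|s].
- by rewrite lee_fin.
- by rewrite inve_ge0 lee_fin powR_ge0.
rewrite /= !in_itv/= => /andP[s0 s1]; split; first by rewrite ltW.
have [|k k1 k2] := @grid_cell _ m m%:R^-1 s s0; first by rewrite mh.
rewrite (step_funE _ h0 k1 k2).
have nk : node k.+1 <= 1 by exact: node_le1.
have Mk := le_running_sup (ltW s0) k2 nk.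
rewrite inver; case: ifPn => [_|pn0]; first exact: leey.
have cp : 0 < c * node k.+1 `^ beta by rewrite mulr_gt0// powR_gt0// divr_gt0.
rewrite lee_fin lef_pV2 ?posrE; last 2 first.
- by rewrite powR_gt0// (lt_le_trans cp)// rising_ge.
- by rewrite lt_neqAle eq_sym pn0 powR_ge0.
rewrite ge0_ler_powR ?nnegrE ?(ltW alpha_gt0)//.
  by rewrite (le_trans (ltW cp))// rising_ge.
by rewrite (le_trans Mk)// lerDl ltW.
Qed.

End running_sup.

(** * Lower bound of the partition function at fixed time *)

Section lower_bound.
Context {d : measure_display} {T : measurableType d} {R : realType}.
Local Notation mu := (@lebesgue_measure R).
Variables (P : probability T R) (x : R) (B : R -> {RV P >-> R}).
Hypothesis BM : brownian_motion P x B.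
Variables (alpha lambda kappa c t Pot : R) (p : nat) (psi Phi : R -> R).
Hypotheses (alpha_gt0 : 0 < alpha) (lambda_gt0 : 0 < lambda).
Hypotheses (kappa_gt0 : 0 < kappa) (kappa_lt1 : kappa < 1) (c_gt0 : 0 < c).
Hypotheses (p_gt0 : (0 < p)%N) (p_large : 1 <= rate alpha * p%:R) (t_ge1 : 1 <= t).
Hypothesis modulus : forall u v, 0 <= u -> u <= v -> v <= 1 ->
  0 <= Phi v - Phi u /\ (psi v - psi u) ^+ 2 <= (v - u) * (Phi v - Phi u).
Hypotheses (psi0 : psi 0 = 0) (Phi0 : Phi 0 = 0).
Hypothesis PotE :
  (\int[mu]_(s in `[0%R, 1%R]) ((`|psi s| `^ alpha)%:E)^-1 <= Pot%:E)%E.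

(* This exponent makes the tail terms of the grid bound decay like [u `^ (-1/2)],
   which is summable near [u = 0]. *)
Let beta : R := 2^-1 + (4 * p%:R)^-1.
Let s := t `^ scale alpha.
Let lift_path := rising psi beta c.
Let tail : R := (2 * p%:R / (kappa * c) ^+ 2) ^+ p.

Definition lower_value : R :=
  expR (- (t `^ rate alpha / 2 * ((1 + kappa) * Phi 1 + (1 + kappa^-1) * (c ^+ 2 * p.+1%:R) +
     lambda * (((1 - kappa) `^ alpha)^-1 * Pot)) + (1 + 2 * lambda * tail))).

Let t_gt0 : 0 < t. Proof. exact: lt_le_trans t_ge1. Qed.

Let s_gt0 : 0 < s. Proof. exact: powR_gt0. Qed.

Let p_ge1 : 1 <= p%:R :> R. Proof. by rewrite ler1n. Qed.

Let pR : 0 < p%:R :> R. Proof. by rewrite ltr0n. Qed.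

Let betaE : 2 * beta - 1 = (2 * p%:R)^-1.
Proof. by rewrite /beta; field; rewrite gt_eqF. Qed.

Let beta_gt : 1 < 2 * beta.
Proof. by rewrite -subr_gt0 betaE invr_gt0 mulr_gt0. Qed.

Let beta_le1 : beta <= 1.
Proof.
have : (2 * p%:R)^-1 <= 1 :> R by rewrite invf_le1 ?mulr_gt0//; have := p_ge1; lra.
rewrite -betaE; lra.
Qed.

Let beta_p : beta <= p.+1%:R * (2 * beta - 1).
Proof.
rewrite betaE -natr1 -subr_ge0 /beta.
have -> : (p%:R + 1) * (2 * p%:R)^-1 - (2^-1 + (4 * p%:R)^-1) = (4 * p%:R)^-1 :> R.
  by field; rewrite gt_eqF.
by rewrite invr_ge0 mulr_ge0.
Qed.

Section grid.
Variable m : nat.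
Hypothesis m_gt0 : (0 < m)%N.

Let mR : 0 < m%:R :> R. Proof. by rewrite ltr0n. Qed.

Let node (k : nat) : R := k%:R / m%:R.

Let node_ge0 k : 0 <= node k. Proof. by rewrite divr_ge0. Qed.

Let node_gt0 k : 0 < node k.+1. Proof. by rewrite divr_gt0. Qed.

Let node_le1 k : (k <= m)%N -> node k <= 1.
Proof. by move=> km; rewrite ler_pdivrMr// mul1r ler_nat. Qed.

Let h := t / m%:R.

Let tauE k : k%:R * h = node k * t.
Proof. by rewrite /h /node; ring. Qed.

(* With the sign of [x], the drift can only move the path away from [0]. *)
Let sg : R := if 0 <= x then 1 else -1.

Let g k := sg * (s * lift_path (node k)).
Let v k := (((1 - kappa) * (s * lift_path (node k.+1))) `^ alpha)^-1.
Let A k := kappa * (s * lift_path (node k.+1)).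

Let lift_gt0 k : (k < m)%N -> 0 < lift_path (node k.+1).
Proof.
move=> km; apply: lt_le_trans (rising_ge modulus psi0 _ c (node_ge0 k.+1) (node_le1 km)).
by rewrite mulr_gt0// powR_gt0.
Qed.

(** Either the noise is at most [kappa] times the path, whose distance to 0 keeps a proportion
    [1 - kappa], or one of the exponentials is at least 1 and exceeds the potential. *)
Let potential_le k y : (k < m)%N ->
  potential alpha (x + g k.+1 + y) <=
  v k + expR (A k / (k.+1%:R * h) * (y - A k)) + expR (A k / (k.+1%:R * h) * (- y - A k)).
Proof.
move=> km; have L0 := lift_gt0 km; set G := s * lift_path (node k.+1).
have G0 : 0 < G by exact: mulr_gt0.
have /andP[V0 V1] := potential_bounds alpha (x + g k.+1 + y).
have v0 : 0 <= v k by rewrite invr_ge0 powR_ge0.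
have A0 : 0 <= A k / (k.+1%:R * h) by rewrite divr_ge0 ?mulr_ge0// ltW// divr_gt0.
have [yA|yA] := leP `|y| (A k).
  rewrite !ler_wpDr ?expR_ge0//.
  have kG : 0 < (1 - kappa) * G by rewrite mulr_gt0// subr_gt0.
  have dist : (1 - kappa) * G <= `|x + g k.+1 + y|.
    have : G <= `|x + g k.+1|.
      rewrite /g /sg -/G; case: (leP 0 x) => x0.
        by rewrite mul1r ger0_norm ?addr_ge0 ?(ltW G0)// lerDr.
      by rewrite mulN1r ltr0_norm; lra.
    have := lerB_dist (x + g k.+1) (- y); rewrite opprK normrN.
    move: yA; rewrite /A -/G; lra.
  rewrite /potential /v -/G lef_pV2 ?posrE ?powR_gt0// ?ltr_pwDl ?powR_ge0//.
  rewrite ler_wpDl// ge0_ler_powR ?nnegrE ?(ltW alpha_gt0)// ltW//.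
have [y0|y0] := leP 0 y.
  have e1 : 1 <= expR (A k / (k.+1%:R * h) * (y - A k)).
    by rewrite (le_trans _ (expR_ge1Dx _))// lerDl mulr_ge0// subr_ge0 ltW// (lt_le_trans yA)// ger0_norm.
  have := expR_ge0 (A k / (k.+1%:R * h) * (- y - A k)); lra.
have e1 : 1 <= expR (A k / (k.+1%:R * h) * (- y - A k)).
  by rewrite (le_trans _ (expR_ge1Dx _))// lerDl mulr_ge0// subr_ge0 ltW// (lt_le_trans yA)// ltr0_norm.
have := expR_ge0 (A k / (k.+1%:R * h) * (y - A k)); lra.
Qed.

Let energy_le : \sum_(i < m) (g i.+1 - g i) ^+ 2 / (2 * h) <=
  t `^ rate alpha / 2 * ((1 + kappa) * Phi 1 + (1 + kappa^-1) * (c ^+ 2 * p.+1%:R)).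
Proof.
have [_ tr2] := powR_rate_scale alpha_gt0 t_gt0.
have trp : 0 < t `^ rate alpha by exact: powR_gt0.
have := rising_energy modulus psi0 Phi0 c beta_gt beta_le1 beta_p kappa_gt0 m_gt0.
rewrite -(ler_pM2l (_ : 0 < t `^ rate alpha / 2)) ?divr_gt0//; apply: le_trans.
rewrite mulr_sumr; apply: ler_sum => i _; rewrite le_eqVlt; apply/orP; left; apply/eqP.
have sg2 : sg ^+ 2 = 1 by rewrite /sg; case: ifP => _; rewrite ?sqrrN expr1n.
rewrite /g -mulrBr -mulrBr exprMn sg2 mul1r exprMn -tr2 /h /lift_path /node.
by field; rewrite !gt_eqF.
Qed.

Let potential_sum_le :
  lambda / 2 * h * \sum_(k < m) v k <=
  t `^ rate alpha / 2 * (lambda * (((1 - kappa) `^ alpha)^-1 * Pot)).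
Proof.
have [tr1 _] := powR_rate_scale alpha_gt0 t_gt0.
have sa : 0 < s `^ alpha by exact: powR_gt0.
have k1 : 0 <= 1 - kappa by rewrite subr_ge0 ltW.
have ka : 0 < (1 - kappa) `^ alpha by rewrite powR_gt0// subr_gt0.
have := rising_potential modulus psi0 beta alpha_gt0 c_gt0 m_gt0 PotE.
set S := \sum_(k < m) _ => H.
have -> : \sum_(k < m) v k = ((1 - kappa) `^ alpha)^-1 * (s `^ alpha)^-1 * S.
  rewrite mulr_sumr; apply: eq_bigr => k _.
  have L0 := ltW (lift_gt0 (ltn_ord k)).
  by rewrite /v powRM ?mulr_ge0 ?(ltW s_gt0)// powRM ?(ltW s_gt0)// !invfM mulrA.
have -> : lambda / 2 * h * (((1 - kappa) `^ alpha)^-1 * (s `^ alpha)^-1 * S) =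
   t `^ rate alpha / 2 * (lambda * ((1 - kappa) `^ alpha)^-1) * (m%:R^-1 * S).
  have -> : h = t `^ rate alpha * s `^ alpha / m%:R by rewrite tr1.
  by field; rewrite !gt_eqF.
rewrite [lambda * (_ * Pot)]mulrA [leRHS]mulrA ler_wpM2l//.
by rewrite !mulr_ge0 ?invr_ge0 ?powR_ge0// ltW.
Qed.

(** The exponent is at least a multiple of [t^rate * u^(2 * beta - 1)]. Its [p]-th power is at least
    that of [t * sqrt u]: [p * (2 * beta - 1) = 1 / 2], and [rate * p >= 1] with [t >= 1]. *)
Let tail_le k : (k < m)%N ->
  expR (- (A k ^+ 2 / (2 * (k.+1%:R * h)))) <= tail / (t * Num.sqrt (node k.+1)).
Proof.
move=> km; set u := node k.+1; have u0 : 0 < u by exact: node_gt0.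
have [_ tr2] := powR_rate_scale alpha_gt0 t_gt0.
set del := 2 * beta - 1.
have trp : 0 < t `^ rate alpha by exact: powR_gt0.
have kc0 : 0 < kappa * c by exact: mulr_gt0.
pose z := (kappa * c) ^+ 2 * (t `^ rate alpha * u `^ del) / 2.
have ud : 0 < u `^ del by exact: powR_gt0.
have z0 : 0 < z by rewrite divr_gt0// mulr_gt0 ?exprn_gt0// mulr_gt0.
have zA : z <= A k ^+ 2 / (2 * (k.+1%:R * h)).
  rewrite tauE -/u ler_pdivlMr; last by rewrite mulr_gt0// mulr_gt0.
  have -> : z * (2 * (u * t)) = (kappa * (s * (c * u `^ beta))) ^+ 2.
    have ub : (u `^ beta) ^+ 2 = u * u `^ del.
      rewrite -powR_mulrn ?powR_ge0// -powRrM -{2}[u]powRr1 ?(ltW u0)//.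
      rewrite -powRD ?(gt_eqF u0) ?implybT//; congr (_ `^ _); rewrite /del; ring.
    by rewrite !exprMn ub -tr2 /z; field.
  have cu : 0 <= c * u `^ beta by rewrite mulr_ge0 ?powR_ge0// ltW.
  have cl : c * u `^ beta <= lift_path u.
    exact: (rising_ge modulus psi0 _ c (node_ge0 k.+1) (node_le1 km)).
  have X0 : 0 <= kappa * (s * (c * u `^ beta)).
    by rewrite mulr_ge0 ?(ltW kappa_gt0)// mulr_ge0 ?(ltW s_gt0).
  have X1 : kappa * (s * (c * u `^ beta)) <= A k.
    by rewrite ler_wpM2l ?(ltW kappa_gt0)// ler_wpM2l ?(ltW s_gt0).
  by rewrite ler_sqr ?nnegrE// (le_trans X0).
apply: (@le_trans _ _ (expR (- z))).
  by rewrite ler_expR lerN2.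
apply: (le_trans (expR_tail_le p_gt0 z0)).
have -> : p%:R / z = 2 * p%:R / (kappa * c) ^+ 2 / (t `^ rate alpha * u `^ del).
  by rewrite /z; field; rewrite !gt_eqF.
rewrite exprMn -/tail ler_wpM2l ?exprn_ge0 ?divr_ge0 ?sqr_ge0//.
rewrite exprVn lef_pV2 ?posrE ?exprn_gt0 ?mulr_gt0 ?sqrtr_gt0//.
rewrite exprMn; apply: ler_pM; rewrite ?sqrtr_ge0 ?(ltW t_gt0)//.
  rewrite -powR_mulrn ?powR_ge0// -powRrM -{1}[t]powRr1 ?(ltW t_gt0)//.
  by rewrite ler_powR.
rewrite -powR_mulrn ?powR_ge0// -powRrM -powR12_sqrt ?(ltW u0)//.
rewrite le_eqVlt; apply/orP; left; apply/eqP; congr (_ `^ _).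
by rewrite /del betaE; field; rewrite gt_eqF.
Qed.

(** Up to constants, a Riemann sum of [u^(- 1 / 2)] over [[0, 1]], which is at most 2 for every
    [m]. *)
Let tail_sum_le :
  lambda / 2 * h * \sum_(k < m) 2 * expR (- (A k ^+ 2 / (2 * (k.+1%:R * h)))) <=
  2 * lambda * tail.
Proof.
have sm : 0 < Num.sqrt (m%:R : R) by rewrite sqrtr_gt0.
have sm2 : Num.sqrt (m%:R : R) ^+ 2 = m%:R by rewrite sqr_sqrtr.
have tail0 : 0 <= tail by rewrite exprn_ge0// divr_ge0 ?sqr_ge0.
have H : \sum_(k < m) 2 * expR (- (A k ^+ 2 / (2 * (k.+1%:R * h)))) <=
    2 * (tail / t) * Num.sqrt m%:R * \sum_(k < m) (Num.sqrt k.+1%:R)^-1.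
  rewrite mulr_sumr; apply: ler_sum => k _.
  have -> : 2 * (tail / t) * Num.sqrt m%:R * (Num.sqrt k.+1%:R)^-1 =
      2 * (tail / (t * Num.sqrt (node k.+1))).
    rewrite /node sqrtrM// sqrtrV//; field.
    by rewrite !gt_eqF// sqrtr_gt0.
  by rewrite ler_pM2l//; exact: tail_le.
have hl : 0 <= lambda / 2 * h by rewrite mulr_ge0 ?divr_ge0 ?(ltW lambda_gt0) ?(ltW t_gt0).
apply: (le_trans (ler_wpM2l hl H)).
have H2 : 0 <= lambda / 2 * h * (2 * (tail / t) * Num.sqrt m%:R).
  by rewrite mulr_ge0// mulr_ge0 ?sqrtr_ge0// mulr_ge0// divr_ge0// ltW.
have H3 := ler_wpM2l H2 (@sum_inv_sqrt_le R m).
rewrite [leLHS]mulrA; apply: (le_trans H3).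
rewrite (_ : h = t / Num.sqrt m%:R ^+ 2); last by rewrite sm2.
rewrite le_eqVlt; apply/orP; left; apply/eqP; field.
by rewrite !gt_eqF.
Qed.

Lemma lower_value_le_grid :
  lower_value <= fine (\int[P]_w (grid_weight B alpha lambda t m w)%:E).
Proof.
have g0 : g 0 = 0 by rewrite /g /node mul0r /lift_path rising0// !mulr0.
have v0 k : 0 <= v k by rewrite invr_ge0 powR_ge0.
have := grid_lower_bound BM alpha_gt0 lambda_gt0 t_gt0 m_gt0 g0 v0 potential_le.
apply: le_trans; rewrite /lower_value ler_expR lerN2 big_split/=.
have := energy_le; have := potential_sum_le; have := tail_sum_le.
rewrite -/h; set S1 := \sum_(_ < _) _; set S2 := \sum_(_ < _) _; set S3 := \sum_(_ < _) _.
rewrite [_ * (S2 + S1)]mulrDr [t `^ rate alpha / 2 * (_ + _ + _)]mulrDr; lra.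
Qed.

End grid.

Lemma lower_value_le_Z : lower_value <= Z P alpha lambda B t.
Proof.
rewrite leNgt; apply/negP => lt.
have /cvgr_lt/(_ _ lt)[M _ HM] := grid_weight_cvg BM alpha_gt0 lambda_gt0 t_gt0.
have := HM M (leqnn M); apply/negP; rewrite -leNgt.
exact: lower_value_le_grid.
Qed.

End lower_bound.

(** * The limit *)

Section asymptotics.
Context {d : measure_display} {T : measurableType d} {R : realType}.
Variables (P : probability T R) (x : R) (B : R -> {RV P >-> R}).
Hypothesis BM : brownian_motion P x B.
Variables (alpha lambda : R).
Hypotheses (alpha_gt0 : 0 < alpha) (alpha_lt2 : alpha < 2) (lambda_gt0 : 0 < lambda).

Local Notation I := (fine (I0 alpha lambda)).

Let I0E : I0 alpha lambda = I%:E.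
Proof.
rewrite fineK// ge0_fin_numE; first exact: I0_ltoo.
by rewrite ltW// I0_gt0.
Qed.

Let I_gt0 : 0 < I.
Proof. by rewrite -lte_fin -I0E I0_gt0. Qed.

Lemma near_powR_ge (a M : R) : 0 < a -> \forall t \near +oo, M <= t `^ a.
Proof.
move=> a0; near=> t.
have tM : `|M| `^ a^-1 <= t by near: t; exact: nbhs_pinfty_ge.
rewrite (le_trans (ler_norm M))// -[leLHS]powRr1// -(mulVf (lt0r_neq0 a0)) powRrM.
by rewrite ge0_ler_powR ?nnegrE ?(ltW a0)// ?powR_ge0// (le_trans _ tM)// powR_ge0.
Unshelve. all: by end_near. Qed.

(** A third of [e] is spent on the near-minimality of [psi], a third on [kappa] and a third on the
    energy of [c * u^beta]; all constants are fixed before [t]. Positivity of [Z] is recorded as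
    well, since [ln] has a default value at nonpositive reals. *)
Lemma lower_asymptotics (e : R) : 0 < e -> \forall t \near +oo,
  0 < Z P alpha lambda B t /\
  - (I / 2) - e <= (t `^ rate alpha)^-1 * ln (Z P alpha lambda B t).
Proof.
move=> e0; have e30 : 0 < e / 3 by rewrite divr_gt0.
have I0fin : I0 alpha lambda \is a fin_num by rewrite I0E.
have [_ [psi [cpsi psi0] <-] act] := lb_ereal_inf_adherent e30 I0fin.
rewrite -/(I0 alpha lambda) I0E -EFinD in act; move: act; rewrite /action.
have pot0 : (0 <= \int[lebesgue_measure]_(s in `[0%R, 1%R]) ((`|psi s| `^ alpha)%:E)^-1)%E.
  by apply: integral_ge0 => s _; rewrite inve_ge0 lee_fin powR_ge0.
rewrite /energy; case: asboolP => [ac|_]; last first.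
  by rewrite addye ?ltNge ?leey// gt_eqF// (lt_le_trans (ltNyr 0))// mule_ge0// lee_fin ltW.
set En := (\int[_]_(_ in _) _)%E; set Po := (\int[_]_(_ in _) _)%E in pot0 *.
have en0 : (0 <= En)%E by apply: integral_ge0 => s _; rewrite lee_fin sqr_ge0.
move=> act.
have lpo0 : (0 <= lambda%:E * Po)%E by rewrite mule_ge0// lee_fin ltW.
have Enfin : En \is a fin_num.
  by rewrite ge0_fin_numE// (le_lt_trans _ (lt_trans act (ltry _)))// leeDl.
have Pofin : Po \is a fin_num.
  rewrite ge0_fin_numE// ltNge; apply/negP; rewrite leye_eq => /eqP Poy.
  by move: act; rewrite Poy gt0_muley// addey ?gt_eqF ?(lt_le_trans (ltNyr 0))// ltNge leey.
have [Phi [modulus Phi0 Phi1]] :=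
  energy_modulus ltr01 ac (lt_trans (le_lt_trans (leeDl _ lpo0) act) (ltry _)).
move: act Phi1; rewrite -/En -(fineK Enfin) -(fineK Pofin) -EFinM -EFinD lte_fin lee_fin.
move: en0 pot0; rewrite -{1}(fineK Enfin) -{1}(fineK Pofin) !lee_fin.
set E := fine En; set Q := fine Po => E0 Q0 act Phi1.
pose p := (Num.truncn (rate alpha)^-1).+1.
have r0 : 0 < rate alpha by exact: rate_gt0.
have p_large : 1 <= rate alpha * p%:R.
  by rewrite mulrC -ler_pdivrMr// mul1r ltW// /p truncnS_gt.
(* [E + 4 * (lambda * Q)] is the coefficient of [kappa] in the error; the 1 makes [D] positive. *)
pose D := E + 4 * (lambda * Q) + 1.
have lQ : 0 <= lambda * Q by rewrite mulr_ge0// ltW.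
have D0 : 0 < D by rewrite /D; lra.
pose kappa := Num.min 4^-1 (e / 3 / D).
have k0 : 0 < kappa by rewrite lt_min invr_gt0 !divr_gt0// ltr0n.
have k4 : kappa <= 4^-1 by rewrite ge_min lexx.
have kD : kappa * D <= e / 3 by rewrite -ler_pdivlMr// ge_min lexx orbT.
have k1 : kappa < 1 by lra.
(* Since [alpha < 2], the power is at least [(1 - kappa)^2], and [kappa <= 1 / 4] allows the linear
   bound. *)
have kpow : ((1 - kappa) `^ alpha)^-1 <= 1 + 4 * kappa.
  have k1' : 0 < 1 - kappa by rewrite subr_gt0.
  have h2 : (1 - kappa) ^+ 2 <= (1 - kappa) `^ alpha.
    rewrite -powR_mulrn ?(ltW k1')// ger_powR ?(ltW alpha_lt2)// k1'/=; lra.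
  apply: (@le_trans _ _ ((1 - kappa) ^+ 2)^-1).
    by rewrite lef_pV2 ?posrE ?powR_gt0// exprn_gt0.
  rewrite -[leLHS]mul1r ler_pdivrMr ?exprn_gt0//.
  have h4 : 0 <= (4^-1 - kappa) * kappa by rewrite mulr_ge0 ?subr_ge0// ltW.
  have h5 : 0 <= kappa * kappa * kappa by rewrite !mulr_ge0// ltW.
  rewrite -subr_ge0.
  have -> : (1 + 4 * kappa) * (1 - kappa) ^+ 2 - 1 =
    7 * ((4^-1 - kappa) * kappa) + 4 * (kappa * kappa * kappa) + kappa / 4 by field.
  lra.
have K0 : 0 < (1 + kappa^-1) * p.+1%:R.
  by rewrite mulr_gt0// addr_gt0// invr_gt0.
(* Chosen so that the added power costs exactly [e / 3]. *)
pose c := Num.sqrt (e / 3 / ((1 + kappa^-1) * p.+1%:R)).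
have c0 : 0 < c by rewrite sqrtr_gt0 divr_gt0.
have c2 : (1 + kappa^-1) * (c ^+ 2 * p.+1%:R) = e / 3.
  have -> : c ^+ 2 = e / 3 / ((1 + kappa^-1) * p.+1%:R).
    by rewrite sqr_sqrtr// divr_ge0 ?(ltW K0) ?(ltW e30).
  by rewrite mulrCA divfK// gt_eqF.
pose M := 1 + 2 * lambda * (2 * p%:R / (kappa * c) ^+ 2) ^+ p.
have main : (1 + kappa) * Phi 1 + (1 + kappa^-1) * (c ^+ 2 * p.+1%:R) +
     lambda * (((1 - kappa) `^ alpha)^-1 * Q) <= I + e.
  rewrite c2.
  have h1 : (1 + kappa) * Phi 1 <= (1 + kappa) * E by rewrite ler_wpM2l// addr_ge0// ltW.
  have h2 : lambda * (((1 - kappa) `^ alpha)^-1 * Q) <= (1 + 4 * kappa) * (lambda * Q).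
    by rewrite mulrCA ler_wpM2r.
  move: kD; rewrite /D; lra.
near=> t.
have t1 : 1 <= t by near: t; exact: nbhs_pinfty_ge.
have tM : M / (e / 2) <= t `^ rate alpha by near: t; exact: near_powR_ge.
have t0 : 0 < t by exact: lt_le_trans t1.
have tr0 : 0 < t `^ rate alpha by exact: powR_gt0.
have PotE : (Po <= Q%:E)%E by rewrite fineK.
have := lower_value_le_Z BM alpha_gt0 lambda_gt0 k0 k1 c0 (ltn0Sn _)
  p_large t1 modulus psi0 Phi0 PotE.
rewrite /lower_value -/M => LZ.
have Z0 : 0 < Z P alpha lambda B t by rewrite (lt_le_trans _ LZ) ?expR_gt0.
split => //; rewrite -(ler_pM2l tr0) mulrA mulfV ?gt_eqF// mul1r.
rewrite -ler_expR lnK ?posrE//; apply: le_trans LZ; rewrite ler_expR.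
have h1 := ler_wpM2l (ltW tr0) main.
have h2 : M <= t `^ rate alpha * (e / 2) by rewrite -ler_pdivrMr// divr_gt0.
move: h1 h2; set A := (_ + _ + _); move: (t `^ _) A => r A.
lra.
Unshelve. all: by end_near. Qed.

(** [kappa] and then [N] are fixed before [t]: the Gaussian constant [K] depends on them only, and
    its logarithm is negligible against [t^rate]. *)
Lemma upper_asymptotics (e : R) : 0 < e -> \forall t \near +oo,
  0 < Z P alpha lambda B t ->
  (t `^ rate alpha)^-1 * ln (Z P alpha lambda B t) <= - (I / 2) + e.
Proof.
move=> e0; have e20 : 0 < e / 2 by rewrite divr_gt0.
have [beta [b1 ab1]] := supercritical_exponent alpha_gt0 alpha_lt2.
have I1 : 0 < I + 1 by rewrite addr_gt0.
(* Makes the loss [(1 - theta) * I] at most [e / 2]; the added 1 keeps the inequality simple. *)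
pose kappa := e / 2 / (I + 1).
have k0 : 0 < kappa by rewrite divr_gt0.
pose theta := (1 + kappa)^-1.
have k1 : 0 < 1 + kappa by rewrite addr_gt0.
have th0 : 0 < theta by rewrite invr_gt0.
have th1 : theta < 1 by rewrite invf_lt1// ltrDl.
have thI : (1 - theta) * I <= e / 2.
  have -> : 1 - theta = kappa * theta by rewrite /theta; field; rewrite gt_eqF.
  have -> : e / 2 = kappa * (I + 1) by rewrite /kappa divfK// gt_eqF.
  rewrite -mulrA ler_pM2l// (@le_trans _ _ I)//; last by rewrite lerDl.
  by rewrite ler_piMl// ltW.
have [N _ /(_ N (leqnn N))/= HN] := rise_cost_cvg lambda b1 ab1 e20.
(* The solution of [kappa * c^alpha = 1]. *)
pose c := (kappa^-1) `^ alpha^-1.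
have c0 : 0 < c by rewrite powR_gt0// invr_gt0.
have kc : 1 <= kappa * c `^ alpha.
  rewrite /c -powRrM mulVf ?gt_eqF// powRr1 ?invr_ge0 ?(ltW k0)//.
  by rewrite mulfV// gt_eqF.
pose K := (Num.sqrt (1 - theta))^-1 ^+ N.+1.
have K0 : 0 < K by rewrite exprn_gt0// invr_gt0 sqrtr_gt0 subr_gt0.
have rb : 0 < N.+2%:R^-1 `^ beta :> R by rewrite powR_gt0// invr_gt0.
near=> t => Z0.
have t1 : 1 <= t by near: t; exact: nbhs_pinfty_ge.
have t0 : 0 < t by exact: lt_le_trans t1.
have tr0 : 0 < t `^ rate alpha by exact: powR_gt0.
have tM : ln K / (e / 2) <= t `^ rate alpha.
  by near: t; apply: near_powR_ge; exact: rate_gt0.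
have tS : (`|x| + c) / N.+2%:R^-1 `^ beta <= t `^ scale alpha.
  by near: t; apply: near_powR_ge; rewrite divr_gt0// addr_gt0.
rewrite ler_pdivrMr// in tS.
have := Z_le_upper_value BM alpha_gt0 alpha_lt2 lambda_gt0 b1 ab1 k0 c0 t0 kc tS.
rewrite /upper_value -/theta -/K => ZU.
rewrite -(ler_pM2l tr0) mulrA mulfV ?gt_eqF// mul1r.
rewrite -ler_expR lnK ?posrE//; apply: (le_trans ZU).
rewrite -[X in _ * X <= _]lnK ?posrE// -expRD ler_expR.
have h2 : ln K <= t `^ rate alpha * (e / 2) by rewrite -ler_pdivrMr.
apply: (le_trans (lerD (lexx _) h2)).
set C := rise_cost _ _ _ _ in HN *.
have -> : - (theta / 2 * t `^ rate alpha * (I - C)) + t `^ rate alpha * (e / 2) =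
  t `^ rate alpha * (- (theta / 2 * (I - C)) + e / 2) by ring.
rewrite ler_pM2l//.
have thC : theta * C <= e / 2.
  by rewrite (@le_trans _ _ (theta * (e / 2)))// ?ler_pM2l ?(ltW HN)// ler_piMl ?(ltW e20)// ltW.
move: thI thC; lra.
Unshelve. all: by end_near. Qed.

End asymptotics.

Theorem theorem8p1 (R : realType) (alpha lambda : R)
    (alpha_gt0 : 0 < alpha) (alpha_lt2 : alpha < 2) (lambda_gt0 : 0 < lambda) :
  (0 < I0 alpha lambda < +oo)%E /\
  forall (x : R) (d : measure_display) (T : measurableType d)
    (P : probability T R) (B : R -> {RV P >-> R}),
    brownian_motion P x B ->
    t `^ ((alpha - 2) / (alpha + 2)) * ln (Z P alpha lambda B t) @[t --> +oo]
      --> - (1 / 2) * fine (I0 alpha lambda).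
Proof.
split; first by rewrite I0_gt0//= I0_ltoo.
move=> x d T P B BM; apply/cvgrPdist_le => e e0.
have lower := lower_asymptotics BM alpha_gt0 alpha_lt2 lambda_gt0 e0.
have upper := upper_asymptotics BM alpha_gt0 alpha_lt2 lambda_gt0 e0.
near=> t.
have -> : t `^ ((alpha - 2) / (alpha + 2)) = (t `^ rate alpha)^-1.
  rewrite -powRN; congr (_ `^ _); rewrite /rate.
  by field; rewrite gt_eqF// addr_gt0.
have [Z0 h1] : 0 < Z P alpha lambda B t /\ - (fine (I0 alpha lambda) / 2) - e <=
    (t `^ rate alpha)^-1 * ln (Z P alpha lambda B t) by near: t.
have h2 : (t `^ rate alpha)^-1 * ln (Z P alpha lambda B t) <=
    - (fine (I0 alpha lambda) / 2) + e.
  by move: Z0; near: t.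
by rewrite ler_norml; apply/andP; split; lra.
Unshelve. all: by end_near. Qed.
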